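(* Let $R$ be an associative unital ring. Consider the following conditions on $R$: (2) every acyclic complex of injective $R$-modules is totally acyclic; (3) every acyclic complex of flat $R$-modules is $F$-totally acyclic; $(2)^{op}$ every acyclic complex of injective $R^{op}$-modules is totally acyclic; $(3)^{op}$ every acyclic complex of flat $R^{op}$-modules is $F$-totally acyclic. Assume that one of the following holds: (a) $R$ satisfies (2) if and only if $R$ satisfies (3); (b) $R$ satisfies (2) if and only if $R$ satisfies $(2)^{op}$; (c) $R$ satisfies (3) if and only if $R$ satisfies $(3)^{op}$. If the character module of every injective $R^{op}$-module has finite flat dimension (as an $R$-module), then $\mathrm{spli}(R)=\mathrm{silp}(R)$.
   Context: All rings are associative and unital; ''$R$-module'' means left $R$-module, and $R^{op}$ is the opposite ring, so $R^{op}$-modules are right $R$-modules. The notions below are applied also with $R^{op}$ in place of $R$. An acyclic (i.e. exact, unbounded in both directions) complex $X^\bullet$ of injective $R$-modules is totally acyclic if $\mathrm{Hom}_R(M,X^\bullet)$ is exact for every injective $R$-module $M$. An acyclic complex $X^\bullet$ of flat $R$-modules is $F$-totally acyclic if $E\otimes_R X^\bullet$ is exact for every injective $R^{op}$-module $E$. The character module of a module $M$ is $M^+=\mathrm{Hom}_{\mathbb{Z}}(M,\mathbb{Q}/\mathbb{Z})$; it is an $R$-module when $M$ is an $R^{op}$-module. $\mathrm{spli}(R)$ is the supremum of the projective dimensions of injective $R$-modules; $\mathrm{silp}(R)$ is the supremum of the injective dimensions of projective $R$-modules (values in $\mathbb{N}\cup\{\infty\}$). *)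

(* Defs.v *)
From HB Require Import structures.
From mathcomp Require Import all_boot all_order all_algebra.
From mathcomp Require Import generic_quotient ring_quotient.
From mathcomp Require Import boolp.
From mathcomp Require Import freeg.

Set Implicit Arguments.
Unset Strict Implicit.
Unset Printing Implicit Defensive.

Import GRing.Theory Num.Theory.
Local Open Scope ring_scope.
Local Open Scope quotient_scope.

(* Left R-modules are [lmodType R]; right R-modules, i.e. modules over the
   opposite ring, are [lmodType R^c].  Rings are [pzRingType], so the zero ring
   is allowed. *)

Inductive enat := Fin of nat | Infinity.

Definition ele (a b : enat) : bool :=
  match a, b with
  | _, Infinity => true
  | Infinity, Fin _ => false
  | Fin m, Fin n => (m <= n)%N
  end.

Lemma ex_asbool (P : nat -> Prop) : (exists n, P n) -> exists n, `[< P n >].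
Proof. by case=> n Pn; exists n; apply/asboolP. Qed.

Definition einf (P : nat -> Prop) : enat :=
  if pselect (exists n, P n) is left h then Fin (ex_minn (ex_asbool h))
  else Infinity.

Definition esup (S : enat -> Prop) : enat :=
  einf (fun n => forall v, S v -> ele v (Fin n)).

Lemma esup_ub (S : enat -> Prop) v : S v -> ele v (esup S).
Proof.
move=> Sv; rewrite /esup /einf; case: pselect => [h|_]; last by case: v Sv.
by case: ex_minnP => n /asboolP + _; apply.
Qed.

Lemma esup_least (S : enat -> Prop) b :
  (forall v, S v -> ele v b) -> ele (esup S) b.
Proof.
case: b => [b|] Sb; last by case: (esup S).
rewrite /esup /einf; case: pselect => [h|[]]; last by exists b.
by case: ex_minnP => n _ /(_ b); apply; apply/asboolP.
Qed.

Definition exact (A B C : zmodType) (f : A -> B) (g : B -> C) : Prop :=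
  forall y, g y = 0 <-> exists x, f x = y.

Lemma linear_ext (R : pzRingType) (M N : lmodType R) (f g : {linear M -> N}) :
  f =1 g -> f = g.
Proof.
case: f g => [f [[f1] [f2]]] [g [[g1] [g2]]] /= /funext fg.
move: f1 f2 g1 g2; rewrite fg => f1 f2 g1 g2.
by rewrite (Prop_irrelevance f1 g1) (Prop_irrelevance f2 g2).
Qed.

Lemma additive_ext (U V : zmodType) (f g : {additive U -> V}) :
  f =1 g -> f = g.
Proof.
case: f g => [f [[f1]]] [g [[g1]]] /= /funext fg.
by move: f1 g1; rewrite fg => f1 g1; rewrite (Prop_irrelevance f1 g1).
Qed.

Section Hom.
Variables (R : pzRingType) (M N : lmodType R).

Definition Hom : Type := {linear M -> N}.

HB.instance Definition _ := gen_eqMixin Hom.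
HB.instance Definition _ := gen_choiceMixin Hom.

Definition Hom_fun (f : Hom) : {linear M -> N} := f.

Let zero : Hom := (\0 : M -> N).
Let opp (f : Hom) : Hom := (\- (Hom_fun f)).
Let add (f g : Hom) : Hom := (Hom_fun f \+ Hom_fun g).

Fact Hom_addA : associative add.
Proof. by move=> f g h; apply: linear_ext => x /=; rewrite addrA. Qed.
Fact Hom_addC : commutative add.
Proof. by move=> f g; apply: linear_ext => x /=; rewrite addrC. Qed.
Fact Hom_add0 : left_id zero add.
Proof. by move=> f; apply: linear_ext => x /=; rewrite add0r. Qed.
Fact Hom_addN : left_inverse zero opp add.
Proof. by move=> f; apply: linear_ext => x /=; rewrite addNr. Qed.
HB.instance Definition _ :=
  GRing.isZmodule.Build Hom Hom_addA Hom_addC Hom_add0 Hom_addN.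

End Hom.

Definition Hom_map (R : pzRingType) (M N N' : lmodType R)
  (g : {linear N -> N'}) : Hom M N -> Hom M N' :=
  fun f => (g \o Hom_fun f).

Section Tensor.
Variables (R : pzRingType) (E : lmodType R^c) (M : lmodType R).

Notation F := {freeg (E * M)%type / int}.
Notation "[: e , m :]" := (<< (e, m) >> : F).

(* The subgroup of the free abelian group on E x M generated by the relations. *)
Inductive tensor_rel : F -> Prop :=
| tensor_rel0 : tensor_rel 0
| tensor_relB x y : tensor_rel x -> tensor_rel y -> tensor_rel (x - y)
| tensor_relDl e e' m : tensor_rel ([: e + e', m :] - ([: e, m :] + [: e', m :]))
| tensor_relDr e m m' : tensor_rel ([: e, m + m' :] - ([: e, m :] + [: e, m' :]))
  (* with E as a right module, this reads (e r) (x) m = e (x) (r m) *)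
| tensor_relZ (r : R) e m :
    tensor_rel ([: (r : R^c) *: e, m :] - [: e, r *: m :]).

Definition tensor_null : pred F := fun x => `[< tensor_rel x >].

Fact tensor_null_zmod_closed : zmod_closed tensor_null.
Proof.
split=> [|x y /asboolP rx /asboolP ry]; apply/asboolP.
  exact: tensor_rel0.
exact: tensor_relB.
Qed.
HB.instance Definition _ :=
  GRing.isZmodClosed.Build F tensor_null tensor_null_zmod_closed.

Definition tensor : Type :=
  @Quotient.quot F (GRing.ZmodClosed.clone F tensor_null _).
HB.instance Definition _ := GRing.Zmodule.on tensor.
HB.instance Definition _ := ZmodQuotient.on tensor.

Definition tens (e : E) (m : M) : tensor := \pi_tensor [: e, m :].

End Tensor.

Definition balanced (R : pzRingType) (E : lmodType R^c) (M : lmodType R)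
    (V : zmodType) (b : E -> M -> V) : Prop :=
  [/\ forall e e' m, b (e + e') m = b e m + b e' m,
      forall e m m', b e (m + m') = b e m + b e m' &
      forall (r : R) e m, b ((r : R^c) *: e) m = b e (r *: m)].

Lemma tens_balanced (R : pzRingType) (E : lmodType R^c) (M : lmodType R) :
  balanced (@tens R E M).
Proof.
by split=> *; rewrite /tens -?raddfD; apply/eqP; rewrite -Quotient.idealrBE;
   apply/asboolP; constructor.
Qed.

(* The map of the universal property: for balanced [b], [tensor_lift b] is the
   additive map sending [tens e m] to [b e m]. *)
Definition tensor_lift (R : pzRingType) (E : lmodType R^c) (M : lmodType R)
    (V : zmodType) (b : E -> M -> V) (t : tensor E M) : V :=
  fglift (fun p : E * M => b p.1 p.2 : zmodule V) (repr t).

Section TensorLift.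
Variables (R : pzRingType) (E : lmodType R^c) (M : lmodType R) (V : zmodType).
Variables (b : E -> M -> V) (bP : balanced b).

Notation L := (fglift (fun p : E * M => b p.1 p.2 : zmodule V)).

Let LB : {morph L : x y / x - y}. Proof. exact: lift_is_additive. Qed.
Let L0 : L 0 = 0. Proof. by rewrite -[X in L X](subrr 0) LB subrr. Qed.
Let LD : {morph L : x y / x + y}.
Proof. by move=> x y; rewrite -[y in LHS]opprK -[- y]add0r !LB L0 sub0r opprK. Qed.
Let LU e m : L << (e, m) >> = b e m. Proof. by rewrite liftU scale1r. Qed.

Let L_null x : tensor_null x -> L x = 0.
Proof.
case: bP => bDl bDr bZ /asboolP; elim=> {x}.
- exact: L0.
- by move=> x y _ Lx _ Ly; rewrite LB Lx Ly subrr.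
- by move=> e e' m; rewrite LB LD !LU bDl subrr.
- by move=> e m m'; rewrite LB LD !LU bDr subrr.
- by move=> r e m; rewrite LB !LU bZ subrr.
Qed.

Let L_pi x : tensor_lift b (\pi x) = L x.
Proof.
apply/eqP; rewrite -subr_eq0 /tensor_lift -LB L_null //.
by have /eqP := reprK (\pi_(tensor E M) x); rewrite -Quotient.idealrBE.
Qed.

Lemma tensor_liftE e m : tensor_lift b (tens e m) = b e m.
Proof. by rewrite L_pi LU. Qed.

Lemma tensor_liftB : {morph tensor_lift b : x y / x - y}.
Proof.
by move=> x y; rewrite -[x]reprK -[y]reprK -raddfB !L_pi LB.
Qed.

End TensorLift.

Section TensorMap.
Variables (R : pzRingType) (E E' : lmodType R^c) (M M' : lmodType R).
Variables (f : {linear E -> E'}) (g : {linear M -> M'}).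

Definition tensor_map : tensor E M -> tensor E' M' :=
  tensor_lift (fun e m => tens (f e) (g m)).

Lemma tensor_map_balanced : balanced (fun e m => tens (f e) (g m)).
Proof.
have [tDl tDr tZ] := tens_balanced E' M'.
by split=> *; rewrite ?linearD ?linearZ_LR ?tDl ?tDr ?tZ.
Qed.

Fact tensor_map_is_zmod_morphism : zmod_morphism tensor_map.
Proof. exact: (tensor_liftB tensor_map_balanced). Qed.
HB.instance Definition _ := GRing.isZmodMorphism.Build
  (tensor E M) (tensor E' M') tensor_map tensor_map_is_zmod_morphism.

Lemma tensor_mapE e m : tensor_map (tens e m) = tens (f e) (g m).
Proof. exact: (tensor_liftE tensor_map_balanced). Qed.

End TensorMap.

Definition is_int : pred rat := fun x => x \is a Num.int.

Fact is_int_zmod_closed : zmod_closed is_int.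
Proof. by split=> [|x y]; [exact: rpred0 | exact: rpredB]. Qed.
HB.instance Definition _ :=
  GRing.isZmodClosed.Build rat is_int is_int_zmod_closed.

Definition QmodZ : zmodType :=
  {ideal_quot GRing.ZmodClosed.clone rat is_int _}.

Section Character.
Variables (R : pzRingType) (E : lmodType R^c).

Definition character : Type := {additive E -> QmodZ}.

HB.instance Definition _ := gen_eqMixin character.
HB.instance Definition _ := gen_choiceMixin character.

Definition character_fun (f : character) : {additive E -> QmodZ} := f.

Let zero : character := (\0 : E -> QmodZ).
Let opp (f : character) : character := \- character_fun f.
Let add (f g : character) : character := character_fun f \+ character_fun g.
(* [(r : R^c) *: x] is x r, so (r f)(x) = f (x r) *)
Let scale (r : R) (f : character) : character :=
  character_fun f \o *:%R (r : R^c).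

Fact character_addA : associative add.
Proof. by move=> f g h; apply: additive_ext => x /=; rewrite addrA. Qed.
Fact character_addC : commutative add.
Proof. by move=> f g; apply: additive_ext => x /=; rewrite addrC. Qed.
Fact character_add0 : left_id zero add.
Proof. by move=> f; apply: additive_ext => x /=; rewrite add0r. Qed.
Fact character_addN : left_inverse zero opp add.
Proof. by move=> f; apply: additive_ext => x /=; rewrite addNr. Qed.
HB.instance Definition _ := GRing.isZmodule.Build character
  character_addA character_addC character_add0 character_addN.

Fact character_scaleA r s f : scale r (scale s f) = scale (r * s) f.
Proof. by apply: additive_ext => x /=; rewrite scalerA. Qed.
Fact character_scale1 : left_id 1 scale.
Proof. by move=> f; apply: additive_ext => x /=; rewrite scale1r. Qed.
Fact character_scaleDr : right_distributive scale +%R.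
Proof. by move=> r f g; apply: additive_ext. Qed.
Fact character_scaleDl f : {morph scale^~ f : r s / r + s}.
Proof.
by move=> r s; apply: additive_ext => x /=; rewrite scalerDl raddfD.
Qed.
HB.instance Definition _ := GRing.Zmodule_isLmodule.Build R character
  character_scaleA character_scale1 character_scaleDr character_scaleDl.

End Character.

Definition projective_module (R : pzRingType) (P : lmodType R) : Prop :=
  forall (A B : lmodType R) (p : {linear A -> B}) (f : {linear P -> B}),
    (forall b, exists a, p a = b) -> exists g : {linear P -> A}, p \o g =1 f.

Definition injective_module (R : pzRingType) (I : lmodType R) : Prop :=
  forall (A B : lmodType R) (i : {linear A -> B}) (f : {linear A -> I}),
    injective i -> exists g : {linear B -> I}, g \o i =1 f.

Definition flat_module (R : pzRingType) (M : lmodType R) : Prop :=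
  forall (A B C : lmodType R^c) (f : {linear A -> B}) (g : {linear B -> C}),
    exact f g ->
    exact (tensor_map f (idfun : {linear M -> M}))
          (tensor_map g (idfun : {linear M -> M})).

(* M has a resolution ... -> P 1 -> P 0 -> M -> 0 with terms in C and P i = 0
   for i > n. *)
Definition left_resolution_le (R : pzRingType) (C : lmodType R -> Prop)
    (M : lmodType R) (n : nat) : Prop :=
  exists (P : nat -> lmodType R) (d : forall i, {linear P i.+1 -> P i})
         (eps : {linear P 0%N -> M}),
    [/\ forall i, C (P i),
        forall i, (n < i)%N -> forall x : P i, x = 0,
        forall m, exists x, eps x = m,
        exact (d 0%N) eps &
        forall i, exact (d i.+1) (d i)].

Definition right_resolution_le (R : pzRingType) (C : lmodType R -> Prop)
    (M : lmodType R) (n : nat) : Prop :=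
  exists (I : nat -> lmodType R) (d : forall i, {linear I i -> I i.+1})
         (eta : {linear M -> I 0%N}),
    [/\ forall i, C (I i),
        forall i, (n < i)%N -> forall x : I i, x = 0,
        injective eta,
        exact eta (d 0%N) &
        forall i, exact (d i) (d i.+1)].

Definition proj_dim (R : pzRingType) (M : lmodType R) : enat :=
  einf (left_resolution_le (@projective_module R) M).

Definition flat_dim (R : pzRingType) (M : lmodType R) : enat :=
  einf (left_resolution_le (@flat_module R) M).

Definition inj_dim (R : pzRingType) (M : lmodType R) : enat :=
  einf (right_resolution_le (@injective_module R) M).

Definition spli (R : pzRingType) : enat :=
  esup (fun v => exists M : lmodType R, injective_module M /\ v = proj_dim M).

Definition silp (R : pzRingType) : enat :=
  esup (fun v => exists M : lmodType R, projective_module M /\ v = inj_dim M).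

Record complex (R : pzRingType) := Complex {
  term :> int -> lmodType R;
  differential : forall i, {linear term i -> term (i + 1)};
  differentialK : forall i x, differential (i + 1) (differential i x) = 0
}.

Section Complexes.
Variable R : pzRingType.
Implicit Type X : complex R.

Definition acyclic X : Prop := forall i, exact (differential X i) (differential X (i + 1)).

Definition Hom_acyclic (M : lmodType R) X : Prop :=
  forall i, exact (@Hom_map R M _ _ (differential X i)) (Hom_map (differential X (i + 1))).

Definition tensor_acyclic (E : lmodType R^c) X : Prop :=
  forall i, exact (tensor_map (idfun : {linear E -> E}) (differential X i))
                  (tensor_map (idfun : {linear E -> E}) (differential X (i + 1))).

Definition acyclic_of_injectives X : Prop :=
  acyclic X /\ forall i, injective_module (X i).

Definition acyclic_of_flats X : Prop :=
  acyclic X /\ forall i, flat_module (X i).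

Definition totally_acyclic X : Prop :=
  acyclic_of_injectives X /\
  forall M : lmodType R, injective_module M -> Hom_acyclic M X.

Definition F_totally_acyclic X : Prop :=
  acyclic_of_flats X /\
  forall E : lmodType R^c, injective_module E -> tensor_acyclic E X.

End Complexes.

Definition acyclic_injectives_totally_acyclic (R : pzRingType) : Prop :=
  forall X : complex R, acyclic_of_injectives X -> totally_acyclic X.

Definition acyclic_flats_F_totally_acyclic (R : pzRingType) : Prop :=
  forall X : complex R, acyclic_of_flats X -> F_totally_acyclic X.

(* Main.v *)
(* If K is pure in a free module P, finitely many elements of K are fixed by
   some map P -> K. Closing subsets of K under such maps and extending partial
   lifts by Zorn's lemma shows that Hom(F, X) is exact for F = P/K flat and X
   an acyclic complex of injectives. Hence (2) holds as soon as all injectives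
   have finite flat dimension, and character modules turn (2)^op into (3).

   Suppose spli(R) = n is finite. Then (2) holds, and each of (a), (b), (c)
   yields (3). For P projective, let P -> J^0 -> J^1 -> ... be the pure exact
   sequence obtained by iterating M |-> M^++ / M. By (3) and the hypothesis on
   character modules, maps from an acyclic complex of projectives to P extend
   to this sequence, and by purity they are then null-homotopic. Every N is a
   retract of the cycle of a periodic complex whose terms have projective
   dimension at most n; its n-th syzygy is the cycle of an acyclic complex of
   projectives, so Ext^(n+1)(N, P) = 0 and silp(R) <= n.

   Suppose silp(R) = n is finite. Dually, every N is a retract of
   the cycle of a periodic complex whose terms have injective dimension at
   most n, and its n-th cosyzygy is the cycle of an acyclic complex of
   injectives; so any A for which Hom(A, -) is exact on such complexes has
   projective dimension at most n. This applies to flat modules, hence modules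
   of finite flat dimension have injective dimension at most n. For characters
   of injective right modules E this bounds the flat dimension of E, which
   gives (2)^op, then (3), and through each of (a), (b), (c) also (2). Now A
   may be taken injective, so spli(R) <= n. *)

Require Import Defs.
From mathcomp Require Import all_boot all_order all_algebra.
From HB Require Import structures.
From mathcomp Require Import generic_quotient ring_quotient.
From mathcomp Require Import boolp classical_sets freeg.

Set Implicit Arguments.
Unset Strict Implicit.
Unset Printing Implicit Defensive.

Import Order.TTheory GRing.Theory Num.Theory.
Local Open Scope ring_scope.
Local Open Scope quotient_scope.

(** Dimension bounds are available for injectives and projectives only, while Ext must vanish on an
    arbitrary module [N]. Adding up all terms of a two-sided resolution of [N] repairs this: the sum
    has bounded dimension whatever [N] is, and n syzygies or cosyzygies make it projective, flat or
    injective. A module with an exact square-zero endomorphism then replaces integer-indexed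
    complexes.

    The complexes are unbounded, so neither lifts nor homotopies can be built by induction on the
    degree from a first one. Zorn's lemma adds one element at a time instead; each addition involves
    only finitely many elements per stage or degree, where purity applies.

    In case (c) with silp(R) finite, only (3)^op is obtained directly. The bound n on the flat
    dimension of injective right modules is then used again: Ext^(n+1)(N, I^+) vanishes for
    injective left modules I, since (3)^op applies to the n-th syzygy of a periodic complex of flat
    dimension at most n. So injective left modules have flat dimension at most n, and (2)
    follows. *)

Lemma semiring_mixin_eq (T : Type) e1 e2 e3 e4 e5 e6 e7
    (m m' : GRing.Nmodule_isPzSemiRing.axioms_ T e1 e2 e3 e4 e5 e6 e7) :
  GRing.Nmodule_isPzSemiRing.one m = GRing.Nmodule_isPzSemiRing.one m' ->
  GRing.Nmodule_isPzSemiRing.mul m = GRing.Nmodule_isPzSemiRing.mul m' -> m = m'.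
Proof.
case: m m' => [? ? ? ? ? ? ? ? ?] [? ? ? ? ? ? ? ? ?] /= *; subst.
by congr GRing.Nmodule_isPzSemiRing.Axioms_; exact: Prop_irrelevance.
Qed.

(** Carrier and multiplication agree by conversion; only the proofs of the ring axioms differ. The
    equation brings results applied to [R^c], which speak of [R^c^c], back to [R]. *)
Lemma converseK (R : pzRingType) : (R^c^c)%type = R :> pzRingType.
Proof.
case: R => T [c e [o] [z] [a] [addN] [add0] [addC] [addA] m].
congr GRing.PzRing.Pack; congr GRing.PzRing.Class.
exact: semiring_mixin_eq.
Qed.

(** Instances are declared once, on [carrier], so that each construction below is an ordinary term
    that may depend on proofs such as [submodule N]. *)
Record module_data (R : pzRingType) := ModuleData {
  carrier :> Type;
  mzero : carrier;
  mopp : carrier -> carrier;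
  madd : carrier -> carrier -> carrier;
  mscale : R -> carrier -> carrier;
  maddA : associative madd;
  maddC : commutative madd;
  madd0 : left_id mzero madd;
  maddN : left_inverse mzero mopp madd;
  mscaleA : forall a b v, mscale a (mscale b v) = mscale (a * b) v;
  mscale1 : left_id 1 mscale;
  mscaleDr : right_distributive mscale madd;
  mscaleDl : forall v, {morph mscale^~ v : a b / a + b >-> madd a b} }.

(** * Constructions on modules *)

Section ModuleOfData.
Variables (R : pzRingType) (d : module_data R).
HB.instance Definition _ := gen_eqMixin (carrier d).
HB.instance Definition _ := gen_choiceMixin (carrier d).
HB.instance Definition _ := GRing.isZmodule.Build (carrier d)
  (@maddA R d) (@maddC R d) (@madd0 R d) (@maddN R d).
HB.instance Definition _ := GRing.Zmodule_isLmodule.Build R (carrier d)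
  (@mscaleA R d) (@mscale1 R d) (@mscaleDr R d) (@mscaleDl R d).
End ModuleOfData.

Section Maps.
Variables (R : pzRingType) (M N : lmodType R).

(* Opaque, so that simplification does not unfold the maps defined below. *)
Fact mklin_ex (f : M -> N) : linear f -> {g : {linear M -> N} | g =1 f}.
Proof.
move=> fP; pose g : {linear M -> N} := HB.pack f (GRing.isLinear.Build R M N *:%R f fP).
by exists g.
Qed.
Definition mklin f (fP : linear f) : {linear M -> N} := sval (mklin_ex fP).
Lemma mklinE f fP x : @mklin f fP x = f x. Proof. exact: (svalP (mklin_ex fP)). Qed.

Lemma lin_choice (G : M -> N -> Prop) :
  (forall x, exists y, G x y) -> (forall x y y', G x y -> G x y' -> y = y') ->
  (forall a x x' y y', G x y -> G x' y' -> G (a *: x + x') (a *: y + y')) ->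
  exists f : {linear M -> N}, forall x, G x (f x).
Proof.
move=> /choice[f fP] GU GL.
have fL : linear f by move=> a x y; apply: GU (GL _ _ _ _ _ (fP x) (fP y)).
by exists (mklin fL) => x; rewrite mklinE.
Qed.

End Maps.

Fact mkadd_ex (U V : zmodType) (f : U -> V) :
  zmod_morphism f -> {g : {additive U -> V} | g =1 f}.
Proof.
move=> fP; pose g : {additive U -> V} := HB.pack f (GRing.isZmodMorphism.Build U V f fP).
by exists g.
Qed.
Definition mkadd (U V : zmodType) (f : U -> V) (fP : zmod_morphism f) :
  {additive U -> V} := sval (mkadd_ex fP).

Lemma mkaddE (U V : zmodType) (f : U -> V) fP x : @mkadd U V f fP x = f x.
Proof. exact: (svalP (mkadd_ex fP)). Qed.

Lemma add_choice (U V : zmodType) (G : U -> V -> Prop) :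
  (forall x, exists y, G x y) -> (forall x y y', G x y -> G x y' -> y = y') ->
  (forall x x' y y', G x y -> G x' y' -> G (x - x') (y - y')) ->
  exists f : {additive U -> V}, forall x, G x (f x).
Proof.
move=> /choice[f fP] GU GL.
have fL : zmod_morphism f by move=> x y; apply: GU (GL _ _ _ _ (fP x) (fP y)).
by exists (mkadd fL) => x; rewrite mkaddE.
Qed.

Lemma lin_inj (R : pzRingType) (M N : lmodType R) (f : {linear M -> N}) :
  (forall x, f x = 0 -> x = 0) -> injective f.
Proof.
move=> f0 x y fxy; apply/eqP; rewrite -subr_eq0; apply/eqP/f0.
by rewrite linearB fxy subrr.
Qed.

Definition surjective (A B : Type) (f : A -> B) := forall y, exists x, f x = y.

Section Factor.
Variables (R : pzRingType) (X Y Z : lmodType R).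

Lemma factor_surj (p : {linear X -> Y}) (f : {linear X -> Z}) :
  surjective p -> (forall x, p x = 0 -> f x = 0) ->
  exists g : {linear Y -> Z}, forall x, g (p x) = f x.
Proof.
move=> ps pf.
have pfE x x' : p x = p x' -> f x = f x'.
  move=> e; apply/eqP; rewrite -subr_eq0 -linearB pf ?linearB ?e ?subrr //.
have [|y z z' [x [<- <-]] [x' [e <-]]||g gP] :=
  @lin_choice R Y Z (fun y z => exists x, p x = y /\ f x = z).
- by move=> y; have [x <-] := ps y; exists (f x), x.
- by rewrite (pfE _ _ e).
- move=> a _ _ _ _ [x [<- <-]] [x' [<- <-]].
  by exists (a *: x + x'); rewrite !linearP.
- by exists g => x; have [x' [/pfE-> <-]] := gP (p x).
Qed.

Lemma factor_inj (i : {linear X -> Y}) (f : {linear Z -> Y}) :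
  injective i -> (forall z, exists x, i x = f z) ->
  exists g : {linear Z -> X}, forall z, i (g z) = f z.
Proof.
move=> ii fi.
have [||a z z' x x' e e'|g gP] := @lin_choice R Z X (fun z x => i x = f z).
- by [].
- by move=> z x x' <- /ii.
- by rewrite !linearP e e'.
- by exists g.
Qed.

End Factor.

Section Submodule.
Variables (R : pzRingType) (M : lmodType R) (N : M -> Prop).

Definition submodule := N 0 /\ forall a x y, N x -> N y -> N (a *: x + y).

Hypothesis NP : submodule.

Let N0 : N 0. Proof. by case: NP. Qed.
Let NL a x y : N x -> N y -> N (a *: x + y). Proof. by case: NP => _; apply. Qed.

Lemma submoduleD x y : N x -> N y -> N (x + y).
Proof. by move=> Nx Ny; rewrite -[x]scale1r; apply: NL. Qed.
Lemma submoduleZ a x : N x -> N (a *: x).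
Proof. by move=> Nx; rewrite -[_ *: _]addr0; apply: NL. Qed.
Lemma submoduleN x : N x -> N (- x).
Proof. by move=> Nx; rewrite -scaleN1r; apply: submoduleZ. Qed.
Lemma submoduleB x y : N x -> N y -> N (x - y).
Proof. by move=> Nx Ny; apply: submoduleD => //; apply: submoduleN. Qed.
Lemma submodule_sum (I : Type) (r : seq I) (F : I -> M) :
  (forall i, N (F i)) -> N (\sum_(i <- r) F i).
Proof. by move=> NF; elim/big_ind: _ => // *; apply: submoduleD. Qed.

Let T := {x : M | N x}.
Let mk x Nx : T := exist N x Nx.
Let ext (u v : T) : sval u = sval v -> u = v.
Proof. by case: u v => [x Nx] [y Ny] /= e; apply: eq_exist. Qed.

Definition sub_data : module_data R.
Proof.
refine (@ModuleData R T (mk N0) (fun u => mk (submoduleN (svalP u)))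
  (fun u v => mk (submoduleD (svalP u) (svalP v)))
  (fun a u => mk (submoduleZ a (svalP u))) _ _ _ _ _ _ _ _).
- by move=> *; apply: ext => /=; rewrite addrA.
- by move=> *; apply: ext => /=; rewrite addrC.
- by move=> *; apply: ext => /=; rewrite add0r.
- by move=> *; apply: ext => /=; rewrite addNr.
- by move=> *; apply: ext => /=; rewrite scalerA.
- by move=> *; apply: ext => /=; rewrite scale1r.
- by move=> *; apply: ext => /=; rewrite scalerDr.
- by move=> ? ? ?; apply: ext => /=; rewrite scalerDl.
Defined.

Definition sub : lmodType R := carrier sub_data.

Fact incl_linear : linear (fun u : sub => sval u : M). Proof. by []. Qed.
Definition incl : {linear sub -> M} := mklin incl_linear.

Lemma incl_inj : injective incl. Proof. by move=> u v; rewrite !mklinE => /ext. Qed.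
Lemma inclP u : N (incl u). Proof. by rewrite mklinE; exact: svalP u. Qed.
Lemma incl_onto x : N x -> exists u, incl u = x.
Proof. by move=> Nx; exists (mk Nx : sub); rewrite mklinE. Qed.

End Submodule.
Arguments inclP {R M N NP} u.
Arguments incl_inj {R M N NP} [x1 x2].

Section Quotient.
Variables (R : pzRingType) (M : lmodType R) (N : M -> Prop).
Hypothesis NP : submodule N.

(** The quotient is realised inside [M] as the set of chosen representatives. The choice is made
    from the coset as a set, hence depends on the coset alone. *)
Let rep (x : M) : M := xget 0 [set y | N (y - x)]%classic.
Let repP x : N (rep x - x).
Proof.
rewrite /rep; case: xgetP => [y -> //|/(_ x)]; rewrite /= subrr => -[].
by case: NP.
Qed.
Let repE x y : N (x - y) -> rep x = rep y.
Proof.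
move=> Nxy; rewrite /rep; congr xget; apply/seteqP; split=> z /= Nz.
  by rewrite -(subrK x z) -addrA; apply: submoduleD.
by rewrite -(subrK y z) -addrA -[y - x]opprB; apply: submoduleB.
Qed.
Let repK x : rep (rep x) = rep x. Proof. exact/repE/repP. Qed.

Let T := {x : M | rep x = x}.
Let cl x : T := exist _ (rep x) (repK x).
Let val_inj (u v : T) : sval u = sval v -> u = v.
Proof. by case: u v => [x ex] [y ey] /= e; apply: eq_exist. Qed.
Let clP u : exists x, u = cl x.
Proof. by exists (sval u); apply: val_inj; rewrite /= (svalP u). Qed.
Let clE x y : N (x - y) -> cl x = cl y.
Proof. by move=> /repE e; apply: val_inj. Qed.

Let clDl x y : cl (sval (cl x) + y) = cl (x + y).
Proof. by apply: clE => /=; rewrite opprD addrACA subrr addr0. Qed.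
Let clDr x y : cl (x + sval (cl y)) = cl (x + y).
Proof. by rewrite addrC clDl addrC. Qed.
Let clZ a x : cl (a *: sval (cl x)) = cl (a *: x).
Proof. by apply: clE => /=; rewrite -scalerBr; apply: submoduleZ. Qed.
Let clN x : cl (- sval (cl x)) = cl (- x).
Proof. by apply: clE => /=; rewrite -opprD; apply: submoduleN. Qed.

Definition quot_data : module_data R.
Proof.
refine (@ModuleData R T (cl 0) (fun u => cl (- sval u))
  (fun u v => cl (sval u + sval v)) (fun a u => cl (a *: sval u)) _ _ _ _ _ _ _ _).
- move=> u v w; have [x ->] := clP u; have [y ->] := clP v.
  have [z ->] := clP w; transitivity (cl (x + y + z)).
    by rewrite clDl clDr addrA clDr addrAC clDr addrAC.
  by rewrite [RHS]clDr [RHS]clDl -[in RHS]addrA [RHS]clDl [in RHS]addrCA [RHS]clDl [in RHS]addrCA addrA.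
- by move=> u v; rewrite addrC.
- by move=> u; have [x ->] := clP u; rewrite !(clDl, clDr) add0r.
- by move=> u; have [x ->] := clP u; rewrite clN !(clDl, clDr) addNr.
- by move=> a b u; have [x ->] := clP u; rewrite !clZ scalerA.
- by move=> u; have [x ->] := clP u; rewrite clZ scale1r.
- move=> a u v; have [x ->] := clP u; have [y ->] := clP v.
  by rewrite clZ scalerDr clDl clDr.
- by move=> u a b; rewrite scalerDl clDl clDr.
Defined.

Definition quot : lmodType R := carrier quot_data.

Fact proj_linear : linear (cl : M -> quot).
Proof. by move=> a x y; rewrite -clDr -clDl -[in LHS]clZ. Qed.
Definition proj : {linear M -> quot} := mklin proj_linear.

Lemma proj_surj : surjective proj.
Proof. by move=> u; have [x ->] := clP u; exists x; rewrite mklinE. Qed.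
Lemma projP x : proj x = 0 <-> N x.
Proof.
rewrite mklinE; split=> [/(congr1 sval) /= e|Nx]; last by apply: clE; rewrite subr0.
by have := submoduleB NP (repP 0) (repP x); rewrite e subr0 opprB addrC subrK.
Qed.

End Quotient.
Arguments proj_surj {R M N} NP.

Section Product.
Variables (R : pzRingType) (I : Type) (M : I -> lmodType R).

Definition dprod_data : module_data R.
Proof.
refine (@ModuleData R (forall i, M i) (fun=> 0) (fun x i => - x i)
  (fun x y i => x i + y i) (fun a x i => a *: x i) _ _ _ _ _ _ _ _).
- by move=> x y z; apply: functional_extensionality_dep => i; rewrite addrA.
- by move=> x y; apply: functional_extensionality_dep => i; rewrite addrC.
- by move=> x; apply: functional_extensionality_dep => i; rewrite add0r.
- by move=> x; apply: functional_extensionality_dep => i; rewrite addNr.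
- by move=> a b x; apply: functional_extensionality_dep => i; rewrite scalerA.
- by move=> x; apply: functional_extensionality_dep => i; rewrite scale1r.
- by move=> a x y; apply: functional_extensionality_dep => i; rewrite scalerDr.
- by move=> x a b; apply: functional_extensionality_dep => i; rewrite scalerDl.
Defined.

Definition dprod : lmodType R := carrier dprod_data.

Definition dmk (x : forall i, M i) : dprod := x.

Fact coord_linear i : linear (fun x : dprod => x i : M i). Proof. by []. Qed.
Definition dcoord i : {linear dprod -> M i} := mklin (coord_linear i).

Lemma dcoord_ext x y : (forall i, dcoord i x = dcoord i y) -> x = y.
Proof. by move=> e; apply: functional_extensionality_dep => i; have := e i; rewrite !mklinE. Qed.

Lemma dcoordE x i : dcoord i (dmk x) = x i. Proof. exact: mklinE. Qed.

Section Tuple.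
Variables (X : lmodType R) (f : forall i, {linear X -> M i}).
Fact dtuple_linear : linear (fun x => dmk (fun i => f i x)).
Proof. by move=> a x y; apply: dcoord_ext => i; rewrite linearP !dcoordE linearP. Qed.
Definition dtuple : {linear X -> dprod} := mklin dtuple_linear.
Lemma dtupleE x i : dcoord i (dtuple x) = f i x. Proof. by rewrite !mklinE. Qed.
End Tuple.

End Product.
Arguments dcoord {R I M} i.
Arguments dmk {R I M} x.

Section Pairs.
Variables (R : pzRingType) (M N X : lmodType R).

(* Much faster to unify with than the instance on [M * N]. *)
Definition dsum2_data : module_data R.
Proof.
refine (@ModuleData R (M * N) (0, 0) (fun x => (- x.1, - x.2))
  (fun x y => (x.1 + y.1, x.2 + y.2)) (fun a x => (a *: x.1, a *: x.2)) _ _ _ _ _ _ _ _).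
- by move=> x y z; rewrite /= !addrA.
- by move=> x y; rewrite addrC [x.2 + _]addrC.
- by case=> x y; rewrite /= !add0r.
- by case=> x y; rewrite /= !addNr.
- by move=> a b x; rewrite /= !scalerA.
- by case=> x y; rewrite /= !scale1r.
- by move=> a x y; rewrite /= !scalerDr.
- by move=> x a b; rewrite /= !scalerDl.
Defined.
Definition dsum2 : lmodType R := carrier dsum2_data.

Fact fst_linear : linear (fun x : dsum2 => x.1 : M). Proof. by []. Qed.
Definition lfst : {linear dsum2 -> M} := mklin fst_linear.
Fact snd_linear : linear (fun x : dsum2 => x.2 : N). Proof. by []. Qed.
Definition lsnd : {linear dsum2 -> N} := mklin snd_linear.

Definition lmkpair (x : M) (y : N) : dsum2 := (x, y).
Lemma lfstE x y : lfst (lmkpair x y) = x. Proof. exact: mklinE. Qed.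
Lemma lsndE x y : lsnd (lmkpair x y) = y. Proof. exact: mklinE. Qed.
Lemma dsum2_ext x y : lfst x = lfst y -> lsnd x = lsnd y -> x = y.
Proof. by rewrite !mklinE; case: x y => [? ?] [? ?] /= -> ->. Qed.
Lemma dsum2_eta x : x = lmkpair (lfst x) (lsnd x).
Proof. by apply: dsum2_ext; rewrite ?lfstE ?lsndE. Qed.

Fact lpair_linear (f : {linear X -> M}) (g : {linear X -> N}) :
  linear (fun x => lmkpair (f x) (g x)).
Proof. by move=> a x y; apply: dsum2_ext; rewrite !linearP ?lfstE ?lsndE. Qed.
Definition lpair f g : {linear X -> dsum2} := mklin (lpair_linear f g).

Fact lcopair_linear (f : {linear M -> X}) (g : {linear N -> X}) :
  linear (fun x : dsum2 => f (lfst x) + g (lsnd x)).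
Proof. by move=> a x y; rewrite !linearP scalerDr addrACA. Qed.
Definition lcopair f g : {linear dsum2 -> X} := mklin (lcopair_linear f g).

Lemma lpairE f g x : lpair f g x = lmkpair (f x) (g x). Proof. exact: mklinE. Qed.
Lemma lcopairE f g x : lcopair f g x = f (lfst x) + g (lsnd x). Proof. exact: mklinE. Qed.

End Pairs.

Section Injections.
Variables (R : pzRingType) (M N : lmodType R).
Definition linl : {linear M -> dsum2 M N} := lpair idfun \0.
Lemma linlE x : linl x = lmkpair x 0. Proof. by rewrite lpairE. Qed.
End Injections.

(** * Free modules *)

Lemma big_seq_supp (V : nmodType) (B : eqType) (s t : seq B) (F : B -> V) :
  uniq s -> uniq t -> (forall b, b \in s -> b \notin t -> F b = 0) ->
  (forall b, b \in t -> b \notin s -> F b = 0) ->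
  \sum_(b <- s) F b = \sum_(b <- t) F b.
Proof.
move=> us ut Fs Ft.
have E (u v : seq B) : (forall b, b \in u -> b \notin v -> F b = 0) ->
    \sum_(b <- u) F b = \sum_(b <- u | b \in v) F b.
  by move=> Fu; rewrite [RHS]big_mkcond; apply: eq_big_seq => b /Fu; case: ifPn => // _ ->.
rewrite (E s t Fs) (E t s Ft) -[LHS]big_filter -[RHS]big_filter.
apply: perm_big; apply: uniq_perm; rewrite ?filter_uniq // => b.
by rewrite !mem_filter andbC.
Qed.

Section FreeModule.
Variables (R : pzRingType) (B : choiceType).

Let Fun := dprod (fun _ : B => (R^o : lmodType R)).
Let fin (x : Fun) := exists s : seq B, forall b, b \notin s -> dcoord b x = 0.

Fact free_submodule : submodule fin.
Proof.
split=> [|a x y [s xs] [t yt]]; first by exists [::] => b _; rewrite linear0.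
exists (s ++ t) => b; rewrite mem_cat negb_or => /andP[/xs bx /yt bt].
by rewrite linearP bx bt scaler0 addr0.
Qed.

Definition free_module : lmodType R := sub free_submodule.

Definition fcoef (x : free_module) b : R := dcoord b (incl free_submodule x).

Lemma fcoefP a x y b : fcoef (a *: x + y) b = a * fcoef x b + fcoef y b.
Proof. by rewrite /fcoef !linearP. Qed.

Lemma free_ext (x y : free_module) : (forall b, fcoef x b = fcoef y b) -> x = y.
Proof. by move=> e; apply/incl_inj/dcoord_ext. Qed.

Lemma free_supp_ex (x : free_module) :
  exists s : seq B, uniq s /\ forall b, b \notin s -> fcoef x b = 0.
Proof.
have [s xs] := inclP x; exists (undup s); split; first exact: undup_uniq.
by move=> b; rewrite mem_undup => /xs.
Qed.
(** Some duplicate-free list containing the support; it may contain indices with zero coefficient,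
    so sums over it have to be shown independent of the list. *)
Definition supp x : seq B := sval (cid (free_supp_ex x)).
Lemma supp_uniq x : uniq (supp x).
Proof. by rewrite /supp; case: cid => s [] /=. Qed.
Lemma suppP x b : b \notin supp x -> fcoef x b = 0.
Proof. by rewrite /supp; case: cid => s [_] /=; apply. Qed.

Fact fbasis_fin b : fin (@dmk R B (fun=> R^o) (fun b' => (b' == b)%:R)).
Proof.
by exists [:: b] => b'; rewrite inE dcoordE => /negbTE->.
Qed.
Definition fbasis b : free_module := sval (cid (incl_onto free_submodule (fbasis_fin b))).
Lemma fcoef_basis b b' : fcoef (fbasis b) b' = (b' == b)%:R.
Proof. by rewrite /fcoef /fbasis; case: cid => x /= ->; rewrite dcoordE. Qed.

Section Lift.
Variables (M : lmodType R) (phi : B -> M).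

Let lift (x : free_module) := \sum_(b <- supp x) fcoef x b *: phi b.

Let liftE x s : uniq s -> (forall b, b \notin s -> fcoef x b = 0) ->
  lift x = \sum_(b <- s) fcoef x b *: phi b.
Proof.
move=> us xs; apply: big_seq_supp => // [|b _ /xs ->|b _ /suppP ->]; rewrite ?scale0r //.
exact: supp_uniq.
Qed.

Fact flift_linear : linear lift.
Proof.
move=> a x y; set s := undup (supp x ++ supp y).
have us : uniq s by exact: undup_uniq.
have sx b : b \notin s -> fcoef x b = 0.
  by rewrite mem_undup mem_cat negb_or => /andP[/suppP].
have sy b : b \notin s -> fcoef y b = 0.
  by rewrite mem_undup mem_cat negb_or => /andP[_ /suppP].
rewrite (liftE us sx) (liftE us sy) (@liftE _ s) // => [|b bs].
  rewrite scaler_sumr -big_split; apply: eq_bigr => b _.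
  by rewrite fcoefP scalerDl scalerA.
by rewrite fcoefP sx // sy // mulr0 addr0.
Qed.
Definition flift : {linear free_module -> M} := mklin flift_linear.

Lemma flift_sum x : flift x = \sum_(b <- supp x) fcoef x b *: phi b.
Proof. exact: mklinE. Qed.

Lemma flift_sum_on s x : uniq s -> (forall b, b \notin s -> phi b = 0) ->
  flift x = \sum_(b <- s) fcoef x b *: phi b.
Proof.
move=> us phi0; rewrite flift_sum; apply: big_seq_supp => // [|b _ /phi0 ->|b _ /suppP ->].
- exact: supp_uniq.
- by rewrite scaler0.
- by rewrite scale0r.
Qed.

Lemma flift_basis b : flift (fbasis b) = phi b.
Proof.
rewrite mklinE [LHS](@liftE _ [:: b]) // => [|b']; last first.
  by rewrite fcoef_basis inE => /negbTE->.
by rewrite big_seq1 fcoef_basis eqxx scale1r.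
Qed.

End Lift.

Lemma free_sum (x : free_module) : x = \sum_(b <- supp x) fcoef x b *: fbasis b.
Proof.
rewrite -flift_sum; apply: free_ext => c; rewrite flift_sum.
have fsum (s : seq B) : fcoef (\sum_(b <- s) fcoef x b *: fbasis b) c =
    \sum_(b <- s) fcoef x b * (c == b)%:R.
  elim: s => [|b s IH]; first by rewrite !big_nil /fcoef !linear0.
  by rewrite !big_cons fcoefP IH fcoef_basis.
rewrite fsum; have [cx|/[dup] cx /suppP->] := boolP (c \in supp x).
  rewrite (bigD1_seq c) ?supp_uniq //= eqxx mulr1 big1 ?addr0 // => b /negbTE.
  by rewrite eq_sym => ->; rewrite mulr0.
rewrite big1_seq // => b /= bx.
by case: eqP bx => [<-|]; rewrite ?mulr0 // (negbTE cx).
Qed.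

Lemma free_map_ext (M : lmodType R) (f g : {linear free_module -> M}) :
  (forall b, f (fbasis b) = g (fbasis b)) -> f =1 g.
Proof.
move=> e x; rewrite (free_sum x) !linear_sum; apply: eq_bigr => b _.
by rewrite !linearZ e.
Qed.

End FreeModule.

#[global] Opaque sub quot dprod dsum2 free_module.

(** * Characters and injective modules *)

(** Division with remainder by the least positive element. It is applied to the multiples of an
    element that fall into a given subgroup. *)
Lemma int_subgroup (D : int -> Prop) :
  D 0 -> (forall j k, D j -> D k -> D (j - k)) ->
  (forall k, D k -> k = 0) \/
  exists n : nat, [/\ (0 < n)%N, D n & forall k, D k -> (n %| k)%Z].
Proof.
move=> D0 DB; have DN k : D k -> D (- k) by move=> Dk; rewrite -sub0r; apply: DB.
have DD j k : D j -> D k -> D (j + k).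
  by move=> Dj Dk; rewrite -[k]opprK; apply/DB/DN.
have Dabs k : D k -> D `|k|%N by move=> Dk; rewrite abszE; case: ger0P => // _; apply: DN.
have [pos|none] := pselect (exists n : nat, `[< (0 < n)%N /\ D n >]); last first.
  left=> k Dk; apply/eqP; rewrite -absz_eq0 -leqn0 leqNgt; apply/negP => k0.
  by apply: none; exists `|k|%N; apply/asboolP; split=> //; apply: Dabs.
right; case: (ex_minnP pos) => n /asboolP[n0 Dn] nmin; exists n; split=> // k Dk.
have DM q : D (q * n%:Z).
  have DMn m : D (m%:Z * n%:Z).
    elim: m => [|m IH]; first by rewrite mul0r.
    by rewrite -addn1 PoszD mulrDl mul1r; apply: DD.
  by case: (intP q) => [|m|m]; rewrite ?mulNr; [exact: DMn 0%N|exact: DMn|apply: DN; exact: DMn].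
have nn0 : n%:Z != 0 by rewrite eqz_nat -lt0n.
have Dr : D (k %% n)%Z by rewrite /modz; apply: DB.
apply/dvdz_mod0P/eqP; rewrite -absz_eq0 -leqn0 leqNgt; apply/negP => r0.
have : (n <= `|(k %% n)%Z|)%N by apply: nmin; apply/asboolP; split=> //; apply: Dabs.
by rewrite leqNgt -ltz_nat gez0_abs ?modz_ge0 // ltz_mod.
Qed.

Definition qz (q : rat) : QmodZ := \pi_QmodZ q.

Fact qz_zmod_morphism : zmod_morphism qz.
Proof. by move=> x y; rewrite /qz; apply: (raddfB (\pi_QmodZ)). Qed.
HB.instance Definition _ := GRing.isZmodMorphism.Build rat QmodZ qz qz_zmod_morphism.

Lemma qz_surj y : exists q, qz q = y.
Proof. by exists (repr y); rewrite /qz reprK. Qed.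

Lemma qz_eq0 q : qz q = 0 <-> q \is a Num.int.
Proof.
have -> : (q \is a Num.int) = (q - 0 \in GRing.ZmodClosed.clone rat is_int _).
  by rewrite subr0.
by rewrite Quotient.idealrBE -[0 in X in X <-> _](raddf0 qz); split=> /eqP.
Qed.

Lemma qz_divisible (n : nat) (y : QmodZ) : (0 < n)%N -> exists w, w *+ n = y.
Proof.
move=> n0; have [q <-] := qz_surj y; exists (qz (q / n%:R)).
by rewrite -raddfMn /= -[_ *+ n]mulr_natr divfK // pnatr_eq0 -lt0n.
Qed.

(** The class of 1/n. Such torsion makes Q/Z a cogenerator: an element of order n modulo a subgroup
    has a nonzero admissible value. *)
Lemma qz_torsion (n : nat) : (1 < n)%N -> exists w : QmodZ, w != 0 /\ w *+ n = 0.
Proof.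
move=> n1; have n0 : (0 < n)%N by apply: ltn_trans n1.
exists (qz n%:R^-1); split; last first.
  by rewrite -raddfMn -[_ *+ n]mulr_natr mulVf ?pnatr_eq0 -?lt0n //; apply/qz_eq0.
apply/eqP => /qz_eq0 /intrP[k kE].
have : (k%:~R : rat) * n%:R = 1 by rewrite -kE mulVf // pnatr_eq0 -lt0n.
rewrite -[n%:R]/(n%:Z%:~R) -intrM => /(congr1 numq).
rewrite -[1]/(1%:~R) !numq_int => /(congr1 absz).
rewrite abszM /= => /eqP; rewrite muln_eq1 => /andP[_ /eqP ne].
by rewrite ne in n1.
Qed.

Definition subgroup (V : zmodType) (H : V -> Prop) :=
  H 0 /\ forall x y, H x -> H y -> H (x - y).

Lemma subgroupN (V : zmodType) (H : V -> Prop) x : subgroup H -> H x -> H (- x).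
Proof. by case=> H0 HB Hx; rewrite -sub0r; apply: HB. Qed.
Lemma subgroupD (V : zmodType) (H : V -> Prop) x y :
  subgroup H -> H x -> H y -> H (x + y).
Proof.
move=> HP Hx Hy; rewrite -[y]opprK; have [_ HB] := HP.
by apply: HB => //; apply: subgroupN.
Qed.
Lemma subgroupMz (V : zmodType) (H : V -> Prop) x (k : int) :
  subgroup H -> H x -> H (x *~ k).
Proof.
move=> HP Hx; have Hn (n : nat) : H (x *+ n).
  elim: n => [|n IH]; first by case: HP.
  by rewrite mulrS; apply: subgroupD.
by case: (intP k) => [|n|n]; [case: HP|exact: Hn|rewrite mulrNz; apply: subgroupN => //; exact: Hn].
Qed.

Section CharacterExtension.
Variable V : zmodType.
Implicit Types G : set (V * QmodZ).

Let good G := subgroup (G : (V * QmodZ)%type -> Prop) /\ forall y, G (0, y) -> y = 0.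

Let good_uniq G x y y' : good G -> G (x, y) -> G (x, y') -> y = y'.
Proof.
move=> [[_ GB] G0] Gy Gy'; apply/eqP; rewrite -subr_eq0; apply/eqP/G0.
by have := GB _ _ Gy Gy'; rewrite /= -[_ - _]/(_, _) /= subrr.
Qed.

Let good_extend G v : good G -> exists G', [/\ good G', (G `<=` G')%classic & exists y, G' (v, y)].
Proof.
move=> gG; have [GP G0] := gG; have [G00 GB] := GP.
(* The value to be given to [v]: if [v *~ n] generates the multiples of [v] in the domain, an n-th
   part of its value; if no nonzero multiple lies there, 0. *)
have [w wP] : exists w : QmodZ, forall (k : int) y, G (v *~ k, y) -> y = w *~ k.
  have [||Dk0|[n [n0 [y0 Gy0] nD]]] := @int_subgroup (fun k => exists y, G (v *~ k, y)).
  - by exists 0.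
  - move=> j k [y Gy] [z Gz]; exists (y - z).
    by have := GB _ _ Gy Gz; rewrite -[_ - _]/(_, _) /= mulrzBr.
  - exists 0 => k y Gy; have k0 := Dk0 k (ex_intro _ y Gy).
    by rewrite k0 mulr0z in Gy *; apply: G0.
  have [w wE] := qz_divisible y0 n0; exists w => k y Gy.
  have /dvdzP[q kE] := nD k (ex_intro _ y Gy).
  apply: good_uniq Gy _ => //; rewrite kE.
  have := subgroupMz q GP Gy0.
  have pairMz (a : V * QmodZ) (j : int) : a *~ j = (a.1 *~ j, a.2 *~ j).
    have pn (m : nat) : a *+ m = (a.1 *+ m, a.2 *+ m).
      by elim: m => [|m IH]; rewrite ?mulr0n // !mulrS IH.
    by case: (intP j) => [|m|m]; rewrite ?mulrNz -?pmulrn ?pn //.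
  by rewrite pairMz /= -wE pmulrn -!mulrzA [n%:Z * q]mulrC.
exists [set p | exists x y k, G (x, y) /\ p = (x + v *~ k, y + w *~ k)]%classic.
split; first split; first split.
- by exists 0, 0, 0; rewrite !mulr0z !addr0.
- move=> _ _ [x [y [k [Gxy ->]]]] [x' [y' [k' [Gxy' ->]]]].
  exists (x - x'), (y - y'), (k - k'); split; first exact: (GB _ _ Gxy Gxy').
  by congr pair; rewrite /= mulrzBr opprD addrACA.
- move=> z [x [y [k [Gxy [/esym/eqP + ->]]]]].
  rewrite addr_eq0 => /eqP xE; apply/eqP; rewrite addr_eq0; apply/eqP.
  by rewrite -mulrNz; apply: wP; rewrite mulrNz -xE.
- by move=> [x y] Gxy; exists x, y, 0; rewrite !mulr0z !addr0.
- by exists w, 0, 0, 1; rewrite !add0r.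
Qed.

(** Injectivity of Q/Z by Zorn's lemma. Partial homomorphisms are represented by graphs, so that
    inclusion means extension and chains have unions. *)
Lemma qz_extend (G : V -> QmodZ -> Prop) :
  G 0 0 -> (forall x x' y y', G x y -> G x' y' -> G (x - x') (y - y')) ->
  (forall y, G 0 y -> y = 0) ->
  exists chi : {additive V -> QmodZ}, forall x y, G x y -> chi x = y.
Proof.
move=> G00 GB G0; pose G1 : set (V * QmodZ) := [set p | G p.1 p.2]%classic.
have gG1 : good G1 by do !split=> //=; move=> p q; apply: GB.
(* Adjoining [G1] makes [P] true of the union of the empty chain. *)
pose P A := good (A `|` G1)%classic.
have [F FP Ftot|A [PA Amax]] := @Zorn_bigcup _ P.
  have [[X FX]|noX] := pselect (exists X, F X); last first.
    rewrite /P; suff -> : (\bigcup_(X in F) X `|` G1 = G1)%classic by [].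
    apply/seteqP; split=> [p [[X FX]|//]|p]; last by right.
    by case: noX; exists X.
  have G1X p : G1 p -> exists2 X, F X & (X `|` G1)%classic p by exists X => //; right.
  have UX p : (\bigcup_(X in F) X `|` G1)%classic p -> exists2 X, F X & (X `|` G1)%classic p.
    by case=> [[Y FY Yp]|/G1X//]; exists Y => //; left.
  have XU Y p : F Y -> (Y `|` G1)%classic p -> (\bigcup_(X in F) X `|` G1)%classic p.
    by move=> FY [Yp|]; [left; exists Y|right].
  split; first split; first by right.
    move=> p q /UX[Y FY Yp] /UX[Z FZ Zq].
    have [W [FW YW ZW]] : exists W, [/\ F W, (Y `<=` W)%classic & (Z `<=` W)%classic].
      by have [YZ|ZY] := Ftot Y Z FY FZ; [exists Z|exists Y]; split=> //; exact: subset_refl.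
    apply: (XU _ _ FW); have [[_ WB] _] := FP W FW; apply: WB.
      by case: Yp => [/YW|]; [left|right].
    by case: Zq => [/ZW|]; [left|right].
  by move=> y /UX[Y FY]; have [_] := FP Y FY; apply.
have dom v : exists y, (A `|` G1)%classic (v, y).
  have [G' [gG' AG' [y G'y]]] := good_extend v PA.
  exists y; apply: contrapT => nAy; apply: (Amax G'); last first.
    suff -> : P G' = good G' by [].
    by rewrite /P (_ : (_ `|` _ = G')%classic) //; apply/setUidPl => p Gp; apply: AG'; right.
  split; first by move=> p Ap; apply: AG'; left.
  by move=> G'A; apply: nAy; left; apply: G'A.
have [x y y'|x x' y y' Gx Gx'|chi chiP] :=
  @add_choice V QmodZ (fun x y => (A `|` G1)%classic (x, y)) dom.
- exact: good_uniq.
- by case: PA => -[_ AB] _; apply: (AB _ _ Gx Gx').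
- by exists chi => x y Gxy; apply: good_uniq PA (chiP x) _; right.
Qed.

End CharacterExtension.

Lemma qz_injective (U V : zmodType) (i : {additive U -> V}) (f : {additive U -> QmodZ}) :
  injective i -> exists g : {additive V -> QmodZ}, forall u, g (i u) = f u.
Proof.
move=> ii; have [||y|g gP] := @qz_extend V (fun v y => exists u, i u = v /\ f u = y).
- by exists 0; rewrite !raddf0.
- by move=> _ _ _ _ [u [<- <-]] [u' [<- <-]]; exists (u - u'); rewrite !raddfB.
- by case=> u [iu0 <-]; rewrite (ii u 0) ?raddf0.
- by exists g => u; apply: gP; exists u.
Qed.

Lemma qz_separate (V : zmodType) (H : V -> Prop) x : subgroup H -> ~ H x ->
  exists chi : {additive V -> QmodZ}, (forall h, H h -> chi h = 0) /\ chi x != 0.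
Proof.
move=> HP nHx; have [H0 HB] := HP.
(* A nonzero value compatible with the order of [x] modulo [H]; for infinite order every nonzero
   value is, and one of order 2 is taken. *)
have [w [w0 wP]] : exists w : QmodZ, w != 0 /\ forall k : int, H (x *~ k) -> w *~ k = 0.
  have [|j k Hj Hk|Hk0|[n [n0 Hn nD]]] := @int_subgroup (fun k => H (x *~ k)).
  - by rewrite mulr0z.
  - by rewrite mulrzBr; apply: HB.
  - have [w [w0 _]] := qz_torsion (isT : (1 < 2)%N).
    by exists w; split=> // k /Hk0 ->; rewrite mulr0z.
  have n1 : (1 < n)%N by case: n n0 Hn {nD} => [|[|n]].
  have [w [w0 wn]] := qz_torsion n1; exists w; split=> // k /nD/dvdzP[q ->].
  by rewrite mulrC mulrzA -pmulrn wn mul0rz.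
have [||y|chi chiP] := @qz_extend V (fun v y => exists h k, [/\ H h, v = h + x *~ k & y = w *~ k]).
- by exists 0, 0; rewrite !mulr0z addr0.
- move=> _ _ _ _ [h [k [Hh -> ->]]] [h' [k' [Hh' -> ->]]].
  by exists (h - h'), (k - k'); rewrite !mulrzBr opprD addrACA; split=> //; apply: HB.
- move=> [h [k [Hh /esym/eqP]]]; rewrite addrC addr_eq0 => /eqP xk ->.
  by apply: wP; rewrite xk; apply: subgroupN.
exists chi; split=> [h Hh|]; first by apply: chiP; exists h, 0; rewrite !mulr0z addr0.
by rewrite (chiP x w) //; exists 0, 1; rewrite add0r.
Qed.

Lemma ker_submodule (R : pzRingType) (M N : lmodType R) (f : {linear M -> N}) :
  submodule (fun x => f x = 0).
Proof. by split=> [|a x y fx fy]; rewrite ?linear0 // linearP fx fy scaler0 addr0. Qed.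

Lemma im_submodule (R : pzRingType) (M N : lmodType R) (f : {linear M -> N}) :
  submodule (fun y => exists x, f x = y).
Proof.
split=> [|a _ _ [x <-] [y <-]]; first by exists 0; rewrite linear0.
by exists (a *: x + y); rewrite linearP.
Qed.

(** Obtained by composing [c] with the coordinate inclusions. A character separating a finite tuple
    thus becomes a tuple in the dual; both the flatness and the purity criterion below rest on
    this. *)
Lemma character_finite_product (R : pzRingType) (B : choiceType) (M : lmodType R)
    (c : {additive dprod (fun _ : B => M) -> QmodZ}) (s : seq B) : uniq s ->
  exists chi : B -> {additive M -> QmodZ}, forall y : B -> M,
    c (dmk (fun b => if b \in s then y b else 0)) = \sum_(b <- s) chi b (y b).
Proof.
move=> us.
pose iota b (y : M) : dprod (fun _ : B => M) := dmk (fun b' => if b' == b then y else 0).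
have iotaB b : zmod_morphism (iota b).
  by move=> y y'; apply: dcoord_ext => b'; rewrite linearB !dcoordE; case: eqP; rewrite ?subr0.
exists (fun b => c \o mkadd (iotaB b)) => y.
rewrite [RHS](eq_bigr (fun b => c (iota b (y b)))) => [|b _]; last by rewrite /= mkaddE.
rewrite -raddf_sum; congr (c _).
apply: dcoord_ext => b; rewrite linear_sum dcoordE; under eq_bigr do rewrite dcoordE.
case: ifPn => bs.
  by rewrite (bigD1_seq b) //= eqxx big1 ?addr0 // => b' /negbTE; rewrite eq_sym => ->.
by rewrite big1_seq // => b' /= b's; case: eqP b's => // <-; rewrite (negbTE bs).
Qed.

Section Dual.
Variables (R : pzRingType) (M : lmodType R).

Let scale_fact (r : R) (phi : {additive M -> QmodZ}) : zmod_morphism (fun m => phi (r *: m)).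
Proof. by move=> x y; rewrite scalerBr raddfB. Qed.

(* [(r : R^c) *: phi] is phi r, so (phi r)(m) = phi (r m) *)
Definition dual_data : module_data R^c.
Proof.
refine (@ModuleData R^c {additive M -> QmodZ} (\0 : M -> QmodZ)
  (fun f => \- f) (fun f g => f \+ g) (fun r f => mkadd (scale_fact r f)) _ _ _ _ _ _ _ _).
- by move=> f g h; apply: additive_ext => x /=; rewrite addrA.
- by move=> f g; apply: additive_ext => x /=; rewrite addrC.
- by move=> f; apply: additive_ext => x /=; rewrite add0r.
- by move=> f; apply: additive_ext => x /=; rewrite addNr.
- by move=> r s f; apply: additive_ext => x; rewrite !mkaddE scalerA.
- by move=> f; apply: additive_ext => x; rewrite mkaddE scale1r.
- by move=> r f g; apply: additive_ext => x; rewrite /= !mkaddE.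
- by move=> f r s; apply: additive_ext => x; rewrite /= !mkaddE scalerDl raddfD.
Defined.

Definition dual : lmodType R^c := carrier dual_data.
Definition dual_fun (phi : dual) : {additive M -> QmodZ} := phi.
Definition dual_mk (phi : {additive M -> QmodZ}) : dual := phi.

Lemma dual_mkE phi m : dual_fun (dual_mk phi) m = phi m. Proof. by []. Qed.
Lemma dual_ext phi psi : dual_fun phi =1 dual_fun psi -> phi = psi.
Proof. exact: additive_ext. Qed.
Lemma dualD phi psi m : dual_fun (phi + psi) m = dual_fun phi m + dual_fun psi m.
Proof. by []. Qed.
Lemma dual0 m : dual_fun 0 m = 0. Proof. by []. Qed.
Lemma dualN phi m : dual_fun (- phi) m = - dual_fun phi m. Proof. by []. Qed.
Lemma dualZ (r : R) phi m : dual_fun ((r : R^c) *: phi) m = dual_fun phi (r *: m).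
Proof. exact: mkaddE. Qed.
Lemma dualP (r : R^c) phi psi m :
  dual_fun (r *: phi + psi) m = dual_fun phi ((r : R) *: m) + dual_fun psi m.
Proof. by rewrite dualD dualZ. Qed.
Lemma dual_sum (I : Type) (s : seq I) (F : I -> dual) m :
  dual_fun (\sum_(i <- s) F i) m = \sum_(i <- s) dual_fun (F i) m.
Proof. by elim: s => [|i s IH]; rewrite ?big_nil // !big_cons dualD IH. Qed.

End Dual.

Section DualMap.
Variables (R : pzRingType) (M N : lmodType R) (f : {linear M -> N}).
Fact dual_map_linear : linear (fun phi : dual N => dual_mk (dual_fun phi \o f)).
Proof.
move=> r phi psi; apply: dual_ext => x; rewrite [RHS]dualP.
rewrite -[LHS]/(dual_fun (r *: phi + psi) (f x)) dualP.
by rewrite -[in LHS]linearZ_LR.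
Qed.
Definition dual_map : {linear dual N -> dual M} := mklin dual_map_linear.
Lemma dual_mapE phi m : dual_fun (dual_map phi) m = dual_fun phi (f m). Proof. by rewrite mklinE. Qed.
End DualMap.

Section Character.
Variables (R : pzRingType) (E : lmodType R^c).
Definition char_mk (phi : {additive E -> QmodZ}) : character E := phi.
Implicit Types phi psi : character E.
Lemma char_mkE (phi : {additive E -> QmodZ}) m : character_fun (char_mk phi) m = phi m.
Proof. by []. Qed.
Lemma char_ext phi psi : character_fun phi =1 character_fun psi -> phi = psi.
Proof. exact: additive_ext. Qed.
Lemma charD phi psi m :
  character_fun (phi + psi) m = character_fun phi m + character_fun psi m.
Proof. by []. Qed.
Lemma char0 m : character_fun (0 : character E) m = 0. Proof. by []. Qed.
Lemma charZ (r : R) phi m : character_fun (r *: phi) m = character_fun phi ((r : R^c) *: m).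
Proof. by []. Qed.
Lemma charP (r : R) phi psi m : character_fun (r *: phi + psi) m =
  character_fun phi ((r : R^c) *: m) + character_fun psi m.
Proof. by []. Qed.
Lemma char_sum (I : Type) (s : seq I) (F : I -> character E) m :
  character_fun (\sum_(i <- s) F i) m = \sum_(i <- s) character_fun (F i) m.
Proof. by elim: s => [|i s IH]; rewrite ?big_nil // !big_cons charD IH. Qed.
End Character.

Section CharMap.
Variables (R : pzRingType) (M N : lmodType R^c) (f : {linear M -> N}).
Fact char_map_linear : linear (fun phi : character N => char_mk (character_fun phi \o f)).
Proof.
move=> r phi psi; apply: char_ext => x; rewrite [RHS]charP.
rewrite -[LHS]/(character_fun (r *: phi + psi) (f x)) charP.
by rewrite -[in LHS]linearZ_LR.
Qed.
Definition char_map : {linear character N -> character M} := mklin char_map_linear.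
Lemma char_mapE phi m : character_fun (char_map phi) m = character_fun phi (f m).
Proof. by rewrite mklinE. Qed.
End CharMap.

#[global] Opaque dual.

Section Cogenerator.
Variable R : pzRingType.

(** Hom_Z(R, Q/Z). Maps from [M] into it correspond to characters of [M] by evaluation at 1, with
    inverse [coind]. *)
Definition cogen : lmodType R := character ((R^c)^o : lmodType R^c).

Section CoInduced.
Variables (M : lmodType R) (phi : {additive M -> QmodZ}).
Fact coind_additive m : zmod_morphism (fun r : (R^c)^o => phi ((r : R) *: m)).
Proof. by move=> r s; rewrite scalerBl raddfB. Qed.
Fact coind_linear : linear (fun m => char_mk (mkadd (coind_additive m)) : cogen).
Proof.
move=> s x y; apply: char_ext => r.
by rewrite charP !char_mkE !mkaddE scalerDr scalerA raddfD.
Qed.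
Definition coind : {linear M -> cogen} := mklin coind_linear.
Lemma coindE m (r : R) : character_fun (coind m) r = phi (r *: m).
Proof. by rewrite mklinE char_mkE mkaddE. Qed.
End CoInduced.

(** Evaluation at 1 turns the extension problem into one for characters. *)
Lemma cogen_injective : injective_module cogen.
Proof.
move=> A B i f ii.
have phiP : zmod_morphism (fun a => character_fun (f a) (1 : R)).
  by move=> x y; rewrite linearB.
have [psi psiE] := qz_injective (mkadd phiP) ii.
exists (coind psi) => a; apply: char_ext => r; rewrite /= coindE -linearZ psiE mkaddE.
rewrite linearZ charZ; congr (character_fun (f a) _); exact: (mulr1 (r : R^c)).
Qed.

End Cogenerator.

Section Injectives.
Variable R : pzRingType.

Lemma dprod_injective (I : Type) (M : I -> lmodType R) :
  (forall i, injective_module (M i)) -> injective_module (dprod M).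
Proof.
move=> MI A B i f ii.
have g j := cid (MI j A B i (dcoord j \o f) ii).
exists (dtuple (fun j => sval (g j))) => a; apply: dcoord_ext => j.
by rewrite /= dtupleE; apply: (svalP (g j)).
Qed.

Lemma dsum2_injective (M N : lmodType R) :
  injective_module M -> injective_module N -> injective_module (dsum2 M N).
Proof.
move=> MI NI A B i f ii.
have [g gP] := MI A B i (lfst M N \o f) ii; have [h hP] := NI A B i (lsnd M N \o f) ii.
exists (lpair g h) => a; rewrite /= lpairE.
by have /= -> := gP a; have /= -> := hP a; rewrite -dsum2_eta.
Qed.

Lemma retract_injective (M N : lmodType R) (i : {linear M -> N}) (r : {linear N -> M}) :
  cancel i r -> injective_module N -> injective_module M.
Proof.
move=> ri NI A B j f jj; have [g gP] := NI A B j (i \o f) jj.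
by exists (r \o g) => a /=; have /= -> := gP a; rewrite ri.
Qed.

Variable M : lmodType R.

(** One factor for each character of [M]: an injective module containing [M], without the minimality
    of an injective envelope. *)
Definition inj_hull : lmodType R := dprod (fun _ : {additive M -> QmodZ} => cogen R).
Definition hull_emb : {linear M -> inj_hull} := dtuple (fun phi => coind phi).

Lemma hull_injective : injective_module inj_hull.
Proof. by apply: dprod_injective => _; apply: cogen_injective. Qed.

Lemma hull_emb_inj : injective hull_emb.
Proof.
apply: lin_inj => m m0; apply: contrapT => mn0.
have [||phi [_ /eqP[]]] := @qz_separate M (fun x => x = 0) m.
- by split=> // x y -> ->; rewrite subr0.
- exact: mn0.
have := congr1 (dcoord phi) m0; rewrite dtupleE => e.
by rewrite -[m]scale1r -(coindE phi) e linear0 char0.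
Qed.

Definition cosyz : lmodType R := quot (im_submodule hull_emb).
Definition cosyz_proj : {linear inj_hull -> cosyz} := proj (im_submodule hull_emb).

Definition free_cover : lmodType R := free_module R M.
Definition cover : {linear free_cover -> M} := flift (fun m : M => m).
Lemma cover_surj : surjective cover.
Proof. by move=> m; exists (fbasis R m); rewrite flift_basis. Qed.

Definition syz : lmodType R := sub (ker_submodule cover).
Definition syz_incl : {linear syz -> free_cover} := incl (ker_submodule cover).

End Injectives.
Arguments hull_injective {R} M.

Lemma free_projective (R : pzRingType) (B : choiceType) : projective_module (free_module R B).
Proof.
move=> A C p f /choice[g gP]; exists (flift (fun b => g (f (fbasis R b)))) => x /=.
by apply: (@free_map_ext _ _ _ (p \o flift _) f) => b /=; rewrite flift_basis gP.
Qed.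

(** * Ext by dimension shifting *)

Section Ext.
Variable R : pzRingType.
Implicit Types A B C K X P E M N : lmodType R.

Definition ses A B C (i : {linear A -> B}) (p : {linear B -> C}) :=
  [/\ injective i, exact i p & surjective p].

Lemma ses_comp A B C (i : {linear A -> B}) (p : {linear B -> C}) x :
  ses i p -> p (i x) = 0.
Proof. by move=> [_ ex _]; apply/ex; exists x. Qed.

Lemma ker_ses M N (p : {linear M -> N}) :
  surjective p -> ses (incl (ker_submodule p)) p.
Proof.
split=> // [|y]; first exact: incl_inj.
by split=> [y0|[u <-]]; [exact: (incl_onto (ker_submodule p))|exact: (inclP u)].
Qed.

Lemma coker_ses M N (i : {linear M -> N}) :
  injective i -> ses i (proj (im_submodule i)).
Proof. by split=> // [y|]; [exact: projP|exact: proj_surj]. Qed.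

Lemma syz_ses M : ses (syz_incl M) (cover M).
Proof. exact/ker_ses/cover_surj. Qed.
Lemma cosyz_ses M : ses (hull_emb M) (cosyz_proj M).
Proof. exact/coker_ses/hull_emb_inj. Qed.
Lemma cover_projective M : projective_module (free_cover M).
Proof. exact: free_projective. Qed.
Arguments cover_projective : clear implicits.

Lemma ses_factor A B C N (i : {linear A -> B}) (p : {linear B -> C}) (f : {linear B -> N}) :
  ses i p -> (forall a, f (i a) = 0) -> exists g : {linear C -> N}, forall b, g (p b) = f b.
Proof.
move=> [_ ex ps] fi; apply: factor_surj => // b /ex[a <-]; exact: fi.
Qed.

Lemma ses_restrict A B C N (i : {linear A -> B}) (p : {linear B -> C}) (f : {linear N -> B}) :
  ses i p -> (forall x, p (f x) = 0) -> exists g : {linear N -> A}, forall x, i (g x) = f x.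
Proof. by move=> [ii ex _] pf; apply: factor_inj => // x; apply/ex/pf. Qed.

(* [ext1 A B] says that Ext^1(A, B) = 0. *)
Definition ext1 A B := forall f : {linear syz A -> B},
  exists g : {linear free_cover A -> B}, forall x, g (syz_incl A x) = f x.

(** [X] is the pushout of [syz_incl A] along the induced map [v] from [syz A] to [K], so [f] extends
    as soon as [f \o v] does. *)
Lemma ext1_extend A B K X (i : {linear K -> X}) (p : {linear X -> A}) (f : {linear K -> B}) :
  ses i p -> ext1 A B -> exists g : {linear X -> B}, forall x, g (i x) = f x.
Proof.
move=> ip AB; have [ii ex ps] := ip.
have [u uP] := cover_projective A _ _ p (cover A) ps.
have [v vP] := @ses_restrict _ _ _ _ i p (u \o syz_incl A) ip
  (fun x => etrans (uP (syz_incl A x)) (ses_comp x (syz_ses A))).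
have [g gP] := AB (f \o v).
pose q : {linear dsum2 (free_cover A) K -> X} := lcopair u i.
have [x|x|h hP] := @factor_surj _ _ _ _ q (lcopair g f).
- have [a ax] := cover_surj (p x).
  have [k kx] : exists k, i k = x - u a by apply/ex; rewrite linearB -ax -uP subrr.
  by exists (lmkpair a k); rewrite lcopairE lfstE lsndE kx addrC subrK.
- rewrite !lcopairE => /eqP; rewrite addr_eq0 => /eqP uak.
  have [s sa] : exists s, syz_incl A s = lfst _ _ x.
    have [_ exA _] := syz_ses A; apply/exA.
    by rewrite -uP /= uak linearN (ses_comp _ ip) oppr0.
  have vk : v s = - lsnd _ _ x by apply: ii; rewrite vP /= sa uak linearN.
  by rewrite -sa gP /= vk linearN addNr.
exists h => k; have := hP (lmkpair 0 k).
by rewrite !lcopairE lfstE lsndE !linear0 !add0r.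
Qed.

(** Lift over the free cover first. The obstruction to descending to [A] is a map from [syz A] to
    [B]; extending it to the cover corrects the lift. *)
Lemma ext1_lift A B X C (i : {linear B -> X}) (p : {linear X -> C}) (f : {linear A -> C}) :
  ses i p -> ext1 A B -> exists g : {linear A -> X}, forall a, p (g a) = f a.
Proof.
move=> ip AB; have [ii ex ps] := ip.
have [u uP] := cover_projective A _ _ p (f \o cover A) ps.
have [|v vP] := @ses_restrict _ _ _ _ i p (u \o syz_incl A) ip.
  by move=> x; rewrite /= [LHS]uP /= (ses_comp _ (syz_ses A)) linear0.
have [g gP] := AB v.
have [|h hP] := ses_factor (f := u \- (i \o g)) (syz_ses A).
  by move=> a; rewrite /= gP vP subrr.
exists h => a; have [x <-] := cover_surj a.
by rewrite hP /= linearB (ses_comp _ ip) subr0 [LHS]uP.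
Qed.

(** A converse of [ext1_lift]: Ext^1 may be tested on any embedding of [B] into an injective. *)
Lemma ext1_of_lift A B E C (i : {linear B -> E}) (p : {linear E -> C}) :
  ses i p -> injective_module E ->
  (forall f : {linear A -> C}, exists g : {linear A -> E}, forall a, p (g a) = f a) ->
  ext1 A B.
Proof.
move=> ip Einj lift f; have [ii ex ps] := ip.
have [sinj _ _] := syz_ses A.
have [h hP] := Einj _ _ (syz_incl A) (i \o f) sinj.
have [|c cP] := ses_factor (f := p \o h) (syz_ses A).
  by move=> x; have /= -> := hP x; rewrite (ses_comp _ ip).
have [g gP] := lift c.
have [|k kP] := @ses_restrict _ _ _ _ i p (h \- (g \o cover A)) ip.
  by move=> x; rewrite /= linearB gP cP subrr.
exists k => x; apply: ii; rewrite kP /= (ses_comp _ (syz_ses A)) linear0 subr0.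
exact: hP.
Qed.

Lemma ext1_proj P B : projective_module P -> ext1 P B.
Proof.
move=> Pproj; apply: (ext1_of_lift (cosyz_ses B) (hull_injective B)) => f.
by have [_ _ ps] := cosyz_ses B; have [g gP] := Pproj _ _ _ f ps; exists g.
Qed.

Lemma ext1_inj A E : injective_module E -> ext1 A E.
Proof.
move=> Einj f; have [ii _ _] := syz_ses A.
by have [g gP] := Einj _ _ _ f ii; exists g.
Qed.

Lemma projective_of_ext1 P : (forall B, ext1 P B) -> projective_module P.
Proof.
move=> PB X Y p f ps.
by have [g gP] := ext1_lift f (ker_ses ps) (PB _); exists g.
Qed.

Lemma injective_of_ext1 E : (forall A, ext1 A E) -> injective_module E.
Proof.
move=> AE X Y i f ii.
by have [g gP] := ext1_extend f (coker_ses ii) (AE _); exists g.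
Qed.

Lemma ext1_mid_l A' A A'' B (i : {linear A' -> A}) (p : {linear A -> A''}) :
  ses i p -> ext1 A' B -> ext1 A'' B -> ext1 A B.
Proof.
move=> ip A'B A''B; have [ii _ _] := ip.
apply: (ext1_of_lift (cosyz_ses B) (hull_injective B)) => f.
have [g gP] := ext1_lift (f \o i) (cosyz_ses B) A'B.
have [h hP] := hull_injective B _ _ _ g ii.
have [|k kP] := ses_factor (f := f \- (cosyz_proj B \o h)) ip.
  by move=> a; rewrite /=; have /= -> := hP a; rewrite gP subrr.
have [l lP] := ext1_lift k (cosyz_ses B) A''B.
by exists (h \+ (l \o p)) => a; rewrite /= linearD lP kP /= addrC subrK.
Qed.

Lemma ext1_of_extend A B K P (i : {linear K -> P}) (p : {linear P -> A}) :
  ses i p -> ext1 P B ->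
  (forall f : {linear K -> B}, exists g : {linear P -> B}, forall x, g (i x) = f x) ->
  ext1 A B.
Proof.
move=> ip PB extend; have [ii ex ps] := ip; have [jj exB qs] := cosyz_ses B.
apply: (ext1_of_lift (cosyz_ses B) (hull_injective B)) => f.
have [g gP] := ext1_lift (f \o p) (cosyz_ses B) PB.
have [|h hP] := @ses_restrict _ _ _ _ (hull_emb B) (cosyz_proj B) (g \o i) (cosyz_ses B).
  by move=> x; rewrite /= gP /= (ses_comp _ ip) linear0.
have [k kP] := extend h.
have [|l lP] := ses_factor (f := g \- (hull_emb B \o k)) ip.
  by move=> x; rewrite /= kP hP subrr.
exists l => a; have [x <-] := ps a.
by rewrite lP /= linearB gP (ses_comp _ (cosyz_ses B)) subr0.
Qed.

Section Shift.
Variables (A K P B E C : lmodType R).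
Variables (i : {linear K -> P}) (p : {linear P -> A}).
Variables (j : {linear B -> E}) (q : {linear E -> C}).
Hypotheses (ip : ses i p) (jq : ses j q) (Einj : injective_module E).

(** Dimension shifting: Ext^1(A, C) and Ext^1(K, B) are both compared with Ext^2(A, B), through [P]
    and through [E]. *)
Lemma ext1_shift : ext1 P C -> ext1 K B -> ext1 A C.
Proof.
move=> PC KB; apply: (ext1_of_extend ip PC) => f; have [ii _ _] := ip.
have [g gP] := ext1_lift f jq KB; have [h hP] := @Einj _ _ _ g ii.
by exists (q \o h) => x; have /= -> := hP x; rewrite gP.
Qed.

Lemma ext1_unshift : projective_module P -> ext1 A C -> ext1 K B.
Proof.
move=> Pproj AC; apply: (ext1_of_lift jq Einj) => f; have [_ _ qs] := jq.
have [g gP] := ext1_extend f ip AC; have [h hP] := Pproj _ _ _ g qs.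
by exists (h \o i) => x; have /= -> := hP (i x); rewrite gP.
Qed.
End Shift.

Definition syzn k M := iter k (@syz R) M.
Definition cosyzn k M := iter k (@cosyz R) M.

(* [ext k A B] says that Ext^(k+1)(A, B) = 0. *)
Definition ext k A B := ext1 (syzn k A) B.
Definition pdle k A := forall B, ext k A B.
Definition idle k B := forall A, ext k A B.

Lemma ext_cosyz k A B E C (j : {linear B -> E}) (q : {linear E -> C}) :
  ses j q -> injective_module E -> ext k.+1 A B <-> ext k A C.
Proof.
move=> jq Einj; split.
  by apply: ext1_shift (syz_ses _) jq Einj _; apply/ext1_proj/(cover_projective _).
exact: ext1_unshift (syz_ses _) jq Einj (@cover_projective _).
Qed.

(** Balance of Ext: each syzygy on the left is traded for a cosyzygy on the right, so that results
    about one variable serve for the other. *)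
Lemma extE k A B : ext k A B <-> ext1 A (cosyzn k B).
Proof.
elim: k B => [//|k IH] B; rewrite /cosyzn iterSr -IH.
exact: ext_cosyz (cosyz_ses B) (hull_injective B).
Qed.

Lemma ext_syz k A B K P (i : {linear K -> P}) (p : {linear P -> A}) :
  ses i p -> projective_module P -> ext k.+1 A B <-> ext k K B.
Proof.
move=> ip Pproj; rewrite !extE /cosyzn iterS; split.
  exact: ext1_unshift ip (cosyz_ses _) (hull_injective _) Pproj.
by apply: ext1_shift ip (cosyz_ses _) (hull_injective _) _; apply: ext1_proj.
Qed.

Lemma ext_inj k A E : injective_module E -> ext k A E.
Proof. exact: ext1_inj. Qed.

Lemma ext_mid_l k A' A A'' B (i : {linear A' -> A}) (p : {linear A -> A''}) :
  ses i p -> ext k A' B -> ext k A'' B -> ext k A B.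
Proof. by rewrite !extE; apply: ext1_mid_l. Qed.

Section LongExact.
Variables (B' B B'' : lmodType R) (i : {linear B' -> B}) (p : {linear B -> B''}).
Hypothesis ip : ses i p.

Lemma ext_mid k A : ext k A B' -> ext k A B'' -> ext k A B.
Proof.
rewrite /ext; set A1 := syzn k A => A1B' A1B'' f; have [ii ex ps] := ip.
have [g gP] := A1B'' (p \o f).
have [h hP] := cover_projective A1 _ _ p g ps.
have [|l lP] := @ses_restrict _ _ _ _ i p (f \- (h \o syz_incl A1)) ip.
  by move=> x; rewrite /= linearB; have /= -> := hP (syz_incl A1 x); rewrite gP subrr.
have [m mP] := A1B' l.
by exists (h \+ (i \o m)) => x; rewrite /= mP lP /= addrC subrK.
Qed.

Lemma ext_right k A : ext k.+1 A B' -> ext k A B -> ext k A B''.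
Proof.
rewrite /ext; set A1 := syzn k A => A1B' A1B f.
have [g gP] := ext1_lift f ip A1B'; have [h hP] := A1B g.
by exists (p \o h) => x; rewrite /= hP gP.
Qed.

Lemma ext_left k A : ext k A B'' -> ext k.+1 A B -> ext k.+1 A B'.
Proof.
rewrite /ext /syzn iterS; set A1 := iter k _ A => AB'' AB f.
have [ii ex ps] := ip.
have [g gP] := AB (i \o f).
have [|h hP] := ses_factor (f := p \o g) (syz_ses (syz A1)).
  by move=> x; rewrite /= gP /= (ses_comp _ ip).
have [h' h'P] := AB'' h.
have [l lP] := cover_projective A1 _ _ p h' ps.
have [|m mP] := ses_restrict (f := g \- (l \o syz_incl A1 \o cover (syz A1))) ip.
  move=> x; rewrite /= linearB; have /= -> := lP (syz_incl A1 (cover (syz A1) x)).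
  by rewrite h'P hP subrr.
exists m => x; apply: ii; rewrite mP /= gP /= (ses_comp _ (syz_ses (syz A1))).
by rewrite (linear0 (syz_incl A1)) (linear0 l) subr0.
Qed.
End LongExact.

Lemma idleS k B : idle k B -> idle k.+1 B.
Proof. by move=> kB A; rewrite /ext /syzn iterSr; apply: kB. Qed.
Lemma idle_le k n B : (k <= n)%N -> idle k B -> idle n B.
Proof. by move=> /subnK <-; elim: (n - k)%N => // m IH /IH /idleS. Qed.
Lemma pdleS k A : pdle k A -> pdle k.+1 A.
Proof.
move=> kA B; apply: (extE _ _ _).2; rewrite /cosyzn iterSr; exact: (extE _ _ _).1 (kA _).
Qed.
Lemma pdle_le k n A : (k <= n)%N -> pdle k A -> pdle n A.
Proof. by move=> /subnK <-; elim: (n - k)%N => // m IH /IH /pdleS. Qed.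

Lemma idle0P B : idle 0 B <-> injective_module B.
Proof. by split=> [/injective_of_ext1|Binj A]; last exact: ext1_inj. Qed.
Lemma pdle0P A : pdle 0 A <-> projective_module A.
Proof. by split=> [/projective_of_ext1|Aproj B]; last exact: ext1_proj. Qed.

Lemma idle_right k B' B B'' (i : {linear B' -> B}) (p : {linear B -> B''}) :
  ses i p -> idle k B' -> idle k B -> idle k B''.
Proof. by move=> ip B'k Bk A; exact: (ext_right ip (@idleS _ _ B'k A) (Bk A)). Qed.

Lemma idle_left B' B B'' (i : {linear B' -> B}) (p : {linear B -> B''}) : ses i p ->
  (exists n, idle n B) -> (exists n, idle n B'') -> exists n, idle n B'.
Proof.
move=> ip [n Bn] [m Bm]; exists (maxn n m).+1 => A; apply: (ext_left ip).
  by apply: idle_le Bm A; apply: leq_maxr.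
by apply: idle_le Bn A; rewrite leqW // leq_maxl.
Qed.

Lemma idle_cosyz k B E C (i : {linear B -> E}) (p : {linear E -> C}) :
  ses i p -> injective_module E -> idle k.+1 B <-> idle k C.
Proof.
by move=> ip Einj; split=> k_ A; [exact: (ext_cosyz k A ip Einj).1|exact: (ext_cosyz k A ip Einj).2].
Qed.

Lemma pdle_syz k K P A (i : {linear K -> P}) (p : {linear P -> A}) :
  ses i p -> projective_module P -> pdle k.+1 A <-> pdle k K.
Proof.
by move=> ip Pproj; split=> k_ B; [exact: (ext_syz k B ip Pproj).1|exact: (ext_syz k B ip Pproj).2].
Qed.

Lemma ext_dprod k A (I : Type) (M : I -> lmodType R) :
  (forall i, ext k A (M i)) -> ext k A (dprod M).
Proof.
move=> AM f; have g i := cid (AM i (dcoord i \o f)).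
exists (dtuple (fun i => sval (g i))) => x; apply: dcoord_ext => i.
by rewrite dtupleE (svalP (g i)).
Qed.

Lemma pair_ses M N : ses (linl M N) (lsnd M N).
Proof.
split=> [x y|x|y].
- by rewrite !linlE => /(congr1 (lfst M N)); rewrite !lfstE.
- split=> [e|[y <-]]; last by rewrite linlE lsndE.
  by exists (lfst M N x); rewrite linlE [RHS]dsum2_eta e.
- by exists (lmkpair 0 y); rewrite lsndE.
Qed.

Lemma idle_pair k M N : idle k M -> idle k N -> idle k (dsum2 M N).
Proof. by move=> Mk Nk A; apply: (ext_mid (pair_ses M N)). Qed.
Lemma pdle_pair k M N : pdle k M -> pdle k N -> pdle k (dsum2 M N).
Proof. by move=> Mk Nk A; apply: (ext_mid_l (pair_ses M N)). Qed.

Lemma ext_retract_l k A A' B (i : {linear A' -> A}) (r : {linear A -> A'}) :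
  cancel i r -> ext k A B -> ext k A' B.
Proof.
move=> ri; rewrite !extE; set C := cosyzn k B => AC.
apply: (ext1_of_lift (cosyz_ses C) (hull_injective C)) => f.
have [g gP] := ext1_lift (f \o r) (cosyz_ses C) AC.
by exists (g \o i) => a; rewrite /= gP /= ri.
Qed.

Lemma ext_retract_r k A B B' (i : {linear B' -> B}) (r : {linear B -> B'}) :
  cancel i r -> ext k A B -> ext k A B'.
Proof.
move=> ri AB f; have [g gP] := AB (i \o f).
by exists (r \o g) => a; rewrite /= gP /= ri.
Qed.

End Ext.

Arguments cover_projective {R} M.

(** * Projective, injective and flat dimension *)

Section Resolutions.
Variable R : pzRingType.
Implicit Types M N K P : lmodType R.

Definition zero_module : lmodType R := dprod (fun v : void => (R^o : lmodType R)).

Lemma zero_module0 (x : zero_module) : x = 0.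
Proof. by apply: dcoord_ext. Qed.

Lemma zero_injective : injective_module zero_module.
Proof. by apply: dprod_injective. Qed.

Lemma zero_projective : projective_module zero_module.
Proof. by move=> A B p f _; exists \0 => x; rewrite (zero_module0 x) !linear0. Qed.

Section Left.
Variable C : lmodType R -> Prop.

Lemma left_resolution0 M : left_resolution_le C M 0 ->
  exists (P : lmodType R) (p : {linear P -> M}), [/\ C P, injective p & surjective p].
Proof.
move=> [P [d [eps [CP P0 es ex _]]]]; exists (P 0%N), eps; split=> //.
by apply: lin_inj => x /ex[y <-]; rewrite (P0 1%N isT y) linear0.
Qed.

Lemma left_resolutionS M n : left_resolution_le C M n.+1 ->
  exists K P (i : {linear K -> P}) (p : {linear P -> M}),
    [/\ ses i p, C P & left_resolution_le C K n].
Proof.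
move=> [P [d [eps [CP Pn es ex exd]]]].
exists (sub (ker_submodule eps)), (P 0%N), (incl (ker_submodule eps)), eps.
have [|e eP] := ses_restrict (f := d 0%N) (ker_ses es).
  by move=> x; apply/ex; exists x.
split=> //; first exact: ker_ses.
exists (fun i => P i.+1), (fun i => d i.+1), e; split=> //.
- by move=> i ni x; apply: Pn.
- by move=> m; have [x xP] := (ex _).1 (inclP m); exists x; apply: incl_inj; rewrite eP.
- move=> y; rewrite -exd -eP; split=> [->|ey]; first by rewrite linear0.
  by apply: (@incl_inj _ _ _ (ker_submodule eps)); rewrite linear0.
Qed.

Lemma left_resolution0_intro M : C M -> C zero_module -> left_resolution_le C M 0.
Proof.
move=> CM C0; pose P i : lmodType R := if i is 0%N then M else zero_module.
exists P, (fun i => \0), idfun; split.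
- by case.
- by case=> // i _; exact: zero_module0.
- by move=> m; exists m.
- by move=> y; split=> [/= ->|[x <-] //]; exists (0 : zero_module).
- by move=> i y; split=> [_|//]; exists (0 : zero_module); rewrite (zero_module0 y).
Qed.

Lemma left_resolutionS_intro M K P n (i : {linear K -> P}) (p : {linear P -> M}) :
  ses i p -> C P -> left_resolution_le C K n -> left_resolution_le C M n.+1.
Proof.
move=> [ii ex ps] CP [Q [d [eps [CQ Qn es exe exd]]]].
pose Q' j : lmodType R := if j is j'.+1 then Q j' else P.
pose d' j : {linear Q' j.+1 -> Q' j} :=
  match j with 0%N => (i \o eps : {linear Q 0%N -> P}) | j'.+1 => d j' end.
exists Q', d', p; split.
- by case.
- by case=> // j nj; apply: Qn.
- exact: ps.
- move=> y; rewrite ex; split=> [[x <-]|[x <-]].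
    by have [z <-] := es x; exists z.
  by exists (eps x).
- case=> [|j]; last exact: exd.
  move=> y; rewrite -exe; split=> [e|e]; last by rewrite /= e linear0.
  by apply: ii; rewrite linear0.
Qed.
End Left.

Section Right.
Variable C : lmodType R -> Prop.

Lemma right_resolution0 M : right_resolution_le C M 0 ->
  exists (I : lmodType R) (i : {linear M -> I}), [/\ C I, injective i & surjective i].
Proof.
move=> [I [d [eta [CI I0 ei ex _]]]]; exists (I 0%N), eta; split=> // y.
by apply/ex; exact: I0.
Qed.

Lemma right_resolutionS M n : right_resolution_le C M n.+1 ->
  exists (I N : lmodType R) (i : {linear M -> I}) (p : {linear I -> N}),
    [/\ ses i p, C I & right_resolution_le C N n].
Proof.
move=> [I [d [eta [CI In ei ex exd]]]].
exists (I 0%N), (quot (im_submodule eta)), eta, (proj (im_submodule eta)).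
have [|e eP] := ses_factor (f := d 0%N) (coker_ses ei).
  by move=> x; apply/ex; exists x.
split=> //; first exact: coker_ses.
exists (fun i => I i.+1), (fun i => d i.+1), e; split=> //.
- by move=> i ni x; apply: In.
- apply: lin_inj => y; have [x <-] := proj_surj (im_submodule eta) y.
  by rewrite eP => e0; apply/(projP (im_submodule eta))/ex.
- move=> y; rewrite exd; split=> [[x <-]|[x <-]].
    by exists (proj (im_submodule eta) x); rewrite eP.
  by have [z <-] := proj_surj (im_submodule eta) x; exists z; rewrite eP.
Qed.

Lemma right_resolution0_intro M : C M -> C zero_module -> right_resolution_le C M 0.
Proof.
move=> CM C0; pose P i : lmodType R := if i is 0%N then M else zero_module.
exists P, (fun i => \0), idfun; split.
- by case.
- by case=> // i _; exact: zero_module0.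
- by [].
- by move=> y; split=> [_|[x <-]]; [exists y|rewrite /=].
- by move=> i y; split=> [_|//]; exists (0 : P i); rewrite (zero_module0 y).
Qed.

Lemma right_resolutionS_intro M (I : lmodType R) N n (i : {linear M -> I}) (p : {linear I -> N}) :
  ses i p -> C I -> right_resolution_le C N n -> right_resolution_le C M n.+1.
Proof.
move=> [ii ex ps] CI [Q [d [eta [CQ Qn ei exe exd]]]].
pose Q' j : lmodType R := if j is j'.+1 then Q j' else I.
pose d' j : {linear Q' j -> Q' j.+1} :=
  match j with 0%N => (eta \o p : {linear I -> Q 0%N}) | j'.+1 => d j' end.
exists Q', d', i; split.
- by case.
- by case=> // j nj; apply: Qn.
- exact: ii.
- move=> y; rewrite -ex; split=> [e|e]; last by rewrite /= e linear0.
  by apply: ei; rewrite linear0.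
- case=> [|j]; last exact: exd.
  move=> y; rewrite exe; split=> [[x <-]|[x <-]].
    by have [z <-] := ps x; exists z.
  by exists (p x).
Qed.
End Right.

Lemma pdle_resolution n M : pdle n M <-> left_resolution_le (@projective_module R) M n.
Proof.
elim: n M => [|n IH] M.
  rewrite pdle0P; split=> [Mproj|].
    exact: left_resolution0_intro Mproj zero_projective.
  move=> /left_resolution0[P [p [Pproj pi ps]]].
  have [q qP] := factor_inj (f := idfun) pi ps.
  move=> A B e f es; have [g gP] := Pproj A B e (f \o p) es.
  by exists (g \o q) => x; have /= -> := gP (q x); rewrite qP.
split=> [Mn|].
  apply: left_resolutionS_intro (syz_ses M) (cover_projective M) _.
  exact: (IH _).1 ((pdle_syz n (syz_ses M) (cover_projective M)).1 Mn).
move=> /left_resolutionS[K [P [i [p [ip Pproj /IH Kn]]]]].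
exact/(pdle_syz _ ip Pproj).
Qed.

Lemma idle_resolution n M : idle n M <-> right_resolution_le (@injective_module R) M n.
Proof.
elim: n M => [|n IH] M.
  rewrite idle0P; split=> [Minj|].
    exact: right_resolution0_intro Minj zero_injective.
  move=> /right_resolution0[P [p [Pinj pi ps]]].
  have [q qP] := factor_inj (f := idfun) pi ps.
  by apply: (retract_injective (i := p) (r := q)) => // x; apply: pi; rewrite qP.
split=> [Mn|].
  apply: right_resolutionS_intro (cosyz_ses M) (hull_injective M) _.
  exact: (IH _).1 ((idle_cosyz n (cosyz_ses M) (hull_injective M)).1 Mn).
move=> /right_resolutionS[K [P [i [p [ip Pinj /IH Kn]]]]].
exact/(idle_cosyz _ ip Pinj).
Qed.

Lemma einf_le (Q : nat -> Prop) n : Q n -> ele (einf Q) (Fin n).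
Proof.
move=> Qn; rewrite /einf; case: pselect => [h|[]]; last by exists n.
by case: ex_minnP => m _ /(_ n); apply; apply/asboolP.
Qed.

Lemma einf_ex (Q : nat -> Prop) n : ele (einf Q) (Fin n) -> exists2 m, (m <= n)%N & Q m.
Proof.
rewrite /einf; case: pselect => // h; case: ex_minnP => m /asboolP Qm _ /= mn.
by exists m.
Qed.

Lemma spliP n : ele (spli R) (Fin n) <-> forall I : lmodType R, injective_module I -> pdle n I.
Proof.
split=> [Rn I Iinj|Rn].
  have /einf_ex[m mn /pdle_resolution] : ele (proj_dim I) (Fin n).
    have : ele (proj_dim I) (spli R) by apply: esup_ub; exists I.
    by move: (proj_dim I) (spli R) Rn => [a|] [b|] //= bn ab; apply: leq_trans ab bn.
  exact: pdle_le.
apply: esup_least => _ [I [Iinj ->]].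
by apply/einf_le/pdle_resolution/Rn.
Qed.

Lemma silpP n : ele (silp R) (Fin n) <-> forall P : lmodType R, projective_module P -> idle n P.
Proof.
split=> [Rn I Iinj|Rn].
  have /einf_ex[m mn /idle_resolution] : ele (inj_dim I) (Fin n).
    have : ele (inj_dim I) (silp R) by apply: esup_ub; exists I.
    by move: (inj_dim I) (silp R) Rn => [a|] [b|] //= bn ab; apply: leq_trans ab bn.
  exact: idle_le.
apply: esup_least => _ [I [Iinj ->]].
by apply/einf_le/idle_resolution/Rn.
Qed.

End Resolutions.

(** * Tensor-Hom adjunction, character duality and flatness *)

Lemma tensor_ext (R : pzRingType) (E : lmodType R^c) (M : lmodType R) (V : zmodType)
    (f g : {additive tensor E M -> V}) :
  (forall e m, f (tens e m) = g (tens e m)) -> f =1 g.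
Proof.
move=> fg; elim/quotW => x; rewrite -(freeg_sumE x) !raddf_sum.
apply: eq_bigr => -[e m] _.
by rewrite -[coeff _ _]intz -freegU_mulz !raddfMz; congr (_ *~ _); exact: fg.
Qed.

Section Adjunction.
Variables (R : pzRingType) (E : lmodType R^c) (M : lmodType R).

Lemma tensor_hom_dual (phi : {additive tensor E M -> QmodZ}) :
  exists h : {linear E -> dual M}, forall e m, dual_fun (h e) m = phi (tens e m).
Proof.
have [tDl tDr tZ] := tens_balanced E M.
have hP e : zmod_morphism (fun m => phi (tens e m)).
  by move=> m m'; rewrite -raddfB; congr (phi _); rewrite -[m in RHS](subrK m' m) [in RHS]tDr addrK.
have hL : linear (fun e => dual_mk (mkadd (hP e))).
  move=> r e e'; apply: dual_ext => m; rewrite dualP !dual_mkE !mkaddE tDl tZ.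
  exact: raddfD.
by exists (mklin hL) => e m; rewrite mklinE dual_mkE mkaddE.
Qed.

Lemma hom_dual_tensor (h : {linear E -> dual M}) :
  exists phi : {additive tensor E M -> QmodZ}, forall e m, phi (tens e m) = dual_fun (h e) m.
Proof.
have hb : balanced (fun e m => dual_fun (h e) m).
  split=> [e e' m|e m m'|r e m]; first by rewrite linearD dualD.
    by rewrite raddfD.
  by rewrite linearZ dualZ.
have phiP : zmod_morphism (tensor_lift (fun e m => dual_fun (h e) m)).
  by move=> x y; apply: tensor_liftB.
by exists (mkadd phiP) => e m; rewrite mkaddE tensor_liftE.
Qed.

Lemma flip_dual_char (h : {linear E -> dual M}) :
  exists k : {linear M -> character E}, forall m e, character_fun (k m) e = dual_fun (h e) m.
Proof.
have kP m : zmod_morphism (fun e => dual_fun (h e) m).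
  by move=> e e'; rewrite linearB dualD dualN.
have kL : linear (fun m => char_mk (mkadd (kP m))).
  move=> r m m'; apply: char_ext => e; rewrite charP !char_mkE !mkaddE raddfD.
  by rewrite linearZ dualZ.
by exists (mklin kL) => m e; rewrite mklinE char_mkE mkaddE.
Qed.

Lemma flip_char_dual (k : {linear M -> character E}) :
  exists h : {linear E -> dual M}, forall e m, dual_fun (h e) m = character_fun (k m) e.
Proof.
have hP e : zmod_morphism (fun m => character_fun (k m) e).
  by move=> m m'; rewrite linearB.
have hL : linear (fun e => dual_mk (mkadd (hP e))).
  move=> r e e'; apply: dual_ext => m; rewrite dualP !dual_mkE !mkaddE raddfD.
  by rewrite linearZ charZ.
by exists (mklin hL) => m e; rewrite mklinE dual_mkE mkaddE.
Qed.

End Adjunction.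

Lemma qz_factor (U V : zmodType) (g : {additive U -> V}) (f : {additive U -> QmodZ}) :
  (forall x, g x = 0 -> f x = 0) -> exists h : {additive V -> QmodZ}, forall x, h (g x) = f x.
Proof.
move=> gf; have [||y|h hP] := @qz_extend V (fun y z => exists x, g x = y /\ f x = z).
- by exists 0; rewrite !raddf0.
- by move=> _ _ _ _ [u [<- <-]] [u' [<- <-]]; exists (u - u'); rewrite !raddfB.
- by case=> x [/gf -> <-].
- by exists h => x; apply: hP; exists x.
Qed.

Lemma additive_range_subgroup (U V : zmodType) (f : {additive U -> V}) :
  subgroup (fun y => exists x, f x = y).
Proof.
split=> [|_ _ [x <-] [y <-]]; first by exists 0; rewrite raddf0.
by exists (x - y); rewrite raddfB.
Qed.

Section DualExact.
Variable R : pzRingType.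

Lemma dual_ses (A B C : lmodType R) (i : {linear A -> B}) (p : {linear B -> C}) :
  ses i p -> ses (dual_map p) (dual_map i).
Proof.
move=> [ii ex ps]; split.
- move=> f g fg; apply: dual_ext => c; have [b <-] := ps c.
  by rewrite -!dual_mapE fg.
- move=> f; split=> [f0|[g <-]]; last first.
    by apply: dual_ext => a; rewrite !dual_mapE (ex _).2 ?raddf0 //; exists a.
  have [|chi chiP] := @qz_factor _ _ p (dual_fun f).
    move=> x /ex[a <-]; by rewrite -dual_mapE f0.
  by exists (dual_mk chi); apply: dual_ext => b; rewrite dual_mapE dual_mkE chiP.
- move=> f; have [chi chiP] := qz_injective (dual_fun f) ii.
  by exists (dual_mk chi); apply: dual_ext => a; rewrite dual_mapE dual_mkE chiP.
Qed.

Lemma char_ses (A B C : lmodType R^c) (i : {linear A -> B}) (p : {linear B -> C}) :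
  ses i p -> ses (char_map p) (char_map i).
Proof.
move=> [ii ex ps]; split.
- move=> f g fg; apply: char_ext => c; have [b <-] := ps c.
  by rewrite -!char_mapE fg.
- move=> f; split=> [f0|[g <-]]; last first.
    by apply: char_ext => a; rewrite !char_mapE (ex _).2 ?raddf0 //; exists a.
  have [|chi chiP] := @qz_factor _ _ p (character_fun f).
    move=> x /ex[a <-]; by rewrite -char_mapE f0.
  by exists (char_mk chi); apply: char_ext => b; rewrite char_mapE char_mkE chiP.
- move=> f; have [chi chiP] := qz_injective (character_fun f) ii.
  by exists (char_mk chi); apply: char_ext => a; rewrite char_mapE char_mkE chiP.
Qed.

(** Factor over the image of [g], then extend from the image to [C]. *)
Lemma injective_factor (B C I : lmodType R) (g : {linear B -> C}) (f : {linear B -> I}) :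
  injective_module I -> (forall b, g b = 0 -> f b = 0) ->
  exists h : {linear C -> I}, forall b, h (g b) = f b.
Proof.
move=> Iinj gf; pose G := im_submodule g.
have [|g' g'P] := factor_inj (f := g) (@incl_inj _ _ _ G).
  by move=> b; apply: (incl_onto G); exists b.
have [||f' f'P] := @factor_surj _ _ _ _ g' f.
- by move=> y; have [b bP] := inclP y; exists b; apply: (@incl_inj _ _ _ G); rewrite g'P.
- by move=> b b0; apply: gf; rewrite -g'P b0 linear0.
have [h hP] := Iinj _ _ (incl G) f' (@incl_inj _ _ _ G).
by exists h => b; rewrite -f'P -[RHS]hP /= g'P.
Qed.

(** Maps A -> P^+ are maps P -> A^+, and these lift over the surjection B^+ -> A^+. *)
Lemma proj_dual_injective (P : lmodType R) : projective_module P -> injective_module (dual P).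
Proof.
move=> Pproj A B i f ii; have [k kP] := flip_dual_char f.
have [g gP] := Pproj _ _ (char_map i) k (and3_rec (fun _ _ => id) (char_ses (coker_ses ii))).
have [h hP] := flip_char_dual g; exists h => a; apply: dual_ext => m /=.
by rewrite hP -char_mapE; have /= -> := gP m.
Qed.

Lemma proj_char_injective (P : lmodType R^c) :
  projective_module P -> injective_module (character P).
Proof.
move=> Pproj A B i f ii; have [k kP] := flip_char_dual f.
have [g gP] := Pproj _ _ (dual_map i) k (and3_rec (fun _ _ => id) (dual_ses (coker_ses ii))).
have [h hP] := flip_dual_char g; exists h => a; apply: char_ext => m /=.
by rewrite hP -dual_mapE; have /= -> := gP m.
Qed.

End DualExact.

Section Flat.
Variable R : pzRingType.

(** Maps A -> M^+ are characters of the tensor product of A and M. Tensoring the injection with [M]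
    keeps it injective, and Q/Z extends the character. *)
Lemma flat_dual_injective (M : lmodType R) : flat_module M -> injective_module (dual M).
Proof.
move=> Mflat A B i f ii.
have [phi phiP] := hom_dual_tensor f.
have ex : exact (\0 : {linear zero_module R^c -> A}) i.
  move=> a; split=> [|[z <-]]; last by rewrite linear0.
  by rewrite -(linear0 i) => /ii ->; exists 0.
have ti : injective (tensor_map i (idfun : {linear M -> M})).
  move=> x y xy; apply/eqP; rewrite -subr_eq0; apply/eqP.
  have [|z <-] := (Mflat _ _ _ _ _ ex (x - y)).1; first by rewrite raddfB; apply/eqP; rewrite subr_eq0; apply/eqP.
  apply: (@tensor_ext _ _ _ _ (tensor_map (\0 : {linear zero_module R^c -> A})
    (idfun : {linear M -> M})) \0) => e m; rewrite [LHS]tensor_mapE /=.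
  have [tDl _ _] := tens_balanced A M.
  by apply: (@addrI _ (tens 0 m)); rewrite -tDl !addr0.
have [psi psiP] := qz_injective phi ti.
have [g gP] := tensor_hom_dual psi; exists g => a; apply: dual_ext => m /=.
by rewrite gP -phiP -psiP; congr (psi _); exact/esym/tensor_mapE.
Qed.

(** A character separating [t] from the image of [f] is a map B -> M^+ that vanishes on ker g, hence
    factors through [g]; so it kills [t]. *)
Lemma dual_injective_flat (M : lmodType R) : injective_module (dual M) -> flat_module M.
Proof.
move=> Minj A B C f g fg t; split=> [gt|[x <-]]; last first.
  apply: (@tensor_ext _ _ _ _ (tensor_map g (idfun : {linear M -> M}) \o
    tensor_map f (idfun : {linear M -> M})) \0) => e m /=.
  rewrite [X in tensor_map _ _ X]tensor_mapE [LHS]tensor_mapE /= (fg _).2; last by exists e.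
  have [tDl _ _] := tens_balanced C M.
  by apply: (@addrI _ (tens 0 m)); rewrite -tDl !addr0.
apply: contrapT => nt.
have [c [cf ct]] := qz_separate (additive_range_subgroup (tensor_map f (idfun : {linear M -> M}))) nt.
have [h hP] := tensor_hom_dual c.
have [|k kP] := @injective_factor _ _ _ _ g h Minj.
  move=> b /fg[a <-]; apply: dual_ext => m; rewrite hP dual0; apply: cf.
  by exists (tens a m); exact: tensor_mapE.
have [psi psiP] := hom_dual_tensor k.
have : c t = psi (tensor_map g (idfun : {linear M -> M}) t).
  apply: (@tensor_ext _ _ _ _ c (psi \o tensor_map g (idfun : {linear M -> M}))) => e m /=.
  by rewrite -hP -kP -psiP; congr (psi _); exact/esym/tensor_mapE.
by rewrite gt raddf0 => c0; rewrite c0 eqxx in ct.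
Qed.

Lemma projective_flat (P : lmodType R) : projective_module P -> flat_module P.
Proof. by move=> /proj_dual_injective/dual_injective_flat. Qed.

End Flat.

Section Unop.
Variable R : pzRingType.

(** For [K] over [R^c], [dual K] is a module over [R^c^c] and [character K] one over [R], with the
    same elements and action. Test modules are moved between the two rings by [unop]. *)
Definition unop_data (M : lmodType R^c^c) : module_data R.
Proof.
refine (@ModuleData R M 0 -%R +%R (fun (r : R) (x : M) => (r : R^c^c) *: x) _ _ _ _ _ _ _ _).
- exact: addrA.
- exact: addrC.
- exact: add0r.
- exact: addNr.
- by move=> a b v; rewrite scalerA.
- exact: scale1r.
- by move=> a x y; rewrite scalerDr.
- by move=> v a b; exact: (scalerDl v (a : R^c^c) (b : R^c^c)).
Defined.
Definition unop (M : lmodType R^c^c) : lmodType R := carrier (unop_data M).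

Lemma char_dual_injective (K : lmodType R^c) :
  injective_module (character K) -> injective_module (dual K).
Proof.
move=> Kinj A B i f ii.
have iL : linear (fun x : unop A => i x : unop B) by move=> r x y; exact: (linearP i).
have fL : linear (fun x : unop A => char_mk (dual_fun (f x))).
  by move=> r x y; apply: char_ext => k; rewrite charP !char_mkE [in LHS](linearP f) dualP.
have [|g gP] := Kinj _ _ (mklin iL) (mklin fL).
  by move=> x y; rewrite !mklinE => /ii.
have gL : linear (fun x : B => dual_mk (character_fun (g x))).
  move=> r x y; apply: dual_ext => k; rewrite dualP !dual_mkE.
  by have -> := linearP g (r : R) (x : unop B) y; rewrite charP.
exists (mklin gL) => a; apply: dual_ext => k; rewrite /= mklinE dual_mkE.
by have := gP a; rewrite /= !mklinE => ->.
Qed.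

Lemma char_injective_flat (K : lmodType R^c) :
  injective_module (character K) -> flat_module K.
Proof. by move=> /char_dual_injective/dual_injective_flat. Qed.

End Unop.

Section FlatDim.
Variable R : pzRingType.

(** Dualising a free presentation of [M] gives an injective copresentation of the dual. From here on
    [idle n (dual M)] expresses that [M] has flat dimension at most n. *)
Lemma idle_dual_flat n (M : lmodType R) : idle n (dual M) <-> flat_module (syzn n M).
Proof.
elim: n M => [|n IH] M.
  rewrite idle0P; split=> [/dual_injective_flat|/flat_dual_injective] //.
rewrite /syzn iterSr -/(syzn n _) -IH.
exact: idle_cosyz (dual_ses (syz_ses M)) (proj_dual_injective (cover_projective M)).
Qed.

Lemma idle_char_flat n (E : lmodType R^c) : idle n (character E) -> flat_module (syzn n E).
Proof.
elim: n E => [|n IH] E; first by move=> /idle0P/char_injective_flat.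
rewrite /syzn iterSr => En; apply: IH.
have Finj := proj_char_injective (cover_projective E).
exact: (idle_cosyz n (char_ses (syz_ses E)) Finj).1 En.
Qed.

End FlatDim.

Lemma projective_lift (R : pzRingType) (P A B C : lmodType R)
    (d : {linear A -> B}) (d' : {linear B -> C}) (f : {linear P -> B}) :
  projective_module P -> exact d d' -> (forall x, d' (f x) = 0) ->
  exists g : {linear P -> A}, forall x, d (g x) = f x.
Proof.
move=> Pproj ex df; pose G := im_submodule d.
have [|d1 d1P] := factor_inj (f := d) (@incl_inj _ _ _ G).
  by move=> a; apply: (incl_onto G); exists a.
have [|f1 f1P] := factor_inj (f := f) (@incl_inj _ _ _ G).
  by move=> x; apply: (incl_onto G); apply/ex.
have [|g gP] := Pproj _ _ d1 f1.
  by move=> y; have [a aP] := inclP y; exists a; apply: (@incl_inj _ _ _ G); rewrite d1P.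
by exists g => x; rewrite -d1P -f1P; have /= -> := gP x.
Qed.

(** The linear counterpart of [qz_extend]; it glues compatible partial maps along a chain and
    extends the result to all of [P]. *)
Lemma injective_extend_rel (R : pzRingType) (P I : lmodType R) (G : P -> I -> Prop) :
  injective_module I -> G 0 0 ->
  (forall a x x' y y', G x y -> G x' y' -> G (a *: x + x') (a *: y + y')) ->
  (forall y, G 0 y -> y = 0) ->
  exists t : {linear P -> I}, forall x y, G x y -> t x = y.
Proof.
move=> Iinj G00 GL G0.
have GU x y y' : G x y -> G x y' -> y = y'.
  move=> Gy Gy'; apply/eqP; rewrite -subr_eq0; apply/eqP/G0.
  by have := GL (-1) _ _ _ _ Gy' Gy; rewrite !scaleN1r addNr addrC.
have DP : submodule (fun x => exists y, G x y).
  split=> [|a x x' [y Gxy] [y' Gxy']]; first by exists 0.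
  by exists (a *: y + y'); apply: GL.
have [u|u y y'|a u u' y y' Gy Gy'|f fP] := @lin_choice R (sub DP) I (fun u y => G (incl DP u) y).
- exact: inclP u.
- exact: GU.
- by rewrite linearP; apply: GL.
have [t tP] := Iinj _ _ (incl DP) f (@incl_inj _ _ _ DP).
exists t => x y Gxy; have [u ux] := incl_onto DP (ex_intro _ y Gxy).
by apply: GU Gxy; rewrite -ux; have /= -> := tP u; apply: fP.
Qed.

(** * Flat modules and acyclic complexes of injectives *)

Section Span.
Variables (R : pzRingType) (P : lmodType R).
Implicit Types S T : P -> Prop.

Definition span S x := forall N : P -> Prop, submodule N -> (forall y, S y -> N y) -> N x.

Lemma span_submodule S : submodule (span S).
Proof.
split=> [N [N0 _] _ //|a x y Sx Sy N NP SN].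
by case: (NP) => _; apply; [apply: Sx|apply: Sy].
Qed.
Lemma span_in S x : S x -> span S x. Proof. by move=> Sx N _; apply. Qed.
Lemma span_mono S T : (forall x, S x -> T x) -> forall x, span S x -> span T x.
Proof. by move=> ST x Sx N NP TN; apply: Sx => // y /ST/TN. Qed.
Lemma span_ext (M : lmodType R) (f g : {linear P -> M}) S :
  (forall x, S x -> f x = g x) -> forall x, span S x -> f x = g x.
Proof.
move=> fg x Sx; apply: (Sx (fun x => f x = g x)) => //.
by split=> [|a u v fu fv]; rewrite ?linear0 // !linearP fu fv.
Qed.
End Span.

Section Equational.
Variables (R : pzRingType) (B : choiceType) (P F : lmodType R).
Variable pi : {linear P -> F}.
Hypothesis (pi_surj : surjective pi) (Finj : injective_module (dual F)).

(* The equational criterion for flatness. *)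
Lemma flat_relation (s : seq B) (r : B -> R) (x : B -> F) : uniq s ->
  \sum_(b <- s) r b *: x b = 0 ->
  exists q : B -> P, (forall b, b \in s -> pi (q b) = x b) /\ \sum_(b <- s) r b *: q b = 0.
Proof.
move=> us rx0; pose V := dprod (fun _ : B => F).
(* The tuples on [s] that lift to a solution in [P]. If [xs] is not among them, a character [c]
   separates it from them. *)
pose H (z : V) := exists q : B -> P, [/\ forall b, b \in s -> pi (q b) = dcoord b z,
  forall b, b \notin s -> dcoord b z = 0 & \sum_(b <- s) r b *: q b = 0].
have HP : subgroup H.
  split=> [|z z' [q [qz z0 rq]] [q' [qz' z0' rq']]].
    exists (fun=> 0); split=> [b _|b _|]; rewrite ?linear0 //.
    by rewrite big1 // => b _; rewrite scaler0.
  exists (fun b => q b - q' b); split=> [b bs|b bs|].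
  - by rewrite !linearB qz // qz'.
  - by rewrite linearB z0 // z0' // subrr.
  - rewrite (eq_bigr (fun b => r b *: q b - r b *: q' b)) => [|b _]; last exact: scalerBr.
    by rewrite sumrB rq rq' subrr.
pose xs : V := dmk (fun b => if b \in s then x b else 0).
have [[q [qx _ rq]]|nH] := pselect (H xs).
  by exists q; split=> // b bs; rewrite qx // dcoordE bs.
have [c [cH /eqP[]]] := qz_separate HP nH.
have [chi chiP] := character_finite_product c us.
pose cb b : dual F := dual_mk (chi b).
have cbE b y : dual_fun (cb b) y = chi b y by [].
pose f := flift (fun b => if b \in s then cb b else 0).
pose g := flift (fun b => (if b \in s then r b else 0) : ((R^c)^o)%type).
have fE l : f l = \sum_(b <- s) (fcoef l b) *: cb b.
  rewrite (@flift_sum_on _ _ _ _ s) // => [|b /negbTE->//].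
  by apply: eq_big_seq => b ->.
have gE l : g l = \sum_(b <- s) r b * (fcoef l b : R).
  rewrite (@flift_sum_on _ _ _ _ s) // => [|b /negbTE->//].
  by apply: eq_big_seq => b ->.
(* If the sum of the r_b l_b is 0, then (l_b y) lifts to the solution (l_b p), so [c] kills it.
   Hence [f] vanishes on the kernel of [g] and factors through [g]. *)
have [l gl0|h hP] := @injective_factor _ _ _ _ g f Finj.
  apply: dual_ext => y; rewrite fE dual_sum dual0.
  under eq_bigr do rewrite dualZ cbE.
  rewrite -(chiP (fun b => (fcoef l b : R) *: y)); apply: cH; have [p py] := pi_surj y.
  exists (fun b => (fcoef l b : R) *: p); split=> [b bs|b /negbTE bs|].
  - by rewrite dcoordE bs linearZ py.
  - by rewrite dcoordE bs.
  - under eq_bigr do rewrite scalerA.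
    by rewrite -scaler_suml -gE gl0 scale0r.
(* The components of [c] are thus h(1) r_b, so [c xs] is h(1) evaluated at the given relation, that
   is 0. *)
have cbh b : b \in s -> cb b = (r b : R^c) *: h (1 : R).
  move=> bs; rewrite -linearZ.
  have := hP (fbasis R^c b); rewrite !flift_basis bs => <-; congr (h _).
  exact: (esym (mulr1 (r b : R^c))).
rewrite chiP.
rewrite (eq_big_seq (fun b => dual_fun (h (1 : R)) (r b *: x b))) => [|b bs]; last first.
  by rewrite -cbE cbh // dualZ.
by rewrite -raddf_sum rx0 raddf0.
Qed.

End Equational.

Section Villamayor.
Variables (R : pzRingType) (B : choiceType) (F : lmodType R).
Variable pi : {linear free_module R B -> F}.
Hypothesis (pi_surj : surjective pi) (Fflat : flat_module F).
Let P := free_module R B.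

(** For one element x = sum x_b e_b, the relation among the pi(e_b) lifts to elements q_b with the
    same images and sum x_b q_b = 0. The map e_b |-> e_b - q_b has values in the kernel and fixes
    x. *)
Lemma flat_fixing (a : seq P) : (forall x, x \in a -> pi x = 0) ->
  exists theta : {linear P -> P}, (forall x, pi (theta x) = 0) /\
    forall x, x \in a -> theta x = x.
Proof.
have one x : pi x = 0 -> exists theta : {linear P -> P}, (forall x, pi (theta x) = 0) /\
    theta x = x.
  move=> px0; have := @flat_relation R B P F pi pi_surj (flat_dual_injective Fflat)
    (supp x) (fcoef x) (fun b => pi (fbasis R b)) (supp_uniq x).
  case=> [|q [qP rq]].
    have := congr1 pi (free_sum x); rewrite px0 linear_sum => e; rewrite [RHS]e.
    by apply: eq_bigr => b _; rewrite linearZ.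
  exists (flift (fun b => if b \in supp x then fbasis R b - q b else 0)); split.
    move=> y; apply: (@free_map_ext _ _ _ (pi \o flift _) \0) => b.
    by rewrite /= flift_basis; case: ifP => bs; rewrite ?linear0 // linearB qP // subrr.
  rewrite flift_sum [RHS]free_sum.
  rewrite (eq_big_seq (fun b => fcoef x b *: fbasis R b - fcoef x b *: q b)) => [|b ->].
    by rewrite sumrB rq subr0.
  exact: scalerBr.
elim: a => [_|x a IH ax]; first by exists \0; split=> // x; rewrite /= linear0.
have [|t [tK ta]] := IH; first by move=> y ya; apply: ax; rewrite inE ya orbT.
have [|t' [t'K t'x]] := one (x - t x).
  by rewrite linearB tK ax ?subr0 // inE eqxx.
(* The complement of this map is the product (1 - t')(1 - t), which kills whatever [t] fixes, and
   also [x]. *)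
exists (t \+ (t' \o (idfun \- t))); split=> [y|y].
  by rewrite /= linearD tK t'K addr0.
rewrite inE => /orP[/eqP->|ya] /=; first by rewrite t'x addrC subrK.
by rewrite ta // subrr linear0 addr0.
Qed.

End Villamayor.

(** All words of length at most [n]: a finite set for each stage of the countable closure, while
    every word is reached at some stage. *)
Fixpoint words (T : eqType) (a : seq T) n : seq (seq T) :=
  if n is n'.+1 then [::] :: [seq x :: w | x <- a, w <- words a n'] else [:: [::]].

Lemma words_in (T : eqType) (a w : seq T) n :
  (forall x, x \in w -> x \in a) -> (size w <= n)%N -> w \in words a n.
Proof.
elim: n w => [|n IH] [|x w] //= wa wn; rewrite inE; apply/allpairsP.
exists (x, w); split=> //; first by apply: wa; rewrite inE eqxx.
by apply: IH => // y yw; apply: wa; rewrite inE yw orbT.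
Qed.

Lemma words_sub (T : eqType) (a w : seq T) n :
  w \in words a n -> forall x, x \in w -> x \in a.
Proof.
elim: n w => [|n IH] w /=; first by rewrite inE => /eqP->.
rewrite inE => /orP[/eqP->//|/allpairsP[[x w'] [/= xa /IH w'a ->]]] y.
by rewrite inE => /orP[/eqP->|/w'a].
Qed.

Section Lifting.
Variables (R : pzRingType) (X : complex R).
Hypotheses (Xac : acyclic X) (Xinj : forall i, injective_module (X i)).
Let d i := differential X i.

Section OnSubmodules.
Variable P : lmodType R.
Implicit Types N : P -> Prop.

(* Every map from [N] to a cycle of [X] lifts to [X]; by injectivity of [X] the maps can be taken to be defined on [P]. *)
Definition lifts N i := forall f : {linear P -> X (i + 1)},
  (forall x, N x -> d (i + 1) (f x) = 0) ->
  exists g : {linear P -> X i}, forall x, N x -> f x = d i (g x).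

(** Two lifts of [f] differ on [N1] by a map into cycles, that is by d r; subtracting it makes the
    second lift extend the first. The correction lives one degree lower, so all degrees have to be
    treated together. *)
Lemma lifts_extend (N1 N2 : P -> Prop) i (f : {linear P -> X (i + 1 + 1)})
    (s : {linear P -> X (i + 1)}) :
  lifts N1 i -> lifts N2 (i + 1) -> (forall x, N1 x -> N2 x) ->
  (forall x, N2 x -> d (i + 1 + 1) (f x) = 0) ->
  (forall x, N1 x -> f x = d (i + 1) (s x)) ->
  exists s' : {linear P -> X (i + 1)},
    (forall x, N2 x -> f x = d (i + 1) (s' x)) /\ forall x, N1 x -> s' x = s x.
Proof.
move=> L1 L2 N12 fc fs; have [s2 s2P] := L2 f fc.
have [|r rP] := L1 (s2 \- s).
  by move=> x N1x; rewrite /= linearB -s2P ?fs ?subrr //; apply: N12.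
exists (s2 \- (d i \o r)); split=> x Nx /=; last by rewrite -rP //= subKr.
by rewrite linearB differentialK subr0 s2P.
Qed.

End OnSubmodules.

Section Closure.
Variables (B : choiceType) (K : free_module R B -> Prop).
Let P := free_module R B.
Hypothesis KP : submodule K.
Variable theta : seq P -> {linear P -> P}.
Hypothesis thetaK : forall a, (forall x, x \in a -> K x) -> forall x, K (theta a x).
Hypothesis theta_fix : forall a, (forall x, x \in a -> K x) -> forall x, x \in a -> theta a x = x.

Let supps (a : seq P) : seq B := flatten [seq supp x | x <- a].

Lemma supps_in a x b : x \in a -> b \notin supps a -> fcoef x b = 0.
Proof.
move=> xa ba; apply: suppP; apply: contra ba => bx; apply/flattenP.
by exists (supp x) => //; apply: map_f.
Qed.

(** For a list [a] of closed elements, [theta a], cut down to the basis elements in the supports of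
    [a], has values in the span of the closure and still fixes [a]. So these spans inherit the
    fixing property of [K]. *)
Inductive cl (T : P -> Prop) : P -> Prop :=
| cl_in x : T x -> cl T x
| cl_step a b : (forall x, x \in a -> cl T x) -> b \in supps a -> cl T (theta a (fbasis R b)).

Lemma cl_mono (T U : P -> Prop) : (forall x, T x -> U x) -> forall x, cl T x -> cl U x.
Proof.
move=> TU x; elim=> {x} [x /TU|a b _ IH ba]; first exact: cl_in.
exact: cl_step.
Qed.

Lemma cl_K (T : P -> Prop) : (forall x, T x -> K x) -> forall x, cl T x -> K x.
Proof. by move=> TK x; elim=> {x} [x /TK//|a b _ IH ba]; exact: thetaK. Qed.

Section Countable.
Variable c : seq P.
Hypothesis cK : forall x, x \in c -> K x.

(** The second piece makes the inclusion of a stage into the next one factor as needed in [M_lift];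
    the third treats all words, so that the stages exhaust the closure. *)
Let next (a : seq P) n := a ++ [seq theta a (fbasis R b) | b <- supps a] ++
  flatten [seq [seq theta w (fbasis R b) | b <- supps w] | w <- words a n].
Let st n := nat_rect (fun=> seq P) c (fun n a => next a n) n.
Let stS n : st n.+1 = next (st n) n. Proof. by []. Qed.

Let st_sub n m x : x \in st n -> x \in st (n + m)%N.
Proof.
by move=> xn; elim: m => [|m IH]; rewrite ?addn0 // addnS stS mem_cat IH.
Qed.
Let st_le n m x : (n <= m)%N -> x \in st n -> x \in st m.
Proof. by move=> /subnKC <-; apply: st_sub. Qed.

Let st_cl n x : x \in st n -> cl (fun x => x \in c) x.
Proof.
elim: n x => [|n IH] x; first exact: cl_in.
rewrite stS !mem_cat => /orP[/IH//|/orP[/mapP[b bs ->]|]].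
  by apply: cl_step bs => y /IH.
case/flattenP=> _ /mapP[w /words_sub wa ->] /mapP[b bs ->].
by apply: cl_step bs => y /wa/IH.
Qed.
Let st_K n x : x \in st n -> K x.
Proof. by move=> /st_cl; apply: cl_K. Qed.

Let cl_st x : cl (fun x => x \in c) x -> exists n, x \in st n.
Proof.
elim=> {x} [x xc|a b _ IH ba]; first by exists 0%N.
have [n [an na]] : exists n, (forall x, x \in a -> x \in st n) /\ (size a <= n)%N.
  elim: a {ba} IH => [|x a IHa] IH; first by exists 0%N.
  have [n [an na]] := IHa (fun y ya => IH y (mem_behead (s := x :: a) ya)).
  have [m xm] := IH x (mem_head x a).
  exists (maxn n m).+1; split; last by rewrite /= ltnS (leq_trans na) // leq_maxl.
  move=> y; rewrite inE => /orP[/eqP->|/an].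
    by apply: st_le xm; rewrite leqW // leq_maxr.
  by apply: st_le; rewrite leqW // leq_maxl.
exists n.+1; rewrite stS !mem_cat; apply/orP; right; apply/orP; right.
apply/flattenP; exists [seq theta a (fbasis R b) | b <- supps a]; last exact: map_f.
by apply: map_f; apply: words_in.
Qed.

Let M n := span (fun x => x \in st n).
Let M_le n m x : (n <= m)%N -> M n x -> M m x.
Proof. by move=> nm; apply: span_mono => y; apply: st_le. Qed.
Let N := span (cl (fun x => x \in c)).
Let M_N n x : M n x -> N x. Proof. by apply: span_mono => y /st_cl. Qed.
Let N_M x : N x -> exists n, M n x.
Proof.
move=> Nx; apply: (Nx (fun x => exists n, M n x)) => [|y /cl_st[n yn]]; last by exists n; apply: span_in.
split=> [|r u v [n un] [m vm]]; first by exists 0%N; case: (span_submodule (fun x => x \in st 0)).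
exists (maxn n m); have [_] := span_submodule (fun x => x \in st (maxn n m)); apply.
  by apply: M_le un; rewrite leq_maxl.
by apply: M_le vm; rewrite leq_maxr.
Qed.

(* The inclusion of [M n] into [M n.+1] factors through a free module. *)
Let M_lift n i (f : {linear P -> X (i + 1)}) :
  (forall x, M n.+1 x -> d (i + 1) (f x) = 0) ->
  exists g : {linear P -> X i}, forall x, M n x -> f x = d i (g x).
Proof.
move=> fc; pose t := flift (fun b => if b \in supps (st n) then theta (st n) (fbasis R b) else 0).
have tM x : M n.+1 (t x).
  have MP := span_submodule (fun x => x \in st n.+1).
  rewrite /t flift_sum; apply: (submodule_sum MP) => b; apply: (submoduleZ MP).
  case: ifP => bs; last by case: MP.
  by apply: span_in; rewrite stS !mem_cat (map_f (fun b => theta _ (fbasis R b)) bs) orbT.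
have tfix x : M n x -> t x = x.
  apply: (span_ext (f := t) (g := idfun)) => y yn /=.
  rewrite -[RHS](theta_fix (@st_K n) yn) /t flift_sum [in RHS](free_sum y) linear_sum.
  apply: eq_bigr => b _; rewrite [RHS]linearZ_LR; case: ifPn => // bs.
  by rewrite (supps_in yn bs) !scale0r.
have [g gP] := @projective_lift R P _ _ _ (d i) (d (i + 1)) (f \o t)
  (@free_projective R B) (@Xac i) (fun x => fc _ (tM x)).
by exists g => x Mx; rewrite gP /= tfix.
Qed.

(** Lifts on the stages [M n] are corrected one after the other, as in [lifts_extend], so that they
    stabilise on each stage and can be glued. *)
Lemma cl_countable i : lifts N (i + 1).
Proof.
move=> f fc.
(* [M_lift] loses one stage: from a lift on [M n.+1], agreement can be kept on [M n] only. *)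
pose inv n (t : {linear P -> X (i + 1)}) := forall x, M n.+1 x -> f x = d (i + 1) (t x).
have step n t : inv n t ->
    exists t', inv n.+1 t' /\ forall x, M n x -> t' x = t x.
  move=> tP; have [|s sP] := @M_lift n.+2 (i + 1) f; first by move=> x /M_N/fc.
  have [|r rP] := @M_lift n i (s \- t).
    by move=> x Mx; rewrite /= linearB -tP // -sP ?subrr //; apply: M_le Mx.
  exists (s \- (d i \o r)); split=> x Mx /=; last by rewrite -rP //= subKr.
  by rewrite linearB differentialK subr0 sP.
have [|t0 t0P] := @M_lift 1 (i + 1) f; first by move=> x /M_N/fc.
pose T n : {t | inv n t} := nat_rect (fun n => {t | inv n t}) (exist _ t0 t0P)
  (fun n t => exist _ _ (svalP (cid (step n _ (svalP t)))).1) n.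
have TS n x : M n x -> sval (T n.+1) x = sval (T n) x.
  exact: (svalP (cid (step n _ (svalP (T n))))).2.
have Tle n m x : (n <= m)%N -> M n x -> sval (T m) x = sval (T n) x.
  move=> /subnKC <- Mx; elim: (m - n)%N => [|k IH]; rewrite ?addn0 // addnS TS //.
  by apply: M_le Mx; rewrite leq_addr.
have [||y|t tP] := @injective_extend_rel R P (X (i + 1))
   (fun x y => exists n, M n x /\ y = sval (T n) x) (@Xinj _).
- by exists 0%N; rewrite linear0; split=> //; case: (span_submodule (fun x => x \in st 0)).
- move=> a x x' _ _ [n [Mx ->]] [m [Mx' ->]]; exists (maxn n m).
  have [Mm Mm'] : M (maxn n m) x /\ M (maxn n m) x'.
    by split; [apply: M_le Mx; rewrite leq_maxl|apply: M_le Mx'; rewrite leq_maxr].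
  split; first by have [_] := span_submodule (fun x => x \in st (maxn n m)); apply.
  by rewrite linearP -(Tle n (maxn n m)) ?leq_maxl // -(Tle m (maxn n m)) ?leq_maxr.
- by move=> [n [_ ->]]; rewrite linear0.
exists t => x /N_M[n Mx]; rewrite (tP x (sval (T n) x)); last by exists n.
by apply: (svalP (T n)); apply: M_le Mx.
Qed.

End Countable.

Section WellOrdered.
Variable le : rel P.
Hypothesis le_wo : wochoice.well_order le.
Let lt x y := le x y /\ x <> y.

Let minP (A : P -> Prop) : (exists x, A x) -> exists x, A x /\ forall y, A y -> le x y.
Proof.
move=> [x Ax]; have [|z [[zA zmin] _]] := le_wo (A := [pred y | `[< A y >]]).
  by exists x; rewrite inE.
exists z; split; first by move: zA; rewrite inE.
by move=> y Ay; apply: zmin; rewrite inE.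
Qed.

Let le_anti x y : le x y -> le y x -> x = y.
Proof.
move=> xy yx; have [|z [_ zu]] := le_wo (A := [pred u | (u == x) || (u == y)]).
  by exists x; rewrite inE eqxx.
have lexx u : le u u.
  have [|v [vu]] := @minP (fun v => v = u); first by exists u.
  by move=> /(_ u (erefl u)); rewrite vu.
transitivity z; [apply/esym|]; apply: zu; split; rewrite ?inE ?eqxx ?orbT //.
  by move=> u; rewrite inE => /orP[] /eqP->.
by move=> u; rewrite inE => /orP[] /eqP->.
Qed.

(** A set with a finite list adjoined. In the transfinite induction, adding [u] to the segment below
    [u] merely lengthens the list. *)
Let seg (T : P -> Prop) (c : seq P) x := T x \/ x \in c.
Let N T c := span (cl (seg T c)).
Let below t x := K x /\ lt x t.
Let downset (T : P -> Prop) :=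
  (forall x, T x -> K x) /\ forall x y, T x -> K y -> lt y x -> T y.

Let N_mono (T U : P -> Prop) c c' : (forall x, seg T c x -> seg U c' x) ->
  forall x, N T c x -> N U c' x.
Proof. by move=> TU; apply: span_mono; apply: cl_mono. Qed.

Let N_sub T c : submodule (N T c). Proof. exact: span_submodule. Qed.

(* A partial lift on [N T c] is encoded by [T] together with its graph. *)
Let code T c i (s : {linear P -> X i}) : set (P * X i + P) :=
  [set u | match u with inl p => N T c p.1 /\ p.2 = s p.1 | inr x => T x end]%classic.

(** Zorn's lemma for lifts over downsets [T] inside [D]. If a maximal [T] is not [D], it is the
    segment below the least [u] missing from it; the hypothesis at [u], with the lists [c] and
    [u :: c], provides what [lifts_extend] needs. *)
Lemma cl_downset (D : P -> Prop) c i : downset D -> (forall x, x \in c -> K x) ->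
  (forall t c', D t -> (forall x, x \in c' -> K x) -> forall i, lifts (N (below t) c') i) ->
  lifts (N D c) (i + 1).
Proof.
move=> [DK Ddown] cK IH f fc.
pose good T (s : {linear P -> X (i + 1)}) := [/\ downset T, forall x, T x -> D x &
  forall x, N T c x -> f x = d (i + 1) (s x)].
pose G : set (set (P * X (i + 1) + P)) :=
  [set A | A = set0 \/ exists T s, good T s /\ A = code T c s]%classic.
have NTD T : (forall x, T x -> D x) -> forall x, N T c x -> N D c x.
  by move=> TD; apply: N_mono => x [/TD|]; [left|right].
have [s0 s0P] : exists s0, good (fun=> False) s0.
  have [x|s0 s0P] := cl_countable cK (f := f).
    by move=> Nx; apply: fc; move: x Nx; apply: span_mono; apply: cl_mono => x; right.
  exists s0; split=> // x Nx; apply: s0P; move: x Nx; apply: span_mono; apply: cl_mono.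
  by move=> x [].
have [F FG Ftot|A [GA Amax]] := @Zorn_bigcup _ G.
  pose FT T := exists s, good T s /\ F (code T c s).
  have [[T0 FT0]|noF] := pselect (exists T, FT T); last first.
    left; apply/seteqP; split=> // u [A FA Au].
    have [A0|[T [s [gs As]]]] := FG A FA; first by rewrite A0 in Au.
    by case: noF; exists T, s; rewrite -As.
  right; pose U x := exists T, FT T /\ T x.
  have FTle T T' : FT T -> FT T' -> (forall x, T x -> T' x) \/ (forall x, T' x -> T x).
    move=> [s [_ Fs]] [s' [_ Fs']].
    have [H|H] := Ftot _ _ Fs Fs'; [left|right] => x Tx; exact: (H (inr x)).
  have NU x : N U c x -> exists T, FT T /\ N T c x.
    move=> Nx; apply: (Nx (fun x => exists T, FT T /\ N T c x)).
      split=> [|a y z [T [FTT Ny]] [T' [FTT' Nz]]].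
        by exists T0; split=> //; case: (N_sub T0 c).
      have [W [FW [Wy Wz]]] : exists W, FT W /\ N W c y /\ N W c z.
        have [TT'|T'T] := FTle T T' FTT FTT'; [exists T'|exists T]; split=> //; split=> //.
          by move: Ny; apply: N_mono => u [/TT'|]; [left|right].
        by move: Nz; apply: N_mono => u [/T'T|]; [left|right].
      by exists W; split=> //; have [_] := N_sub W c; apply.
    move=> y; suff : cl (seg U c) y -> exists T, FT T /\ cl (seg T c) y.
      by move=> H /H[T [FTT clT]]; exists T; split=> //; apply: span_in.
    elim=> {x Nx y} [x [[T [FTT Tx]]|xc]|a b _ IHa ba].
    - by exists T; split=> //; apply: cl_in; left.
    - by exists T0; split=> //; apply: cl_in; right.
    have [T [FTT aT]] : exists T, FT T /\ forall x, x \in a -> cl (seg T c) x.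
      elim: a {ba} IHa => [|x a IH'] IHa; first by exists T0.
      have [T [FTT aT]] := IH' (fun y ya => IHa y (mem_behead (s := x :: a) ya)).
      have [T' [FTT' xT']] := IHa x (mem_head x a).
      have [TT'|T'T] := FTle T T' FTT FTT'; [exists T'|exists T]; split=> // y;
        rewrite inE => /orP[/eqP->//|].
      + by move=> /aT; apply: cl_mono => u [/TT'|]; [left|right].
      + by move: xT'; apply: cl_mono => u [/T'T|]; [left|right].
      + exact: aT.
    by exists T; split=> //; apply: cl_step.
  have Udown : downset U.
    split=> [x [T [[s [[[TK _] _ _] _]] /TK]]//|x y [T [FTT Tx]] Ky yx].
    by exists T; split=> //; have [s [[[_ Td] _ _] _]] := FTT; apply: Td Tx Ky yx.
  have [||y|s sP] := @injective_extend_rel R P (X (i + 1))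
     (fun x y => exists T s, [/\ good T s, F (code T c s), N T c x & y = s x]) (@Xinj _).
  - have [s [gs Fs]] := FT0; exists T0, s; split=> //; last by rewrite linear0.
    by case: (N_sub T0 c).
  - move=> a x x' _ _ [T [s [gs Fs Nx ->]]] [T' [s' [gs' Fs' Nx' ->]]].
    have [TT'|T'T] := Ftot _ _ Fs Fs'.
      have [Nx1 /= e] := TT' (inl (x, s x)) (conj Nx (erefl _)).
      exists T', s'; split=> //; last by rewrite linearP e.
      by have [_] := N_sub T' c; apply.
    have [Nx1 /= e] := T'T (inl (x', s' x')) (conj Nx' (erefl _)).
    exists T, s; split=> //; last by rewrite linearP e.
    by have [_] := N_sub T c; apply.
  - by move=> [T [s [_ _ _ ->]]]; rewrite linear0.
  exists U, s; split; first split=> //.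
  - by move=> x [T [[s1 [[_ TD _] _]] /TD]].
  - move=> x /NU[T [[s1 [gs1 Fs1]] Nx]]; rewrite (sP x (s1 x)); last by exists T, s1.
    by case: gs1 => _ _; apply.
  apply/seteqP; split=> [u [A FA Au]|[[x y] /= [/NU[T [[s1 [gs1 Fs1]] Nx]] ->]|x /= [T [[s1 [_ Fs1]] Tx]]]].
  - have [A0|[T [s1 [gs1 As]]]] := FG A FA; first by rewrite A0 in Au.
    rewrite As in FA Au; case: u Au => [[x y] /= [Nx ->]|x /= Tx]; last by exists T; split=> //; exists s1.
    split; last by rewrite (sP x (s1 x)) //; exists T, s1.
    by move: Nx; apply: N_mono => u [Tu|]; [left; exists T; split=> //; exists s1|right].
  - by exists (code T c s1) => //=; split=> //; apply: sP; exists T, s1.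
  - by exists (code T c s1).
(* The maximal set is not empty, since the code of the lift over the empty downset is larger. *)
have [A0|[T [s [[[TK Tdown] TD sP] As]]]] := GA.
  case: (Amax (code (fun=> False) c s0)); last by right; exists (fun=> False), s0.
  rewrite A0; split=> [u //|/(_ (inl (0, s0 0)))]; apply; split=> //.
  by case: (N_sub (fun=> False) c).
have [TeqD|nTD] := pselect (forall x, D x -> T x).
  by exists s => x Nx; apply: sP; move: Nx; apply: N_mono => y [/TeqD|]; [left|right].
have [|u [[Du nTu] umin]] := @minP (fun x => D x /\ ~ T x).
  by move/existsNP: nTD => [x /not_implyP[Dx nTx]]; exists x.
have Tu x : T x <-> below u x.
  split=> [Tx|[Kx [xu xnu]]].
    split; first exact: TK.
    have xnu : x <> u by move=> e; rewrite e in Tx.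
    split=> //; apply: contrapT => nxu; apply: nTu; apply: Tdown Tx (DK _ Du) _; split; last exact/nesym.
    have [z [[->|->] zm]] := @minP (fun y => y = x \/ y = u) (ex_intro _ x (or_introl (erefl x))).
      by case: nxu; apply: zm; right.
    by apply: zm; left.
  apply: contrapT => nTx; apply: (xnu); apply: le_anti => //; apply: umin; split=> //.
  exact: Ddown Du Kx (conj xu xnu).
have ucK x : x \in u :: c -> K x by rewrite inE => /orP[/eqP->|/cK//]; apply: DK.
pose T' x := T x \/ x = u.
have [|||x Nx||s' [s'P s's]] := @lifts_extend _ (N T c) (N T' c) i f s.
- move=> g gc; have [x Nx|h hP] := IH u c Du cK i g.
    by apply: gc; move: Nx; apply: N_mono => y [/Tu|]; [left|right].
  by exists h => x Nx; apply: hP; move: Nx; apply: N_mono => y [/Tu|]; [left|right].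
- move=> g gc; have [x Nx|h hP] := IH u (u :: c) Du ucK (i + 1) g.
    apply: gc; move: Nx; apply: N_mono => y [/Tu Ty|]; first by left; left.
    by rewrite inE => /orP[/eqP->|yc]; [left; right|right].
  exists h => x Nx; apply: hP; move: Nx; apply: N_mono => y [[/Tu Ty|->]|yc]; first by left.
    by right; rewrite inE eqxx.
  by right; rewrite inE yc orbT.
- by move=> x; apply: N_mono => y [Ty|]; [left; left|right].
- apply: fc; move: Nx; apply: NTD => y [/TD//|->//].
- exact: sP.
case: (Amax (code T' c s')).
  rewrite As; split=> [[[x y] /= [Nx ->]|x /= Tx]|/(_ (inr u)) H]; last by apply: nTu; apply: H; right.
    by split; [move: Nx; apply: N_mono => z [Tz|]; [left; left|right]|rewrite s's].
  by left.
right; exists T', s'; split=> //; split=> // [|x [/TD//|->//]].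
split=> [x [/TK//|->]|x y [Tx|->] Ky yx]; first exact: DK.
  by left; apply: Tdown Tx Ky yx.
by left; apply/Tu.
Qed.

(** Transfinite induction on [t], for all lists and degrees at once: below a least counterexample
    the hypothesis of [cl_downset] holds. *)
Lemma cl_segment t c i : (forall x, x \in c -> K x) -> lifts (N (below t) c) i.
Proof.
apply: contrapT => bad.
pose A t := exists c, exists i, (forall x, x \in c -> K x) /\ ~ lifts (N (below t) c) i.
have [|u [[c' [j [c'K nl]]] umin]] := @minP A.
  exists t, c, i; apply: contrapT => H; apply: bad => cK.
  by apply: contrapT => nl; apply: H.
case: nl; rewrite -(subrK 1 j); apply: cl_downset => //.
  split=> [x []//|x y [Kx [xu nxu]] Ky [yx nyx]]; split=> //.
  split; last by move=> e; apply: nxu; apply: le_anti => //; rewrite -e.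
  have [z [zE zm]] := @minP (fun z => z = x \/ z = y \/ z = u) (ex_intro _ x (or_introl (erefl x))).
  have zu : le z u by apply: zm; right; right.
  case: zE => [e|[<-//|e]].
    have xy : le x y by rewrite -e; apply: zm; right; left.
    by case: nyx; apply: le_anti.
  have ux : le u x by rewrite -e; apply: zm; left.
  by case: nxu; apply: le_anti.
move=> v c'' [Kv [vu nvu]] c''K k; apply: contrapT => nl; apply: nvu.
by apply: le_anti => //; apply: umin; exists c'', k.
Qed.

Lemma cl_whole i : lifts K i.
Proof.
have KE x : N K [::] x <-> K x.
  split=> [Nx|Kx]; last by apply: span_in; apply: cl_in; left.
  by apply: (Nx K KP); apply: cl_K => y [].
rewrite -(subrK 1 i) => f fc.
have [|//|||g gP] := @cl_downset K [::] (i - 1) _ _ _ f.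
- by split=> // x y _ Ky _.
- by move=> t c' _ c'K j; apply: cl_segment.
- by move=> x /KE; apply: fc.
- by exists g => x /KE; apply: gP.
Qed.

End WellOrdered.

End Closure.

Definition Hom_exact (A : lmodType R) := forall i (f : {linear A -> X (i + 1)}),
  (forall x, d (i + 1) (f x) = 0) -> exists g : {linear A -> X i}, forall x, f x = d i (g x).

(** The terms of [X] are injective, so the three Hom complexes form a short exact sequence. *)
Lemma Hom_exact_quotient (K P A : lmodType R) (j : {linear K -> P}) (p : {linear P -> A}) :
  ses j p -> Hom_exact K -> Hom_exact P -> Hom_exact A.
Proof.
move=> jp KX PX i; rewrite -(subrK 1 i); move: (i - 1) => {}i f fc.
have [|g gP] := PX (i + 1) (f \o p); first by move=> x; apply: fc.
have [|r rP] := KX i (g \o j).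
  by move=> x; rewrite /= -gP /= (ses_comp _ jp) linear0.
have [jinj _ _] := jp; have [s sP] := @Xinj i _ _ j r jinj.
have [|h hP] := ses_factor (f := g \- (d i \o s)) jp.
  by move=> x; rewrite /=; have /= -> := sP x; rewrite -rP subrr.
exists h => a; have [_ _ ps] := jp; have [x <-] := ps a.
by rewrite hP /= linearB differentialK subr0 -gP.
Qed.

Lemma projective_Hom_exact (P : lmodType R) : projective_module P -> Hom_exact P.
Proof.
move=> Pproj i f fc; have [g gP] := projective_lift Pproj (@Xac i) fc.
by exists g => x; rewrite gP.
Qed.

Lemma flat_Hom_exact (F : lmodType R) : flat_module F -> Hom_exact F.
Proof.
move=> Fflat; pose K x := cover F x = 0.
have KP : submodule K by apply: ker_submodule.
have fixing (a : seq (free_cover F)) : exists theta : {linear free_cover F -> free_cover F},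
    (forall x, x \in a -> K x) -> (forall x, K (theta x)) /\ forall x, x \in a -> theta x = x.
  (* Lists outside the kernel get the zero map, because [theta] has to be total. *)
  have [aK|naK] := pselect (forall x, x \in a -> K x); last by exists \0.
  by have [th thP] := flat_fixing (@cover_surj R F) Fflat aK; exists th.
have /choice[theta thetaP] := fixing.
have [le le_wo] := wochoice.well_ordering_principle (free_cover F).
have KX i : lifts K i.
  exact: (@cl_whole _ K KP theta (fun a aK => (thetaP a aK).1) (fun a aK => (thetaP a aK).2) le le_wo i).
refine (Hom_exact_quotient (syz_ses F) _ (projective_Hom_exact (cover_projective F))).
move=> i f fc; have [syzi syzex _] := syz_ses F.
have [f' f'P] := @Xinj (i + 1) _ _ _ f syzi.
have [x Kx|g gP] := KX i f'.
  by have [y <-] := (syzex x).1 Kx; have /= -> := f'P y; apply: fc.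
exists (g \o syz_incl F) => y; rewrite -(f'P y) /= gP //.
exact: (ses_comp y (syz_ses F)).
Qed.

Lemma flat_syzn_Hom_exact n (A : lmodType R) : flat_module (syzn n A) -> Hom_exact A.
Proof.
elim: n A => [|n IH] A; first exact: flat_Hom_exact.
rewrite /syzn iterSr => /IH; move=> AX.
exact: (Hom_exact_quotient (syz_ses A) AX (projective_Hom_exact (cover_projective A))).
Qed.

Lemma Hom_exact_acyclic (A : lmodType R) : Hom_exact A -> Hom_acyclic A X.
Proof.
move=> AX i f; split=> [df0|[g <-]]; last first.
  by apply: linear_ext => x; rewrite /= differentialK.
have [x|g gP] := AX i (Hom_fun f); last by exists g; apply: linear_ext => x; rewrite /= gP.
exact: (congr1 (fun h => Hom_fun h x) df0).
Qed.

End Lifting.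

Lemma flat_syzn_totally_acyclic (R : pzRingType) :
  (forall E : lmodType R, injective_module E -> exists n, flat_module (syzn n E)) ->
  acyclic_injectives_totally_acyclic R.
Proof.
move=> Rfd X [Xac Xinj]; split=> // E /Rfd[n En].
exact: Hom_exact_acyclic (flat_syzn_Hom_exact Xac Xinj En).
Qed.

(** * Null-homotopic maps into pure exact sequences *)

(* Purity through solvability of finite linear systems: the equations are indexed by [s], the unknowns by [t]. *)
Definition pure_in (R : pzRingType) (B : choiceType) (J : lmodType R) (N : J -> Prop) :=
  forall (s t : seq B) (a : B -> B -> R) (psi : B -> J), uniq s -> uniq t ->
  (forall b, b \in s -> N (\sum_(b' <- t) a b b' *: psi b')) ->
  exists g : B -> J, (forall b, N (g b)) /\
    forall b, b \in s -> \sum_(b' <- t) a b b' *: g b' = \sum_(b' <- t) a b b' *: psi b'.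

Section NullHomotopy.
Variables (R : pzRingType) (B : choiceType) (J : nat -> lmodType R).
Variable d : forall n, {linear J n -> J n.+1}.
Hypothesis dex : forall n, exact (d n) (d n.+1).
Hypothesis dpure : forall n, pure_in B (fun x => d n x = 0).

Let dd n x : d n.+1 (d n x) = 0. Proof. by apply/dex; exists x. Qed.

Section FiniteType.
Variables (N : nat -> seq B) (a : B -> B -> R).
Variable F : forall n, B -> J n.+1.

(** The composite of [phi] with the differential from degree n to degree n + 1, whose matrix is
    [a]. *)
Let ap n (M : lmodType R) (phi : B -> M) b := \sum_(b' <- N n.+1) a b b' *: phi b'.

Hypothesis Nuniq : forall n, uniq (N n).
Hypothesis aa : forall n b b'', b \in N n -> b'' \in N n.+2 ->
  \sum_(b' <- N n.+1) a b b' * a b' b'' = 0.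
Hypothesis Fchain : forall n b, b \in N n -> d n.+1 (F n b) = ap n (@F n.+1) b.

Let prev n := if n is m.+1 then N m else [::].

Let prev_uniq n : uniq (prev n). Proof. by case: n. Qed.

Let apD n (M : lmodType R) (phi psi : B -> M) b :
  ap n (fun b => phi b + psi b) b = ap n phi b + ap n psi b.
Proof. by rewrite /ap -big_split; apply: eq_bigr => b' _; rewrite scalerDr. Qed.
Let apB n (M : lmodType R) (phi psi : B -> M) b :
  ap n (fun b => phi b - psi b) b = ap n phi b - ap n psi b.
Proof. by rewrite /ap -sumrB; apply: eq_bigr => b' _; rewrite scalerBr. Qed.
Let ap_lin n (M M' : lmodType R) (h : {linear M -> M'}) (phi : B -> M) b :
  h (ap n phi b) = ap n (fun b => h (phi b)) b.
Proof. by rewrite /ap linear_sum; apply: eq_bigr => b' _; rewrite linearZ. Qed.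
Let ap_ap n (M : lmodType R) (phi : B -> M) b : b \in N n -> ap n (ap n.+1 phi) b = 0.
Proof.
move=> bn; rewrite /ap; under eq_bigr do rewrite scaler_sumr.
rewrite exchange_big big1_seq //= => b'' bn2.
by under eq_bigr do rewrite scalerA; rewrite -scaler_suml aa ?scale0r.
Qed.
Let ap_eq n (M : lmodType R) (phi psi : B -> M) b :
  (forall b', b' \in N n.+1 -> phi b' = psi b') -> ap n phi b = ap n psi b.
Proof. by move=> e; apply: eq_big_seq => b' /e->. Qed.

Let ap_prev n (M : lmodType R) (phi : B -> M) b : b \in prev n ->
  \sum_(b' <- N n) a b b' *: ap n phi b' = 0.
Proof. by case: n => // n; apply: ap_ap. Qed.

(** The properties of what remains of [F n] once the part of the homotopy built so far is
    subtracted. *)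
Let inv n (phi : B -> J n.+1) :=
  (forall b, b \in prev n -> \sum_(b' <- N n) a b b' *: phi b' = 0) /\
  forall b, b \in N n -> d n.+1 (phi b) = ap n (@F n.+1) b.

Let step n phi : inv phi ->
  exists sr : (B -> J n.+1) * (B -> J n),
    [/\ forall b, b \in prev n -> \sum_(b' <- N n) a b b' *: sr.2 b' = 0,
        forall b, b \in N n -> phi b = ap n sr.1 b + d n (sr.2 b) &
        inv (fun b => F n.+1 b - d n.+1 (sr.1 b))].
Proof.
move=> [phi0 dphi].
(* Purity in [J n.+2]: some [g] with values in the image of [d n.+1] agrees with [F n.+1] on
   boundaries, and [s] is a preimage of it. *)
have [b bn|g [dg gF]] := dpure (n := n.+2) (a := a) (psi := @F n.+1) (Nuniq n) (Nuniq n.+1).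
  by rewrite -[\sum_(_ <- _) _]/(ap n (@F n.+1) b) -dphi // dd.
have /choice[s sP] b : exists x, d n.+1 x = g b by apply/dex.
have ds b : b \in N n -> d n.+1 (ap n s b) = d n.+1 (phi b).
  by move=> bn; rewrite ap_lin dphi // -[RHS]gF //; apply: ap_eq => b' _; rewrite sP.
have /choice[r0 r0P] b : exists x, b \in N n -> d n x = phi b - ap n s b.
  have [bn|] := boolP (b \in N n); last by exists 0.
  have /dex[x xP] : d n.+1 (phi b - ap n s b) = 0 by rewrite linearB ds // subrr.
  by exists x.
(* Purity in [J n]: subtracting [g'] makes [r0] vanish on boundaries without changing its image
   under [d n]. *)
have [b bn|g' [dg' g'P]] := dpure (a := a) (psi := r0) (prev_uniq n) (Nuniq n).
  rewrite linear_sum (eq_big_seq (fun b' => a b b' *: phi b' - a b b' *: ap n s b')).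
    rewrite sumrB phi0 // sub0r; apply/eqP; rewrite oppr_eq0; apply/eqP.
    exact: ap_prev.
  by move=> b' b'n; rewrite linearZ_LR r0P // scalerBr.
exists (s, fun b => r0 b - g' b); split=> [b bn|b bn|] /=.
- rewrite (eq_bigr (fun b' => a b b' *: r0 b' - a b b' *: g' b')) => [|b' _].
    by rewrite sumrB g'P // subrr.
  exact: scalerBr.
- by rewrite linearB dg' subr0 r0P // addrC subrK.
split=> [b bn|b bn].
  rewrite -[LHS]/(ap n _ b) apB -(dphi b bn) -(ds b bn).
  by rewrite -(ap_lin n (d n.+1)) subrr.
by rewrite linearB dd subr0 Fchain.
Qed.

Lemma finite_null_homotopy : exists t : forall n, B -> J n,
  forall n b, b \in N n -> F n b = d n (t n b) + \sum_(b' <- N n.+1) a b b' *: t n.+1 b'.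
Proof.
have inv0 : inv (@F 0) by split=> // b bn; apply: Fchain.
pose St n := {phi : B -> J n.+1 | inv phi}.
pose nx n (u : St n) := cid (step (svalP u)).
have nxI n (u : St n) : inv (fun b => F n.+1 b - d n.+1 ((sval (nx n u)).1 b)).
  by case: (svalP (nx n u)).
pose st n : St n := nat_rect St (exist _ _ inv0) (fun n u => exist _ _ (nxI n u)) n.
pose s n := (sval (nx n (st n))).1; pose r n := (sval (nx n (st n))).2.
(* The remainder in degree n is F n minus d (s (n - 1)), and also d (r n) plus s n after the
   differential. As [r] vanishes on boundaries, s (n - 1) + r n is the homotopy. *)
pose t n : B -> J n := match n with 0%N => r 0%N | m.+1 => fun b => s m b + r m.+1 b end.
exists t => n b bn.
have stE : F n b = sval (st n) b + d n (t n b - r n b).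
  case: n bn => [|n] bn; first by rewrite /= subrr linear0 addr0.
  by rewrite /= addrK subrK.
have [_ /(_ b bn) e _] := svalP (nx n (st n)).
rewrite stE e linearB [LHS]addrC [ap n _ b + _]addrC addrA subrK; congr (_ + _).
have [r0 _ _] := svalP (nx n.+1 (st n.+1)).
by rewrite -[RHS]/(ap n (fun b' => s n b' + r n.+1 b') b) apD [X in _ + X]r0 // addr0.
Qed.

End FiniteType.

Variable delta : {linear free_module R B -> free_module R B}.
Variable f : forall n, {linear free_module R B -> J n.+1}.
Hypothesis deltaK : forall x, delta (delta x) = 0.
Hypothesis fchain : forall n x, d n.+1 (f n x) = f n.+1 (delta x).

Let e (b : B) := fbasis R b.
Let a b b' := fcoef (delta (e b)) b'.
Let next b := supp (delta (e b)).

Let flift_agree (M : lmodType R) (phi psi : B -> M) x :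
  (forall b, b \in supp x -> phi b = psi b) -> flift phi x = flift psi x.
Proof. by move=> pp; rewrite !flift_sum; apply: eq_big_seq => b /pp->. Qed.

(** [S n] collects basis elements in degree n; closure under [next] makes their spans a subcomplex,
    on which [s] is a homotopy. *)
Let good (S : nat -> B -> Prop) (s : forall n, B -> J n) :=
  (forall n b b', S n b -> b' \in next b -> S n.+1 b') /\
  forall n b, S n b -> f n (e b) = d n (s n b) + flift (s n.+1) (delta (e b)).

(** The basis elements reached from [b0] outside [S] are finitely many in each degree, and there are
    none below degree [n0]; so [finite_null_homotopy] applies to them. *)
Let good_extend S s n0 b0 : good S s -> ~ S n0 b0 ->
  exists S' s', [/\ good S' s', S' n0 b0, forall n b, S n b -> S' n b &
    forall n b, S n b -> s' n b = s n b].
Proof.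
move=> [Scl Ss] nS0.
pose init n := if n == n0 then [:: b0] else [::].
pose fresh n (c : seq B) := undup ([seq b' <- flatten [seq next b | b <- c] | `[< ~ S n b' >]] ++ init n).
pose N n := nat_rect (fun=> seq B) (init 0%N) (fun n c => fresh n.+1 c) n.
have Nuniq n : uniq (N n) by case: n => [|n]; [rewrite /= /init; case: ifP|exact: undup_uniq].
have initS n b : b \in init n -> ~ S n b.
  by rewrite /init; case: eqP => // -> ; rewrite inE => /eqP->.
have NS n b : b \in N n -> ~ S n b.
  case: n => [|n]; first exact: initS.
  rewrite /= mem_undup mem_cat => /orP[|/initS//].
  by rewrite mem_filter => /andP[/asboolP].
have initN n b : b \in init n -> b \in N n.
  by case: n => // n bn; rewrite /= mem_undup mem_cat bn orbT.
have Nb0 : b0 \in N n0 by apply: initN; rewrite /init eqxx inE.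
have Nnext n b b' : b \in N n -> b' \in next b -> S n.+1 b' \/ b' \in N n.+1.
  move=> bn b'b; have [Sb'|nSb'] := pselect (S n.+1 b'); first by left.
  right; rewrite /= mem_undup mem_cat mem_filter; apply/orP; left; apply/andP; split.
    exact/asboolP.
  by apply/flattenP; exists (next b) => //; apply: map_f.
pose s0 n b := if `[< S n b >] then s n b else 0.
have s0S n b : S n b -> s0 n b = s n b by move=> Sb; rewrite /s0 asboolT.
have s0N n b : ~ S n b -> s0 n b = 0 by move=> Sb; rewrite /s0 asboolF.
(* The defect of [s] extended by zero. It vanishes on [S], hence is a chain map on the quotient
   spanned by the new elements. *)
pose F n (x : free_module R B) := f n x - d n (flift (s0 n) x) - flift (s0 n.+1) (delta x).
have Fchain n x : d n.+1 (F n x) = F n.+1 (delta x).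
  by rewrite /F !linearB dd subr0 fchain deltaK linear0 subr0.
have FS n b : S n b -> F n (e b) = 0.
  move=> Sb; rewrite /F (Ss n b Sb) flift_basis s0S // [d n _ + _]addrC addrK.
  rewrite (@flift_agree _ (s0 n.+1) (s n.+1)) ?subrr // => b' /(Scl n b b' Sb).
  exact: s0S.
have sumN (M : lmodType R) (phi : B -> M) n b : b \in N n ->
    (forall b', S n.+1 b' -> phi b' = 0) ->
    flift phi (delta (e b)) = \sum_(b' <- N n.+1) a b b' *: phi b'.
  move=> bn phi0; rewrite (@flift_agree _ phi (fun b' => if b' \in N n.+1 then phi b' else 0)).
    rewrite (@flift_sum_on _ _ _ _ (N n.+1)) // => [|b' /negbTE->//].
    by apply: eq_big_seq => b' ->.
  by move=> b' /(Nnext n b b' bn)[/phi0->|->] //; case: ifP.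
have Flift n x : F n x = flift (fun b => F n (e b)) x.
  pose Fl : {linear free_module R B -> J n.+1} :=
    (f n \- (d n \o flift (s0 n))) \- (flift (s0 n.+1) \o delta).
  by rewrite -[LHS]/(Fl x); apply: free_map_ext => b; rewrite flift_basis.
have [n b b'' bn b''n|n b bn|t tP] := @finite_null_homotopy N a (fun n b => F n (e b)) Nuniq.
- have := sumN R^o (fun b' => fcoef (delta (e b')) b'') n b bn.
  move=> <- => [|b' Sb'].
    have fcL : linear (fun x : free_module R B => fcoef x b'' : R^o).
      by move=> r x y; rewrite fcoefP.
    have -> : flift (fun b' => fcoef (delta (e b')) b'' : R^o) (delta (e b)) =
        (mklin fcL \o delta) (delta (e b)).
      by apply: free_map_ext => b'; rewrite flift_basis /= mklinE.
    by rewrite /= deltaK linear0.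
  have /suppP -> // : b'' \notin supp (delta (e b')).
  by apply/negP => /(Scl _ _ _ Sb'); apply: NS b''n.
- rewrite Fchain [LHS]Flift.
  exact: (sumN _ (fun b' => F n.+1 (e b')) n b bn (FS n.+1)).
pose s' n b := s0 n b + (if b \in N n then t n b else 0).
exists (fun n b => S n b \/ b \in N n), s'; split; last first.
- move=> n b Sb; rewrite /s' s0S // ifN ?addr0 //; apply/negP => /NS; exact.
- by move=> n b; left.
- by right.
split=> [n b b' [Sb|bn] b'b|n b Sb].
- by left; apply: Scl Sb b'b.
- exact: Nnext bn b'b.
have s'E : flift (s' n.+1) (delta (e b)) = flift (s0 n.+1) (delta (e b)) +
    flift (fun b' => if b' \in N n.+1 then t n.+1 b' else 0) (delta (e b)).
  rewrite !flift_sum -big_split; apply: eq_bigr => b' _; exact: scalerDr.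
have fE : f n (e b) = F n (e b) + (d n (s0 n b) + flift (s0 n.+1) (delta (e b))).
  by rewrite /F flift_basis [X in _ = _ + X]addrC addrA !subrK.
have tN b' : S n.+1 b' -> (if b' \in N n.+1 then t n.+1 b' else 0) = 0.
  by move=> Sb'; case: ifP => // /NS.
rewrite fE s'E; case: Sb => [Sb|bn].
  rewrite FS // add0r /s' ifN ?addr0; last by apply/negP => /NS; apply.
  congr (_ + _); rewrite [X in _ + X](_ : _ = 0) ?addr0 //.
  rewrite (@flift_agree _ _ (fun=> 0)) => [|b' /(Scl _ _ _ Sb)/tN //].
  by rewrite flift_sum big1 // => b' _; rewrite scaler0.
rewrite (tP n b bn) (sumN _ _ n b bn tN) /s' bn linearD.
rewrite [X in _ = _ + (_ + X)](eq_big_seq (fun b' => a b b' *: t n.+1 b')) => [|b' ->//].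
by rewrite addrACA [d n (t n b) + _]addrC [X in _ + X]addrC.
Qed.

Let code (S : nat -> B -> Prop) (s : forall n, B -> J n) : set {n : nat & (B * J n)%type} :=
  [set u | S (projT1 u) (projT2 u).1 /\ (projT2 u).2 = s (projT1 u) (projT2 u).1]%classic.

(* A complex of free modules is filtered by closed sub-bases whose successive quotients are bounded on the left and finitely generated in each degree; Zorn's lemma reduces to those. *)
Lemma null_homotopy : exists s : forall n, {linear free_module R B -> J n},
  forall n x, f n x = d n (s n x) + s n.+1 (delta x).
Proof.
pose G : set (set {n : nat & (B * J n)%type}) :=
  [set A | exists S s, good S s /\ A = code S s]%classic.
have [H HG Htot|A [[S [s [gS AS]]] Amax]] := @Zorn_bigcup _ G.
  pose rel n b y := exists2 A, H A & A (existT _ n (b, y)).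
  pose S n b := exists y, rel n b y.
  pose s n b := xget 0 [set y | rel n b y]%classic.
  have relU n b y y' : rel n b y -> rel n b y' -> y = y'.
    have U A : H A -> A (existT _ n (b, y)) -> A (existT _ n (b, y')) -> y = y'.
      by move=> /HG[S1 [s1 [_ ->]]] [/= _ ->] [/= _ ->].
    move=> [A HA Ay] [A' HA' Ay']; have [AA'|A'A] := Htot A A' HA HA'.
      by apply: U HA' (AA' _ Ay) Ay'.
    by apply: U HA Ay (A'A _ Ay').
  have sP n b y : rel n b y -> s n b = y.
    move=> bny; rewrite /s; case: xgetP => [z _ /= bnz|/(_ y)//]; exact: relU bnz bny.
  exists S, s; split; last first.
    apply/seteqP; split=> [[n [b y]] [A HA Ay]|[n [b y]] [/= [z bz] ->]].
      have bny : rel n b y by exists A.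
      by split=> /=; [exists y|rewrite (sP n b y)].
    by rewrite (sP n b z) //; case: bz => A HA Az; exists A.
  have SA n b : S n b -> exists S1 s1, [/\ good S1 s1, H (code S1 s1) & S1 n b].
    by move=> [y [A HA]]; have [S1 [s1 [g1 AE]]] := HG A HA; rewrite AE in HA * => -[/= S1b _]; exists S1, s1.
  have sE S1 s1 n b : H (code S1 s1) -> S1 n b -> S n b /\ s n b = s1 n b.
    move=> H1 S1b; have bn : rel n b (s1 n b) by exists (code S1 s1).
    by split; [exists (s1 n b)|apply: sP].
  split=> [n b b' /SA[S1 [s1 [[S1cl _] H1 S1b]]] b'b|n b /SA[S1 [s1 [[S1cl S1s] H1 S1b]]]].
    by have [] := sE S1 s1 n.+1 b' H1 (S1cl n b b' S1b b'b).
  rewrite (S1s n b S1b) (sE S1 s1 n b H1 S1b).2; congr (_ + _).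
  by apply: flift_agree => b' /(S1cl n b b' S1b) /(sE S1 s1 _ _ H1)[_ ->].
have Sall n b : S n b.
  apply: contrapT => nSb; have [S' [s' [gS' S'b SS' ss']]] := good_extend gS nSb.
  apply: (Amax (code S' s')); last by exists S', s'.
  rewrite AS; split=> [[m [b' y]] [/= Sb' ->]|/(_ (existT _ n (b, s' n b)))].
    by split=> /=; [exact: SS'|rewrite ss'].
  by case.
exists (fun n => flift (s n)) => n x; case: gS => _ gS.
have L : linear (fun x => d n (flift (s n) x) + flift (s n.+1) (delta x)).
  by move=> r y z; rewrite !linearP scalerDr addrACA.
rewrite -[RHS](mklinE L); apply: free_map_ext => b.
by rewrite mklinE flift_basis; apply: gS.
Qed.

End NullHomotopy.

(** * Periodic complexes *)

Section FiniteSequences.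
Variables (R : pzRingType) (b : bool).
Implicit Types M : nat -> lmodType R.

(* [dfin true M] is the direct sum and [dfin false M] the product of the [M j]. *)
Let fin M (x : dprod M) := b -> exists m, forall j, (m <= j)%N -> dcoord j x = 0.

Fact fin_submodule M : submodule (@fin M).
Proof.
split=> [_|r x y xf yf bT]; first by exists 0%N => j _; rewrite linear0.
have [m mx] := xf bT; have [n ny] := yf bT; exists (maxn m n) => j.
by rewrite geq_max => /andP[/mx xj /ny yj]; rewrite linearP xj yj scaler0 addr0.
Qed.
Definition dfin M : lmodType R := sub (@fin_submodule M).

Section Dfin.
Variable M : nat -> lmodType R.

Definition fcoord j : {linear dfin M -> M j} := dcoord j \o incl (@fin_submodule M).

Lemma fcoord_ext (x y : dfin M) : (forall j, fcoord j x = fcoord j y) -> x = y.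
Proof. by move=> e; apply/incl_inj/dcoord_ext. Qed.

Lemma fcoord_fin (x : dfin M) : b -> exists m, forall j, (m <= j)%N -> fcoord j x = 0.
Proof. exact: inclP x. Qed.

Lemma dfin_mk (x : forall j, M j) :
  (b -> exists m, forall j, (m <= j)%N -> x j = 0) -> exists u, forall j, fcoord j u = x j.
Proof.
move=> xf; have [|u ux] := incl_onto (@fin_submodule M) (_ : fin (dmk x)).
  by move=> /xf[m mx]; exists m => j /mx; rewrite dcoordE.
by exists u => j; rewrite /fcoord /= ux dcoordE.
Qed.

Lemma dfin_map (X : lmodType R) (f : forall j, {linear X -> M j}) :
  (forall x, b -> exists m, forall j, (m <= j)%N -> f j x = 0) ->
  exists F : {linear X -> dfin M}, forall x j, fcoord j (F x) = f j x.
Proof.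
move=> ff; have [x|F FP] := @factor_inj _ _ _ _ (incl (@fin_submodule M)) (dtuple f) incl_inj.
  apply: (incl_onto (@fin_submodule M)) => /(ff x)[m mx].
  by exists m => j /mx; rewrite dtupleE.
by exists F => x j; rewrite /fcoord /= FP dtupleE.
Qed.
End Dfin.

End FiniteSequences.
#[global] Opaque dfin fcoord.

Lemma dfin_projective (R : pzRingType) (M : nat -> lmodType R) :
  (forall j, projective_module (M j)) -> projective_module (dfin true M).
Proof.
move=> MP A B p f ps.
have inj_ex j : exists i : {linear M j -> dfin true M},
    (forall x, fcoord true M j (i x) = x) /\ forall x k, k != j -> fcoord true M k (i x) = 0.
  have gex k : exists g : {linear M j -> M k},
      (k != j -> forall x, g x = 0) /\ forall (e : j = k) x, g x = ecast k (M k) e x.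
    have [->|kj] := eqVneq k j; last by exists \0; split=> // e; rewrite e eqxx in kj.
    by exists idfun; split=> // e x; rewrite eq_axiomK.
  have g k := cid (gex k).
  have [x _|F FP] := @dfin_map R true M (M j) (fun k => sval (g k)).
    by exists j.+1 => k jk; case: (g k) => h /= [-> //]; rewrite gtn_eqF.
  exists F; split=> [x|x k kj]; rewrite FP; first by case: (g j) => h /= [_ /(_ (erefl j) x)].
  by case: (g k) => h /= [->].
pose i j := sval (cid (inj_ex j)).
have i_same j x : fcoord true M j (i j x) = x by rewrite /i; case: cid => h /= [].
have i_diff j k x : k != j -> fcoord true M k (i j x) = 0.
  by move=> kj; rewrite /i; case: cid => h /= [_]; apply.
pose g j := sval (cid (MP j _ _ p (f \o i j) ps)).
have gP j x : p (g j x) = f (i j x) by rewrite /g; case: cid => h /= hP; apply: hP.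
pose G (x : dfin true M) (y : A) := exists m, (forall j, (m <= j)%N -> fcoord true M j x = 0) /\
  y = \sum_(j < m) g j (fcoord true M j x).
have Gle m n x : (m <= n)%N -> (forall j, (m <= j)%N -> fcoord true M j x = 0) ->
    \sum_(j < m) g j (fcoord true M j x) = \sum_(j < n) g j (fcoord true M j x).
  move=> /subnKC <- mx; elim: (n - m)%N => [|k IH]; first by rewrite addn0.
  by rewrite addnS big_ord_recr /= -IH mx ?leq_addr // linear0 addr0.
have [x|x y y' [m [mx ->]] [n [nx ->]]|a x x' y y' [m [mx ->]] [n [nx ->]]|h hP] :=
  @lin_choice R (dfin true M) A G.
- by have [m mx] := fcoord_fin x isT; exists (\sum_(j < m) g j (fcoord true M j x)), m.
- by case: (leqP m n) => [|/ltnW] mn; rewrite (Gle _ _ x mn).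
- exists (maxn m n); split=> [j|].
    by rewrite geq_max => /andP[/mx xj /nx xj']; rewrite linearP xj xj' scaler0 addr0.
  rewrite (Gle m (maxn m n)) ?leq_maxl // (Gle n (maxn m n)) ?leq_maxr //.
  rewrite scaler_sumr -big_split; apply: eq_bigr => j _ /=.
  by rewrite !linearP.
exists h => x /=; have [m [mx ->]] := hP x.
rewrite linear_sum; under eq_bigr do rewrite gP.
rewrite -linear_sum; congr (f _); apply: fcoord_ext => k; rewrite linear_sum.
have [km|mk] := ltnP k m; last first.
  by rewrite mx // big1 // => j _; apply: i_diff; rewrite gtn_eqF // (leq_trans _ mk).
rewrite (bigD1 (Ordinal km)) //= i_same big1 ?addr0 // => j jk; apply: i_diff.
by rewrite eq_sym; apply: contra jk => /eqP jk; apply/eqP/val_inj.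
Qed.

(** With [b] false the finiteness condition is void, so this module is a retract of the full
    product. *)
Lemma dfin_idle (R : pzRingType) (M : nat -> lmodType R) n :
  (forall j, idle n (M j)) -> idle n (dfin false M).
Proof.
move=> Mn A; have AM : ext n A (dprod M) by apply: ext_dprod => j; apply: Mn.
have [x _ //|F FP] := @dfin_map R false M (dprod M) (fun j => dcoord j).
apply: (ext_retract_r (i := dtuple (fcoord false M)) (r := F)) AM => x.
by apply: fcoord_ext => j; rewrite FP dtupleE.
Qed.

Section Periodic.
Variables (R : pzRingType) (N : lmodType R).

(* Splicing a free resolution of [N] with an injective coresolution, and adding up all the terms. *)
Lemma periodic_ses (b : bool) : exists (G E : lmodType R)
    (i : {linear G -> dsum2 (dfin b (fun j => free_cover (syzn j N))) E})
    (p : {linear dsum2 (dfin b (fun j => free_cover (syzn j N))) E -> G}),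
  [/\ ses i p, injective_module E &
      exists (u : {linear N -> G}) (r : {linear G -> N}), cancel u r].
Proof.
pose K j := syzn j N; pose C j := cosyzn j N.
pose F j := free_cover (K j); pose E := dprod (fun j => inj_hull (C j)).
(* The cosyzygies start at 1, since [C 0] is [N], already present as [K 0]. *)
pose C1 := dprod (fun j => C j.+1).
pose G := dsum2 (dfin b K) C1; pose T := dsum2 (dfin b F) E.
have finS (M : nat -> lmodType R) (M' : nat -> lmodType R)
    (h : forall j, {linear M j.+1 -> M' j}) (x : dfin b M) :
    b -> exists m, forall j, (m <= j)%N -> h j (fcoord b M j.+1 x) = 0.
  move=> /(fcoord_fin x)[m mx]; exists m => j mj.
  by rewrite mx ?linear0 // (leq_trans mj).
have [x|i1 i1P] := @dfin_map R b F (dfin b K) (fun j => syz_incl (K j) \o fcoord b K j.+1).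
  exact: (finS _ _ (fun j => syz_incl (K j)) x).
(* [K 0] goes to the first injective: here resolution and coresolution are spliced. *)
pose i2 : {linear G -> E} := dtuple (fun j => match j return {linear G -> inj_hull (C j)} with
  | 0%N => hull_emb N \o (fcoord b K 0 \o lfst _ _)
  | j'.+1 => hull_emb (C j'.+1) \o (dcoord j' \o lsnd _ _) end).
pose i : {linear G -> T} := lpair (i1 \o lfst _ _) i2.
have [x bT|p1 p1P] := @dfin_map R b K (dfin b F) (fun j => cover (K j) \o fcoord b F j).
  have [m mx] := fcoord_fin x bT.
  by exists m => j /mx; rewrite /= => ->; rewrite linear0.
pose p2 : {linear E -> C1} := dtuple (fun j => cosyz_proj (C j) \o dcoord j).
pose p : {linear T -> G} := lpair (p1 \o lfst _ _) (p2 \o lsnd _ _).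
exists G, E, i, p; split.
- have iE x : [/\ forall j, fcoord b F j (lfst _ _ (i x)) = syz_incl (K j) (fcoord b K j.+1 (lfst _ _ x)),
      dcoord 0%N (lsnd _ _ (i x)) = hull_emb N (fcoord b K 0 (lfst _ _ x)) &
      forall j, dcoord j.+1 (lsnd _ _ (i x)) = hull_emb (C j.+1) (dcoord j (lsnd _ _ x))].
    by rewrite /i lpairE lfstE lsndE; split=> [j||j]; rewrite ?i1P // /i2 dtupleE.
  have pE x : (forall j, fcoord b K j (lfst _ _ (p x)) = cover (K j) (fcoord b F j (lfst _ _ x))) /\
      (forall j, dcoord j (lsnd _ _ (p x)) = cosyz_proj (C j) (dcoord j (lsnd _ _ x))).
    by rewrite /p lpairE lfstE lsndE; split=> j; rewrite ?p1P // /p2 /= dtupleE.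
  split.
  + apply: lin_inj => x ix0; have [xF x0 xC] := iE x.
    apply: dsum2_ext; rewrite linear0.
      apply: fcoord_ext => -[|j]; rewrite linear0.
        by apply: (@hull_emb_inj _ N); rewrite -x0 ix0 !linear0.
      by apply: (@incl_inj _ _ _ (ker_submodule (cover (K j)))); rewrite -xF ix0 !linear0.
    apply: dcoord_ext => j; rewrite linear0; apply: (@hull_emb_inj _ (C j.+1)).
    by rewrite -xC ix0 !linear0.
  + move=> y; split=> [py0|[x <-]]; last first.
      have [xF x0 xC] := iE x; have [pK pC] := pE (i x).
      apply: dsum2_ext; rewrite linear0.
        by apply: fcoord_ext => j; rewrite pK xF linear0 (ses_comp _ (syz_ses (K j))).
      apply: dcoord_ext => -[|j]; rewrite pC linear0 ?x0 ?xC.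
        exact: (ses_comp _ (cosyz_ses N)).
      exact: (ses_comp _ (cosyz_ses (C j.+1))).
    have [pK pC] := pE y.
    have kex j : exists k, syz_incl (K j) k = fcoord b F j (lfst _ _ y).
      by have [_ ex _] := syz_ses (K j); apply/ex; rewrite -pK py0 !linear0.
    have cex j : exists c, hull_emb (C j) c = dcoord j (lsnd _ _ y).
      by have [_ ex _] := cosyz_ses (C j); apply/ex; rewrite -pC py0 !linear0.
    pose k j := sval (cid (kex j)); pose c j := sval (cid (cex j)).
    have kE j : syz_incl (K j) (k j) = fcoord b F j (lfst _ _ y) by rewrite /k; case: cid.
    have cE j : hull_emb (C j) (c j) = dcoord j (lsnd _ _ y) by rewrite /c; case: cid.
    pose k' j : K j := match j with 0%N => c 0%N | j'.+1 => k j' end.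
    have [bT|u uP] := @dfin_mk R b K k'.
      have [m my] := fcoord_fin (lfst _ _ y) bT; exists m.+1 => -[//|j] mj.
      apply: (@incl_inj _ _ _ (ker_submodule (cover (K j)))).
      by rewrite linear0 -[LHS]/(syz_incl (K j) (k j)) kE my.
    exists (lmkpair u (dmk (fun j => c j.+1))).
    have [xF x0 xC] := iE (lmkpair u (dmk (fun j => c j.+1))).
    apply: dsum2_ext.
      by apply: fcoord_ext => j; rewrite xF lfstE uP kE.
    by apply: dcoord_ext => -[|j]; [rewrite x0 lfstE uP|rewrite xC lsndE dcoordE]; exact: cE.
  + move=> x.
    (* Zero coordinates are lifted to zero, to keep finite support. *)
    have fex j : exists f, cover (K j) f = fcoord b K j (lfst _ _ x) /\
        (fcoord b K j (lfst _ _ x) = 0 -> f = 0).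
      have [x0|xn0] := pselect (fcoord b K j (lfst _ _ x) = 0).
        by exists 0; rewrite linear0 x0.
      by have [f fP] := cover_surj (fcoord b K j (lfst _ _ x)); exists f; rewrite fP.
    have eex j : exists e, cosyz_proj (C j) e = dcoord j (lsnd _ _ x).
      by have [_ _ ps] := cosyz_ses (C j); apply: ps.
    have [bT|f fP] := @dfin_mk R b F (fun j => sval (cid (fex j))).
      have [m mx] := fcoord_fin (lfst _ _ x) bT; exists m => j /mx xj.
      by case: cid => f [_ f0] /=; apply: f0.
    exists (lmkpair f (dmk (fun j => sval (cid (eex j))))).
    have [pK pC] := pE (lmkpair f (dmk (fun j => sval (cid (eex j))))).
    apply: dsum2_ext.
      by apply: fcoord_ext => j; rewrite pK lfstE fP; case: cid => ? [].
    by apply: dcoord_ext => j; rewrite pC lsndE dcoordE; case: cid.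
- by apply: dprod_injective => j; apply: hull_injective.
- have uex x : exists u, forall j, fcoord b K j u = match j return K j with 0%N => x | _ => 0 end.
    by apply: dfin_mk => _; exists 1%N => -[].
  have [||a x x' y y' xy xy'|u uP] := @lin_choice R N (dfin b K)
    (fun x u => forall j, fcoord b K j u = match j return K j with 0%N => x | _ => 0 end).
  + exact: uex.
  + by move=> x y y' xy xy'; apply: fcoord_ext => j; rewrite xy xy'.
  + by move=> j; rewrite linearP xy xy'; case: j => //= j; rewrite scaler0 addr0.
  exists (linl _ _ \o u), (fcoord b K 0 \o lfst _ _) => x /=.
  by rewrite linlE lfstE uP.
Qed.

End Periodic.

Section Horseshoe.
Variables (R : pzRingType) (G T : lmodType R).
Variables (i : {linear G -> T}) (p : {linear T -> G}).
Hypothesis ip : ses i p.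

(** Horseshoe lemma with the same free cover at both ends: a syzygy [T1] of [T] is again an
    extension of a module, [syz G], by itself. *)
Lemma horseshoe_syz : exists (T1 F : lmodType R) (i1 : {linear syz G -> T1})
    (p1 : {linear T1 -> syz G}) (j : {linear T1 -> F}) (q : {linear F -> T}),
  [/\ ses i1 p1, ses j q & projective_module F].
Proof.
have [ii ex ps] := ip; have [si sex ssj] := syz_ses G.
have [l lP] := cover_projective G _ _ p (cover G) ps.
pose F := dsum2 (free_cover G) (free_cover G).
pose q : {linear F -> T} := lcopair (i \o cover G) l.
have qE x y : q (lmkpair x y) = i (cover G x) + l y by rewrite lcopairE lfstE lsndE.
have qs : surjective q.
  move=> t; have [y yP] := cover_surj (p t).
  have [g gP] : exists g, i g = t - l y by apply/ex; rewrite linearB -yP -[cover G y]lP subrr.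
  have [x xP] := cover_surj g.
  by exists (lmkpair x y); rewrite qE xP gP subrK.
have jq := ker_ses qs; have [ji jex _] := jq.
exists (sub (ker_submodule q)), F.
have [s|i1 i1P] := ses_restrict (f := linl (free_cover G) (free_cover G) \o syz_incl G) jq.
  by rewrite /= linlE qE (ses_comp _ (syz_ses G)) !linear0 addr0.
have [y|p1 p1P] := ses_restrict (f := lsnd (free_cover G) (free_cover G) \o incl (ker_submodule q)) (syz_ses G).
  have := inclP y; rewrite lcopairE => /(congr1 p).
  by rewrite linearD (ses_comp _ ip) add0r linear0 => <-; apply/esym/lP.
exists i1, p1, (incl (ker_submodule q)), q; split=> //; last first.
  apply/pdle0P; apply: pdle_pair; apply/pdle0P; exact: cover_projective.
split.
- move=> x y xy; apply: si; have := congr1 (incl (ker_submodule q)) xy.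
  by rewrite !i1P /= !linlE => /(congr1 (lfst _ _)); rewrite !lfstE.
- move=> y; split=> [p1y|[s <-]]; last first.
    by apply: si; rewrite p1P /= i1P /= linlE lsndE linear0.
  have y2 : lsnd _ _ (incl (ker_submodule q) y) = 0 by rewrite -[LHS]p1P p1y linear0.
  have := inclP y; rewrite lcopairE y2 linear0 addr0 /= => y1.
  have /sex[s sP] : cover G (lfst _ _ (incl (ker_submodule q) y)) = 0.
    by apply: ii; rewrite y1 linear0.
  by exists s; apply: ji; rewrite i1P /= sP linlE [RHS]dsum2_eta y2.
- move=> s; have [g gP] : exists g, i g = l (syz_incl G s).
    by apply/ex; rewrite [LHS]lP (ses_comp _ (syz_ses G)).
  have [x xP] := cover_surj g.
  have [|y yP] := incl_onto (ker_submodule q) (_ : q (lmkpair (- x) (syz_incl G s)) = 0).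
    by rewrite qE !linearN xP gP addNr.
  by exists y; apply: si; rewrite p1P /= yP lsndE.
Qed.

Lemma horseshoe_cosyz : exists (T1 E : lmodType R) (i1 : {linear cosyz G -> T1})
    (p1 : {linear T1 -> cosyz G}) (j : {linear T -> E}) (q : {linear E -> T1}),
  [/\ ses i1 p1, ses j q & injective_module E].
Proof.
have [ii ex ps] := ip; have [ei eex es] := cosyz_ses G.
have [r rP] := hull_injective G _ _ i (hull_emb G) ii.
have {}rP x : r (i x) = hull_emb G x by exact: rP.
pose E := dsum2 (inj_hull G) (inj_hull G).
pose j : {linear T -> E} := lpair r (hull_emb G \o p).
have jE t : j t = lmkpair (r t) (hull_emb G (p t)) by rewrite /j lpairE.
have ji : injective j.
  apply: lin_inj => t jt; have pt : p t = 0.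
    by apply: ei; rewrite linear0 -(lsndE (r t) (hull_emb G (p t))) -jE jt linear0.
  have [g gt] := (ex t).1 pt; rewrite -gt in jt *.
  suff -> : g = 0 by rewrite linear0.
  by apply: ei; rewrite linear0 -rP -(lfstE (r (i g)) (hull_emb G (p (i g)))) -jE jt linear0.
have jq := coker_ses ji; have [_ jex qs] := jq; pose q := proj (im_submodule j).
have [x|i1 i1P] := ses_factor (f := q \o linl (inj_hull G) (inj_hull G)) (cosyz_ses G).
  rewrite /= linlE; apply/jex; exists (i x).
  by rewrite jE rP (ses_comp _ ip) linear0.
have [t|p1 p1P] := ses_factor (f := cosyz_proj G \o lsnd (inj_hull G) (inj_hull G)) jq.
  by rewrite /= jE lsndE (ses_comp _ (cosyz_ses G)).
exists (quot (im_submodule j)), E, i1, p1, j, q; split=> //; last first.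
  by apply: dsum2_injective; apply: hull_injective.
split.
- apply: lin_inj => y; have [x <-] := es y.
  rewrite i1P /= linlE => /jex[t]; rewrite jE => e.
  have := congr1 (lsnd _ _) e; rewrite !lsndE -(linear0 (hull_emb G)) => /ei pt.
  have [g gt] := (ex t).1 pt; apply/eex; exists g.
  by have := congr1 (lfst _ _) e; rewrite !lfstE -gt rP.
- move=> y; have [x <-] := qs y; rewrite -/q; split=> [|[z]].
    rewrite p1P /= => /eex[g gx]; have [t tg] := ps g.
    exists (cosyz_proj G (lfst _ _ x - r t)); rewrite i1P /= linlE.
    apply/eqP; rewrite -subr_eq0 -linearB; apply/eqP/jex; exists (- t).
    rewrite linearN jE tg gx; apply: dsum2_ext.
      by rewrite linearN linearB !lfstE addrC addKr.
    by rewrite linearN linearB !lsndE sub0r.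
  have [w <-] := es z; rewrite i1P /= => e.
  by rewrite -e p1P /= linlE lsndE linear0.
- move=> z; have [w <-] := es z; exists (q (lmkpair 0 w)).
  by rewrite p1P /= lsndE.
Qed.

End Horseshoe.

(** [D k T] stands for a dimension bound k on [T]: it is used for projective dimension and, through
    duals, for flat dimension. *)
Lemma periodic_syzn (R : pzRingType) (D : nat -> lmodType R -> Prop)
    (Dsyz : forall k (K F T : lmodType R) (i : {linear K -> F}) (p : {linear F -> T}),
      ses i p -> projective_module F -> D k.+1 T -> D k K)
    n (G T : lmodType R) (i : {linear G -> T}) (p : {linear T -> G}) :
  ses i p -> D n T ->
  exists (T' : lmodType R) (i' : {linear syzn n G -> T'}) (p' : {linear T' -> syzn n G}),
    ses i' p' /\ D 0 T'.
Proof.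
elim: n G T i p => [|n IH] G T i p ip DT; first by exists T, i, p.
have [T1 [F [i1 [p1 [j [q [ip1 jq Fproj]]]]]]] := horseshoe_syz ip.
have := IH _ _ _ _ ip1 (Dsyz _ _ _ _ _ _ jq Fproj DT).
by rewrite /syzn iterSr.
Qed.

Lemma periodic_cosyzn (R : pzRingType) n (G T : lmodType R) (i : {linear G -> T})
    (p : {linear T -> G}) :
  ses i p -> idle n T ->
  exists (T' : lmodType R) (i' : {linear cosyzn n G -> T'}) (p' : {linear T' -> cosyzn n G}),
    ses i' p' /\ injective_module T'.
Proof.
elim: n G T i p => [|n IH] G T i p ip DT; first by exists T, i, p; split=> //; apply/idle0P.
have [T1 [F [i1 [p1 [j [q [ip1 jq Finj]]]]]]] := horseshoe_cosyz ip.
have := IH _ _ _ _ ip1 ((idle_cosyz n jq Finj).1 DT).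
by rewrite /cosyzn iterSr.
Qed.

(** * Passage to the opposite ring *)

Section Constant.
Variables (R : pzRingType) (T : lmodType R) (d : {linear T -> T}).
Hypothesis dex : exact d d.

Fact constant_differentialK (i : int) (x : T) : d (d x) = 0.
Proof. by apply/dex; exists x. Qed.
(** An exact square-zero endomorphism repeated in every degree; (2) and (3) are exploited through
    such complexes. *)
Definition constant_complex : complex R := @Complex R (fun=> T) (fun=> d) constant_differentialK.

Lemma constant_Hom_exact (I : lmodType R) (f : {linear I -> T}) :
  acyclic_injectives_totally_acyclic R -> injective_module T -> injective_module I ->
  (forall x, d (f x) = 0) -> exists g : {linear I -> T}, forall x, f x = d (g x).
Proof.
move=> tac Tinj Iinj df; have [|_ /(_ I Iinj 0%Z f)[+ _]] := tac constant_complex; first by split.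
case=> [|g /(congr1 (fun h => Hom_fun h : I -> T)) gE]; first by apply: linear_ext => x; exact: df.
by exists g => x; rewrite -[f x]/(Hom_fun f x) -gE.
Qed.

(** Maps T -> E^+ are characters of the tensor product of E and T. Exactness of the tensored complex
    lets such a character factor through the differential. *)
Lemma constant_tensor_exact (E : lmodType R^c) (h : {linear T -> character E}) :
  acyclic_flats_F_totally_acyclic R -> flat_module T -> injective_module E ->
  (forall x, h (d x) = 0) -> exists g : {linear T -> character E}, forall x, h x = g (d x).
Proof.
move=> Ftac Tflat Einj hd.
have [|_ /(_ E Einj 0%Z)] := Ftac constant_complex; first by split.
rewrite /constant_complex /= => tex.
have [h' h'P] := flip_char_dual h; have [phi phiP] := hom_dual_tensor h'.
have [|psi psiP] := @qz_factor _ _ (tensor_map (idfun : {linear E -> E}) d) phi.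
  move=> t /tex[u <-].
  apply: (@tensor_ext _ _ _ _ (phi \o tensor_map (idfun : {linear E -> E}) d) \0) => e m /=.
  have -> : tensor_map (idfun : {linear E -> E}) d (tens e m) = tens e (d m) by exact: tensor_mapE.
  by rewrite phiP h'P hd char0.
have [g' g'P] := tensor_hom_dual psi; have [g gP] := flip_dual_char g'.
exists g => x; apply: char_ext => e; rewrite gP g'P -h'P -phiP -psiP; congr (psi _).
exact: tensor_mapE.
Qed.

End Constant.

Section OppositeSide.
Variable R : pzRingType.

(* The character modules of the terms of a complex of flat modules, added up, form an acyclic complex with constant injective term. *)
Lemma totally_acyclic_F_totally_acyclic :
  acyclic_injectives_totally_acyclic R^c -> acyclic_flats_F_totally_acyclic R.
Proof.
move=> tac X [Xac Xflat]; split=> // E Einj i.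
pose dX := differential X; pose id_E : {linear E -> E} := idfun.
pose T := dprod (fun j => dual (X j)).
have Tinj : injective_module T.
  by apply: dprod_injective => j; apply: flat_dual_injective.
pose d : {linear T -> T} := dtuple (fun j => dual_map (dX j) \o dcoord (j + 1)).
have dE u j : dcoord j (d u) = dual_map (dX j) (dcoord (j + 1) u) by rewrite /d dtupleE.
have dex : exact d d.
  move=> u; split=> [du0|[v <-]]; last first.
    apply: dcoord_ext => j; rewrite linear0 !dE; apply: dual_ext => x.
    by rewrite !dual_mapE differentialK raddf0.
  (* Each coordinate of [u] factors through the differential of [X]. The cast is there because
     [j + 1] and [k] agree only propositionally. *)
  have vex k : exists chi : {additive X k -> QmodZ}, forall j (e : j + 1 = k) x,
      dual_fun (dcoord j u) x = chi (ecast k (X k) e (dX j x)).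
    rewrite -(subrK 1 k); move: (k - 1) => {}k.
    have [y|chi chiP] := @qz_factor _ _ (dX k) (dual_fun (dcoord k u)).
      rewrite -(subrK 1 k) in y *; move: (k - 1) y => {}k y /Xac[z <-].
      by rewrite -dual_mapE -dE du0 linear0 dual0.
    exists chi => j e x; have jk : j = k by apply: addIr e.
    by subst j; rewrite eq_axiomK chiP.
  pose v : T := dmk (fun k => dual_mk (sval (cid (vex k)))).
  exists v; apply: dcoord_ext => j; rewrite dE; apply: dual_ext => x.
  rewrite dual_mapE dcoordE dual_mkE; case: cid => chi /= chiP.
  by rewrite (chiP j (erefl _)).
move=> t; split=> [t0|[u <-]]; last first.
  apply: (@tensor_ext _ _ _ _ (tensor_map id_E (dX (i + 1)) \o tensor_map id_E (dX i)) \0).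
  move=> e m; rewrite /= [X in tensor_map _ _ X]tensor_mapE [LHS]tensor_mapE /= differentialK.
  have [_ tDr _] := tens_balanced E (X (i + 1 + 1)).
  by apply: (@addrI _ (tens e 0)); rewrite -tDr !addr0.
apply: contrapT => nt.
have [c [cd /eqP[]]] := qz_separate (additive_range_subgroup (tensor_map id_E (dX i))) nt.
have [h hP] := tensor_hom_dual c.
(* The character [c], read as a map from [E] to [T] concentrated at index i + 1. It is a cycle,
   hence a boundary, so [c] factors through [dX (i + 1)] and kills [t]. *)
have [f [fE f0]] : exists f : {linear E -> T},
    (forall e, dcoord (i + 1) (f e) = h e) /\ forall j, j != i + 1 -> forall e, dcoord j (f e) = 0.
  have gex k : exists g : {linear E -> dual (X k)},
      (k != i + 1 -> forall x, g x = 0) /\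
      forall e : i + 1 = k, forall x, g x = ecast k (dual (X k)) e (h x).
    have [->|kj] := eqVneq k (i + 1); last by exists \0; split=> // e; rewrite e eqxx in kj.
    by exists h; split=> // e x; rewrite eq_axiomK.
  have g k := cid (gex k); exists (dtuple (fun k => sval (g k))).
  split=> [e|j ji e]; rewrite dtupleE; first by case: (g (i + 1)) => g' /= [_ /(_ (erefl _))].
  by case: (g j) => g' /= [->].
have [e|g gP] := constant_Hom_exact dex (f := f) tac Tinj Einj.
  apply: dcoord_ext => j; rewrite linear0 dE; have [ji|/f0 ->] := eqVneq (j + 1) (i + 1); last exact: linear0.
  have {ji} -> : j = i by apply: addIr ji.
  apply: dual_ext => x; rewrite fE dual_mapE hP dual0; apply: cd.
  by exists (tens e x); exact: tensor_mapE.
have [psi psiP] := hom_dual_tensor (dcoord (i + 1 + 1) \o g).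
rewrite -[RHS](raddf0 psi) -t0.
apply: (@tensor_ext _ _ _ _ c (psi \o tensor_map id_E (dX (i + 1)))) => e m /=.
have -> : tensor_map id_E (dX (i + 1)) (tens e m) = tens e (dX (i + 1) m) by exact: tensor_mapE.
by rewrite psiP /= -dual_mapE -dE -gP fE hP.
Qed.

End OppositeSide.

(** * Purity of a module in its bidual *)

Section Bidual.
Variable R : pzRingType.
Implicit Types M : lmodType R.

Definition bidual M : lmodType R := character (dual M).

Section Evaluation.
Variable M : lmodType R.
Fact ev_additive (m : M) : zmod_morphism (fun phi : dual M => dual_fun phi m).
Proof. by move=> phi psi; rewrite dualD dualN. Qed.
Fact ev_linear : linear (fun m => char_mk (mkadd (ev_additive m)) : bidual M).
Proof.
move=> r x y; apply: char_ext => phi.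
by rewrite charP !char_mkE !mkaddE raddfD.
Qed.
Definition ev : {linear M -> bidual M} := mklin ev_linear.
Lemma evE m phi : character_fun (ev m) phi = dual_fun phi m.
Proof. by rewrite mklinE char_mkE mkaddE. Qed.

Lemma ev_inj : injective ev.
Proof.
apply: lin_inj => m m0; apply: contrapT => mn0.
have [||phi [_ /eqP[]]] := @qz_separate M (fun x => x = 0) m.
- by split=> // x y -> ->; rewrite subr0.
- exact: mn0.
by rewrite -(evE m (dual_mk phi)) m0 char0.
Qed.

(** If the system has no solution in [M], a character [c] separates its right-hand side from the
    solvable ones. Its components satisfy sum_b cb_b a_(b,b') = 0 for each b', and applying the
    [psi b'] shows that [c] vanishes on that right-hand side. *)
Lemma ev_pure (B : choiceType) : pure_in B (fun y => exists m, ev m = y).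
Proof.
move=> s0 t a psi us ut spsi.
have zex b : exists z, b \in s0 -> ev z = \sum_(b' <- t) a b b' *: psi b'.
  by have [bs|] := boolP (b \in s0); [have [z zP] := spsi b bs; exists z|exists 0].
have /choice[z zP] := zex.
pose V := dprod (fun _ : B => M).
pose zs : V := dmk (fun b => if b \in s0 then z b else 0).
pose H (v : V) := exists x : B -> M, v = dmk (fun b => if b \in s0 then \sum_(b' <- t) a b b' *: x b' else 0).
have HP : subgroup H.
  split=> [|_ _ [x ->] [y ->]].
    exists (fun=> 0); apply: dcoord_ext => b; rewrite linear0 dcoordE; case: ifP => // _.
    by rewrite big1 // => b' _; rewrite scaler0.
  exists (fun b => x b - y b); apply: dcoord_ext => b; rewrite linearB !dcoordE.
  case: ifP => _; last by rewrite subr0.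
  by rewrite -sumrB; apply: eq_bigr => b' _; rewrite scalerBr.
have [[x xP]|nH] := pselect (H zs).
  exists (fun b => ev (x b)); split=> [b|b bs]; first by exists (x b).
  rewrite -(zP b bs); under eq_bigr do rewrite -linearZ_LR.
  rewrite -linear_sum; congr (ev _).
  by have := congr1 (dcoord b) xP; rewrite !dcoordE bs.
have [c [cH /eqP[]]] := qz_separate HP nH.
have [chi chiP] := character_finite_product c us.
pose cb b : dual M := dual_mk (chi b).
have cbE b y : dual_fun (cb b) y = chi b y by [].
have ca b' : b' \in t -> \sum_(b <- s0) (a b b' : R^c) *: cb b = 0.
  move=> b't; apply: dual_ext => m; rewrite dual_sum dual0.
  under eq_bigr do rewrite dualZ cbE.
  rewrite -(chiP (fun b => a b b' *: m)); apply: cH; exists (fun b => if b == b' then m else 0).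
  apply: dcoord_ext => b; rewrite !dcoordE; case: ifP => // _.
  rewrite (bigD1_seq b') //= eqxx big1 ?addr0 // => b'' /negbTE ->.
  by rewrite scaler0.
rewrite chiP.
rewrite (eq_big_seq (fun b => \sum_(b' <- t) character_fun (psi b') ((a b b' : R^c) *: cb b))).
  rewrite exchange_big big1_seq //= => b' b't.
  by rewrite -raddf_sum ca // raddf0.
move=> b bs; rewrite -cbE -evE zP // char_sum.
by apply: eq_bigr => b' _; rewrite charZ.
Qed.

End Evaluation.
End Bidual.

(** * The two inequalities *)

Lemma periodic_exact (R : pzRingType) (G T : lmodType R) (i : {linear G -> T})
    (p : {linear T -> G}) : ses i p -> exact (i \o p) (i \o p).
Proof.
move=> ip; have [ii ex ps] := ip => x; split=> [/= ipx|[y <-]]; last first.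
  by rewrite /= (ses_comp _ ip) linear0.
have [|g <-] := (ex x).1; first by apply: ii; rewrite ipx linear0.
by have [y <-] := ps g; exists y.
Qed.

Section FiniteSilp.
Variables (R : pzRingType) (n : nat).
Hypothesis silp_n : forall P : lmodType R, projective_module P -> idle n P.

Lemma pdle_idle m (A : lmodType R) : pdle m A -> idle n A.
Proof.
elim: m A => [|m IH] A; first by move=> /pdle0P/silp_n.
move=> Am; apply: (idle_right (syz_ses A)); last exact/silp_n/cover_projective.
exact: IH ((pdle_syz m (syz_ses A) (cover_projective A)).1 Am).
Qed.

(** A map from [A] to the n-th cosyzygy of [G] becomes a cycle under [i']; being a boundary, it
    lifts over [p']. *)
Lemma pdle_of_Hom_exact (A : lmodType R) :
  (forall (T : lmodType R) (d : {linear T -> T}) (f : {linear A -> T}), injective_module T ->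
     exact d d -> (forall x, d (f x) = 0) -> exists g : {linear A -> T}, forall x, f x = d (g x)) ->
  pdle n A.
Proof.
move=> AX N; have [G [E [i [p [ip Einj [u [r ur]]]]]]] := periodic_ses N false.
apply: (ext_retract_r ur).
have Tn : idle n (dsum2 (dfin false (fun j => free_cover (syzn j N))) E).
  apply: idle_pair; first by apply: dfin_idle => j; apply/silp_n/cover_projective.
  exact: idle_le (leq0n n) ((idle0P E).2 Einj).
have [T [i' [p' [ip' Tinj]]]] := periodic_cosyzn ip Tn.
apply: (extE _ _ _).2; apply: (ext1_of_lift ip' Tinj) => f.
have [x|g gP] := AX T (i' \o p') (i' \o f) Tinj (periodic_exact ip').
  by rewrite /= (ses_comp _ ip') linear0.
by exists g => x; have [ii _ _] := ip'; apply: ii; exact/esym/gP.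
Qed.

Lemma flat_idle (F : lmodType R) : flat_module F -> idle n F.
Proof.
move=> Fflat; apply: (@pdle_idle n); apply: pdle_of_Hom_exact => T d f Tinj dex df.
by have := @flat_Hom_exact _ (constant_complex dex) (fun=> dex) (fun=> Tinj) F Fflat 0%Z f df.
Qed.

Lemma flat_resolution_idle m (M : lmodType R) :
  left_resolution_le (@flat_module R) M m -> idle n M.
Proof.
elim: m M => [|m IH] M.
  move=> /left_resolution0[P [p [/flat_idle Pn pi ps]]] A.
  have [q qP] := factor_inj (f := idfun) pi ps.
  by apply: (ext_retract_r (i := q) (r := p)) (Pn A).
move=> /left_resolutionS[K [P [i [p [ip /flat_idle Pn /IH Kn]]]]].
exact: idle_right ip Kn Pn.
Qed.

Lemma totally_acyclic_spli :
  acyclic_injectives_totally_acyclic R -> ele (spli R) (Fin n).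
Proof.
move=> tac; apply/spliP => I Iinj; apply: pdle_of_Hom_exact => T d f Tinj dex.
exact: constant_Hom_exact.
Qed.

End FiniteSilp.

Lemma flat_dim_finite (R : pzRingType) (M : lmodType R) :
  flat_dim M <> Infinity -> exists m, left_resolution_le (@flat_module R) M m.
Proof. by rewrite /flat_dim /einf; case: pselect. Qed.

Lemma flat_resolution_dual_idle (R : pzRingType) m (M : lmodType R) :
  left_resolution_le (@flat_module R) M m -> idle m (dual M).
Proof.
elim: m M => [|m IH] M.
  move=> /left_resolution0[P [p [Pflat pi ps]]].
  have [q qP] := factor_inj (f := idfun) pi ps.
  apply/idle0P/(retract_injective (i := dual_map p) (r := dual_map q)).
    by move=> phi; apply: dual_ext => x; rewrite !dual_mapE qP.
  exact: flat_dual_injective.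
move=> /left_resolutionS[K [P [i [p [ip Pflat /IH Kn]]]]].
exact: (idle_cosyz m (dual_ses ip) (flat_dual_injective Pflat)).2 Kn.
Qed.

Section OppositeSfli.
Variable R : pzRingType.

(** The flat dimension of [I] is bounded by showing Ext^(n+1)(N, I^+) = 0 for all [N]: the n-th
    syzygy of the periodic complex has a flat term, and (3) extends maps from its cycles into
    I^+. *)
Lemma F_totally_acyclic_sfli n :
  (forall E : lmodType R, injective_module E -> flat_module (syzn n E)) ->
  acyclic_flats_F_totally_acyclic R ->
  forall I : lmodType R^c, injective_module I -> flat_module (syzn n I).
Proof.
move=> Rn Ftac I Iinj; apply: idle_char_flat => N.
have [G [E [i [p [ip Einj [u [r ur]]]]]]] := periodic_ses N true.
apply: (ext_retract_l ur).
pose D k (T : lmodType R) := idle k (dual T).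
have Tn : D n (dsum2 (dfin true (fun j => free_cover (syzn j N))) E).
  move=> A; apply: (ext_mid (dual_ses (pair_ses _ _))).
    exact: ((idle_dual_flat n E).2 (Rn E Einj)).
  apply: ext_inj; apply: proj_dual_injective; apply: dfin_projective => j.
  exact: cover_projective.
have [|T [i' [p' [ip' D0T]]]] := periodic_syzn (D := D) _ ip Tn.
  move=> k K F T j q jq Fproj.
  exact: (idle_cosyz k (dual_ses jq) (proj_dual_injective Fproj)).1.
have {D0T} Tdual : injective_module (dual T) by apply/idle0P.
(* By adjunction this is the vanishing of Ext^1(I, T^+), and T^+ is injective. *)
have TI : ext1 T (character I).
  move=> f; have [h hP] := flip_char_dual f.
  have [g gP] := ext1_lift h (dual_ses (syz_ses T)) (ext1_inj (A := I) Tdual).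
  have [k kP] := flip_dual_char g; exists k => x; apply: char_ext => y.
  by rewrite kP -dual_mapE gP hP.
apply: (ext1_of_extend ip' TI) => f.
have [x|g gP] := constant_tensor_exact (h := f \o p') (periodic_exact ip') Ftac
  (dual_injective_flat Tdual) Iinj.
  by rewrite /= (ses_comp _ ip') linear0.
exists g => x; have [_ _ ps] := ip'; have [y <-] := ps x.
exact/esym/gP.
Qed.

End OppositeSfli.

Section FiniteSpli.
Variables (R : pzRingType) (n : nat).
Hypothesis spli_n : forall I : lmodType R, injective_module I -> pdle n I.
Hypothesis Ftac : acyclic_flats_F_totally_acyclic R.
Hypothesis Hchar : forall E : lmodType R^c, injective_module E ->
  exists m, idle m (dual (character E)).

(** Finite flat dimension, read off from the dual. *)
Let ffd (M : lmodType R) := exists m, idle m (dual M).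

Lemma dual_character_idle m (D : lmodType R^c) : idle m D -> ffd (character D).
Proof.
elim: m D => [|m IH] D; first by move=> /idle0P/Hchar.
move=> Dm; have Hinj := hull_injective D.
have /IH Cm := (idle_cosyz m (cosyz_ses D) Hinj).1 Dm.
exact: idle_left (dual_ses (char_ses (cosyz_ses D))) (Hchar Hinj) Cm.
Qed.

Let cok (M : lmodType R) : lmodType R := quot (im_submodule (ev M)).
Let cok_ses (M : lmodType R) : ses (ev M) (proj (im_submodule (ev M))).
Proof. exact/coker_ses/ev_inj. Qed.

Section CoEvaluation.
Variable D : lmodType R^c.
Fact coev_additive (x : D) : zmod_morphism (fun xi : character D => character_fun xi x).
Proof. by []. Qed.
Fact coev_linear : linear (fun x => dual_mk (mkadd (coev_additive x))).
Proof.
move=> r x y; apply: dual_ext => xi.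
by rewrite dualP !dual_mkE !mkaddE raddfD charZ.
Qed.
Definition coev : {linear D -> dual (character D)} := mklin coev_linear.
Lemma coevE x xi : dual_fun (coev x) xi = character_fun xi x.
Proof. by rewrite mklinE dual_mkE mkaddE. Qed.
End CoEvaluation.

(** [coev] splits the dual of [ev M], so the dual of the cokernel is a retract of the dual of M^++,
    which [dual_character_idle] controls. *)
Lemma cok_ffd M : ffd M -> ffd (cok M).
Proof.
move=> [m Mm]; have [k Bk] := dual_character_idle Mm; exists k => A.
have ses_d := dual_ses (cok_ses M); have [ii _ _] := ses_d.
have [beta|rho rhoP] := ses_restrict
    (f := idfun \- (coev (dual M) \o dual_map (ev M))) ses_d.
  rewrite /= linearB; apply/eqP; rewrite subr_eq0; apply/eqP.
  by apply: dual_ext => x; rewrite [RHS]dual_mapE coevE evE.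
apply: (ext_retract_r (i := dual_map (proj (im_submodule (ev M)))) (r := rho)) (Bk A).
by move=> gamma; apply: ii; rewrite rhoP /= (ses_comp _ ses_d) linear0 subr0.
Qed.

Section HomIntoBidual.
Variables (Q : lmodType R) (d : {linear Q -> Q}).
Hypotheses (Qproj : projective_module Q) (dex : exact d d).

Let hom_exact (M : lmodType R) := forall h : {linear Q -> M}, (forall x, h (d x) = 0) ->
  exists g : {linear Q -> M}, forall x, h x = g (d x).

Lemma hom_exact_right (M' M M'' : lmodType R) (i : {linear M' -> M}) (p : {linear M -> M''}) :
  ses i p -> hom_exact M' -> hom_exact M -> hom_exact M''.
Proof.
move=> ip M'ex Mex h hd; have [ii ex ps] := ip.
have [l lP] := @Qproj _ _ p h ps.
have [x|u uP] := ses_restrict (f := l \o d) ip; first by have /= -> := lP (d x).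
have [x|u' u'P] := M'ex u.
  have ddx : d (d x) = 0 by apply/dex; exists x.
  by apply: ii; rewrite uP /= ddx !linear0.
have [x|v vP] := Mex (l \- (i \o u')).
  by rewrite /= -u'P uP /= subrr.
exists (p \o v) => x; rewrite /= -vP /= linearB (ses_comp _ ip) subr0.
exact/esym/lP.
Qed.

(** For injective [D] this is (3); in general, characters turn an injective coresolution of [D] into
    a resolution of its character module. *)
Lemma hom_exact_character m (D : lmodType R^c) : idle m D -> hom_exact (character D).
Proof.
elim: m D => [|m IH] D.
  move=> /idle0P Dinj h.
  exact: (@constant_tensor_exact R Q d dex D h Ftac (projective_flat Qproj) Dinj).
move=> Dm; have Hinj := hull_injective D.
have Cm := IH _ ((idle_cosyz m (cosyz_ses D) Hinj).1 Dm).
apply: (hom_exact_right (char_ses (cosyz_ses D)) Cm) => h.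
exact: (@constant_tensor_exact R Q d dex _ h Ftac (projective_flat Qproj) Hinj).
Qed.

Variable P : lmodType R.
Hypothesis P0 : ffd P.

Let Mk k := iter k cok P.
Let Mk_ffd k : ffd (Mk k).
Proof. by elim: k => [//|k IH]; apply: cok_ffd. Qed.
Let Mk_hom k : hom_exact (bidual (Mk k)).
Proof. by have [m Mm] := Mk_ffd k; apply: hom_exact_character Mm. Qed.

(* The pure coresolution [P -> P^++ -> ...], in degrees shifted by one. *)
Let J j : lmodType R := match j with
  | 0%N => zero_module R | 1%N => P | k.+2 => bidual (Mk k) end.
Let dJ j : {linear J j -> J j.+1} := match j return {linear J j -> J j.+1} with
  | 0%N => \0 | 1%N => ev P
  | k.+2 => ev (Mk k.+1) \o proj (im_submodule (ev (Mk k))) end.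

Let dJ_ker k y : dJ k.+2 y = 0 <-> exists x, ev (Mk k) x = y.
Proof.
rewrite /= -(linear0 (ev (Mk k.+1))); split=> [/ev_inj|yx].
  by move/(projP (im_submodule (ev (Mk k)))).
by congr (ev _ _); apply/(projP (im_submodule (ev (Mk k)))).
Qed.

Let dJ_exact j : exact (dJ j) (dJ j.+1).
Proof.
case: j => [|[|k]] y.
- split=> [|[x <-]]; last by rewrite /= linear0.
  by rewrite /= -(linear0 (ev P)) => /ev_inj ->; exists 0.
- exact: (@dJ_ker 0%N y).
rewrite dJ_ker; split=> [[x <-]|[x <-]].
  by have [z <-] := proj_surj (im_submodule (ev (Mk k))) x; exists z.
by exists (proj (im_submodule (ev (Mk k))) x).
Qed.

Let dJ_pure (B : choiceType) j : pure_in B (fun x => dJ j x = 0).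
Proof.
case: j => [|[|k]] s t a psi us ut spsi.
- by exists psi; split.
- exists (fun=> 0); split=> [b|b bs]; first by rewrite linear0.
  rewrite big1 => [|b' _]; last by rewrite scaler0.
  by apply/esym; have := spsi b bs; rewrite /= -[X in _ = X](linear0 (ev P)) => /ev_inj.
have [b bs|g [gE gP]] := ev_pure (M := Mk k) (a := a) (psi := psi) us ut.
  exact/dJ_ker/spsi.
by exists g; split=> // b; apply/dJ_ker/gE.
Qed.

Lemma hom_exact_projective : hom_exact P.
Proof.
move=> g0 g0d.
(* A cocycle into [Mk k] becomes a coboundary f \o d in the bidual, and [f] induces a cocycle into
   [Mk k.+1]. Iterating gives the chain map into [J]. *)
pose St k := {g : {linear Q -> Mk k} | forall x, g (d x) = 0}.
have step k (u : St k) : exists f : {linear Q -> bidual (Mk k)},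
    forall x, ev (Mk k) (sval u x) = f (d x).
  by have [x|f fP] := @Mk_hom k (ev (Mk k) \o sval u); [rewrite /= (svalP u) linear0|exists f].
pose fs k u := sval (cid (step k u)).
have fsP k (u : St k) x : ev (Mk k) (sval u x) = fs k u (d x) by rewrite /fs; case: cid.
have fsd k (u : St k) x : (proj (im_submodule (ev (Mk k))) \o fs k u) (d x) = 0.
  by rewrite /= -fsP (ses_comp _ (cok_ses (Mk k))).
pose st k : St k := nat_rect St (exist _ g0 g0d) (fun k u => exist _ _ (fsd k u)) k.
pose f j : {linear Q -> J j.+1} := match j return {linear Q -> J j.+1} with
  | 0%N => g0 | k.+1 => fs k (st k) end.
have fchain j x : dJ j.+1 (f j x) = f j.+1 (d x) by case: j => [|k]; [exact: (@fsP 0%N (st 0%N) x)|exact: (@fsP k.+1 (st k.+1) x)].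
(* [null_homotopy] concerns free modules: [d] is transported to the free cover, of which [Q] is a
   retract. *)
have [sg sgP] := @Qproj _ _ (cover Q) idfun (@cover_surj R Q).
have {}sgP x : cover Q (sg x) = x by exact: sgP.
pose delta : {linear free_cover Q -> free_cover Q} := sg \o d \o cover Q.
have [x|j x|s sP] := @null_homotopy R Q J dJ dJ_exact (@dJ_pure _) delta (fun j => f j \o cover Q).
- have dd0 : d (d (cover Q x)) = 0 by apply/dex; exists (cover Q x).
  by rewrite /delta /= sgP dd0 linear0.
- by rewrite /delta /= sgP; apply: fchain.
(* Since [J 0] is zero, the homotopy in degree 0 reads g0 = s 1 after the differential. *)
exists (s 1%N \o sg) => x; have := sP 0%N (sg x).
by rewrite /delta /= !sgP add0r.
Qed.

End HomIntoBidual.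

Lemma F_totally_acyclic_silp : ele (silp R) (Fin n).
Proof.
apply/silpP => P Pproj N.
have [G [E [i [p [ip Einj [u [r ur]]]]]]] := periodic_ses N true.
apply: (ext_retract_l ur).
have Tn : pdle n (dsum2 (dfin true (fun j => free_cover (syzn j N))) E).
  (* [E] is an infinite product, but it is injective, so the bound on spli covers it. *)
  apply: pdle_pair; last exact: spli_n.
  apply: (pdle_le (leq0n n)); apply/pdle0P; apply: dfin_projective => j.
  exact: cover_projective.
have [|Q [i' [p' [ip' /pdle0P Qproj]]]] := periodic_syzn (D := @pdle R) _ ip Tn.
  by move=> k K F T j q jq Fproj; exact: (pdle_syz k jq Fproj).1.
apply: (ext1_of_extend ip' (@ext1_proj _ Q P Qproj)) => f.
have Pffd : ffd P by exists 0%N; apply/idle0P/proj_dual_injective.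
have [x|g gP] := hom_exact_projective Qproj (periodic_exact ip') Pffd (h := f \o p').
  by rewrite /= (ses_comp _ ip') linear0.
by exists g => x; have [_ _ ps] := ip'; have [y <-] := ps x; exact/esym/gP.
Qed.

End FiniteSpli.

Lemma ele_eq (a b : enat) : (forall n, ele a (Fin n) <-> ele b (Fin n)) -> a = b.
Proof.
case: a b => [m|] [k|] // ab.
- by congr Fin; apply/eqP; rewrite eqn_leq; apply/andP; split; [apply/ab|apply/ab]; exact: leqnn.
- by have /= := (ab m).1 (leqnn m).
- by have /= := (ab k).2 (leqnn k).
Qed.

Theorem corollary1p3 (R : pzRingType)
  (Habc : (acyclic_injectives_totally_acyclic R <->
             acyclic_flats_F_totally_acyclic R) \/
          (acyclic_injectives_totally_acyclic R <->
             acyclic_injectives_totally_acyclic R^c%type) \/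
          (acyclic_flats_F_totally_acyclic R <->
             acyclic_flats_F_totally_acyclic R^c%type))
  (Hchar : forall E : lmodType R^c,
     injective_module E -> flat_dim (character E) <> Infinity) :
  spli R = silp R.
Proof.
have op2_3 := @totally_acyclic_F_totally_acyclic R.
have two_3op : acyclic_injectives_totally_acyclic R -> acyclic_flats_F_totally_acyclic R^c%type.
  move=> tac; apply: totally_acyclic_F_totally_acyclic.
  by rewrite converseK.
apply: ele_eq => n; split=> [/spliP Rn|/silpP Rn].
  have two : acyclic_injectives_totally_acyclic R.
    apply: flat_syzn_totally_acyclic => E Einj; exists n.
    apply: projective_flat; apply/pdle0P => B; by have := Rn E Einj B.
  have three : acyclic_flats_F_totally_acyclic R.
    (* Case (b) passes through (2)^op and case (c) through (3)^op. *)
    by case: Habc => [[H _]|[[H _]|[_ H]]]; [exact: H|exact/op2_3/H|exact/H/two_3op].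
  apply: F_totally_acyclic_silp Rn three _ => E /Hchar/flat_dim_finite[m Em].
  by exists m; apply: flat_resolution_dual_idle.
have char_n (E : lmodType R^c) : injective_module E -> flat_module (syzn n E).
  move=> /Hchar/flat_dim_finite[m Em]; apply: idle_char_flat.
  exact: flat_resolution_idle Rn _ _ Em.
have op2 : acyclic_injectives_totally_acyclic R^c%type.
  by apply: flat_syzn_totally_acyclic => E /char_n; exists n.
apply: (totally_acyclic_spli Rn).
(* Cases (a) and (b) lead to (2) at once. In case (c), (3)^op carries the bound on flat dimension
   from injectives over [R^c] to those over [R^c^c], that is over [R]. *)
case: Habc => [[_ H]|[[_ H]|[H _]]]; [exact/H/op2_3|exact: H|].
rewrite -[X in acyclic_injectives_totally_acyclic X]converseK.
apply: flat_syzn_totally_acyclic => I Iinj; exists n.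
exact: F_totally_acyclic_sfli char_n (H (op2_3 op2)) I Iinj.
Qed.
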